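(* Let $\mathcal U:\mathcal P_2(\mathbb R^d)\to\mathbb R$ and let $\tilde{\mathcal U}:\mathbb H\to\mathbb R$, $\tilde{\mathcal U}(x)=\mathcal U(\sharp(x))$, be its lift. Then $\mathcal U\in C^{1,1}(\mathcal P_2(\mathbb R^d))$ if and only if $\tilde{\mathcal U}\in C^{1,1}(\mathbb H)$.
   Context: $\Omega=(0,1)^d$ with Lebesgue measure $\mathcal L^d_\Omega$; $\mathbb H=L^2(\Omega;\mathbb R^d)$ with norm $\|\cdot\|$; $\sharp(x)=x_\sharp\mathcal L^d_\Omega$. $\mathcal P_2(\mathbb R^d)$ is the set of Borel probability measures with finite second moment, with distance $W_2$; $\Gamma_o(\mu,\nu)$ is the set of $W_2$-optimal plans between $\mu$ and $\nu$; $T_\mu\mathcal P_2(\mathbb R^d)$ is the closure of $\{D\varphi:\varphi\in C_c^\infty(\mathbb R^d)\}$ in $L^2(\mu)$. $\tilde{\mathcal U}\in C^{1,1}(\mathbb H)$: $\tilde{\mathcal U}$ is Fréchet differentiable and there is $C$ with $\|\nabla\tilde{\mathcal U}(x)-\nabla\tilde{\mathcal U}(y)\|\le C\|x-y\|$ for all $x,y\in\mathbb H$. $\mathcal U$ is differentiable at $\mu$ with Wasserstein gradient $\nabla_w\mathcal U(\mu)\in T_\mu\mathcal P_2(\mathbb R^d)$ if $\mathcal U(\nu)-\mathcal U(\mu)=\int\nabla_w\mathcal U(\mu)(q_1)\cdot(q_2-q_1)\,d\gamma(q_1,q_2)+o(W_2(\mu,\nu))$ for $\gamma\in\Gamma_o(\mu,\nu)$.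 It is known that this is equivalent to Fréchet differentiability of $\tilde{\mathcal U}$ at $x$ with $\sharp(x)=\mu$, and then $\nabla\tilde{\mathcal U}(x)=\nabla_w\mathcal U(\mu)\circ x$; $\mathcal U$ is continuously differentiable if $\tilde{\mathcal U}\in C^1(\mathbb H)$. $\mathcal U\in C^{1,1}(\mathcal P_2(\mathbb R^d))$: $\mathcal U$ is continuously differentiable and there is a constant $C\ge0$ such that (1) $\mathrm{spt}(\mu)\ni q_1\mapsto\nabla_w\mathcal U(\mu)(q_1)$ is Lipschitz with constant $C$ for every $\mu$, and (2) $\big|\mathcal U(\nu)-\mathcal U(\mu)-\int\nabla_w\mathcal U(\mu)(q_1)\cdot(q_2-q_1)\,d\gamma(q_1,q_2)\big|\le CW_2^2(\mu,\nu)$ for all $\mu,\nu\in\mathcal P_2(\mathbb R^d)$ and all $\gamma\in\Gamma_o(\mu,\nu)$. *)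

(* Defs.v *)
From HB Require Import structures.
From mathcomp Require Import all_boot all_order all_algebra.
From mathcomp Require Import all_classical all_reals all_analysis measurable_realfun.

Set Implicit Arguments.
Unset Strict Implicit.
Unset Printing Implicit Defensive.
Import Order.TTheory GRing.Theory Num.Theory.
Import numFieldNormedType.Exports.

Local Open Scope classical_set_scope.
Local Open Scope ring_scope.

(* Borel sigma-algebra of R^d (row vectors). *)
Section borel.
Context {R : realType} (d : nat).

HB.instance Definition _ := @isMeasurable.Build
  (sigma_display (@open 'rV[R]_d)) 'rV[R]_d <<s @open 'rV[R]_d >>
  (@sigma_algebra0 _ setT _) (@sigma_algebraC _ _)
  (@sigma_algebra_bigcup _ setT _).

Lemma open_measurable_rV (A : set 'rV[R]_d) : open A -> measurable A.
Proof. by move=> oA; exact: sub_sigma_algebra. Qed.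

Lemma measurable_coord (i : 'I_d) :
  measurable_fun [set: 'rV[R]_d] (fun v => v ord0 i).
Proof.
apply: (measurability _ (RGenOInfty.measurableE R)) => _ [_ [a ->] <-].
rewrite setTI; apply: open_measurable_rV.
apply: open_comp; last exact: interval_open.
by move=> v _; exact: coord_continuous.
Qed.

Lemma measurable_fun_rV disp (T : measurableType disp) (f : T -> 'rV[R]_d) :
  (forall i, measurable_fun setT (fun t => f t ord0 i)) ->
  measurable_fun setT f.
Proof.
move=> mf; apply: (@measurability _ _ _ _ _ _ (@open 'rV[R]_d)) => // _ [U oU <-].
rewrite setTI.
pose B (k : 'rV[rat]_d * rat) : set 'rV[R]_d :=
  ball (map_mx (@ratr R) k.1) (ratr k.2).
have -> : f @^-1` U = \bigcup_(k in [set k | B k `<=` U]) (f @^-1` B k).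
  apply/seteqP; split=> [t /= Ut|t [k kU Bt]]; last exact: kU.
  have /nbhs_ballP[e /= e0 eU] : nbhs (f t) U by exact: open_nbhs_nbhs.
  have [r] := @rat_in_itvoo R 0 (e / 2) (divr_gt0 e0 (ltr0n _ 2)).
  rewrite in_itv/= => /andP[r0 re].
  have /choice[c hc] : forall i : 'I_d, exists q : rat,
      `|ratr q - f t ord0 i| < ratr r.
    move=> i; have [] := @rat_in_itvoo R (f t ord0 i - ratr r) (f t ord0 i + ratr r).
      by rewrite ltrD2l (lt_trans _ r0)// oppr_lt0.
    move=> q; rewrite in_itv/= => hq; exists q.
    by rewrite ltr_distl.
  exists (\row_i c i, r) => /=.
    move=> z [_ Bz]; apply: eU; split=> // i j; rewrite (ord1 i).
    have := Bz ord0 j; rewrite !mxE /ball /= => zc.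
    rewrite (splitr e); apply: (@le_lt_trans _ _
      (`|f t ord0 j - ratr (c j)| + `|ratr (c j) - z ord0 j|)).
      by rewrite -[X in `|X|](subrKA (ratr (c j))) ler_normD.
    by rewrite ltrD// (lt_trans _ re)// distrC.
  by split=> //= i j; rewrite (ord1 i) !mxE /ball /=.
rewrite bigcup_mkcond; apply: countable_bigcupT_measurable => [|k].
  exact: countableP.
case: ifPn => // _; have [k0|k0] := ltP (0 : R) (ratr k.2); last first.
  rewrite [X in measurable X](_ : _ = set0) //.
  by apply/seteqP; split => // t [] /=; rewrite ltNge k0.
have -> : f @^-1` B k = \bigcap_(i in [set: 'I_d])
    ((fun t => f t ord0 i) @^-1` ball (ratr (k.1 ord0 i) : R) (ratr k.2)).
  apply/seteqP; split=> t /= Bt.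
    by move=> i _; have := Bt.2 ord0 i; rewrite mxE.
  by split=> // i j; rewrite (ord1 i) mxE; exact: Bt.
apply: fin_bigcap_measurable => [|i _]; first exact: finite_finset.
rewrite -[X in measurable X]setTI.
by apply: mf => //; exact: measurable_ball.
Qed.
End borel.

(* Lebesgue measure on R^d, as the d-fold product of the one-dimensional one. *)
Section lebesgue_rV.
Context {R : realType}.

Definition cons_rV n (p : R * 'rV[R]_n) : 'rV[R]_n.+1 :=
  \row_i oapp (p.2 ord0) p.1 (unlift ord0 i).

Lemma cons_rV0 n (p : R * 'rV[R]_n) : cons_rV p ord0 ord0 = p.1.
Proof. by rewrite mxE unlift_none. Qed.

Lemma cons_rVS n (p : R * 'rV[R]_n) (i : 'I_n) :
  cons_rV p ord0 (lift ord0 i) = p.2 ord0 i.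
Proof. by rewrite mxE liftK. Qed.

Definition uncons_rV n (v : 'rV[R]_n.+1) : R * 'rV[R]_n :=
  (v ord0 ord0, \row_i v ord0 (lift ord0 i)).

Lemma cons_rVK n : cancel (@cons_rV n) (@uncons_rV n).
Proof.
move=> [a v]; rewrite /uncons_rV cons_rV0; congr (_, _).
by apply/rowP => i; rewrite mxE cons_rVS.
Qed.

Lemma uncons_rVK n : cancel (@uncons_rV n) (@cons_rV n).
Proof.
move=> v; apply/rowP => i; rewrite mxE.
by case: unliftP => [j ->|->] //=; rewrite mxE.
Qed.

Lemma measurable_cons_rV n : measurable_fun setT (@cons_rV n).
Proof.
apply: measurable_fun_rV => i; case: (unliftP ord0 i) => [j ->|->].
  rewrite (_ : (fun _ => _) = (fun v : 'rV[R]_n => v ord0 j) \o snd).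
    exact: measurableT_comp (measurable_coord j) measurable_snd.
  by apply/funext => p; rewrite cons_rVS.
rewrite (_ : (fun _ => _) = fst); first exact: measurable_fst.
by apply/funext => p; rewrite cons_rV0.
Qed.

Lemma measurable_uncons_rV n : measurable_fun setT (@uncons_rV n).
Proof.
apply: measurable_fun_pair; first exact: measurable_coord.
apply: measurable_fun_rV => i; under eq_fun do rewrite mxE.
exact: measurable_coord.
Qed.

Section cons_measure.
Context n (mu : {sigma_finite_measure set 'rV[R]_n -> \bar R}).

Definition lebesgue_cons : set 'rV[R]_n.+1 -> \bar R :=
  pushforward (@lebesgue_measure R \x mu)%E (@cons_rV n).

Let lebesgue_cons0 : lebesgue_cons set0 = 0%E.
Proof. by rewrite /lebesgue_cons /pushforward preimage_set0 measure0. Qed.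

Let lebesgue_cons_ge0 A : (0 <= lebesgue_cons A)%E.
Proof. by rewrite /lebesgue_cons /pushforward measure_ge0. Qed.

Let lebesgue_cons_sigma_additive : semi_sigma_additive lebesgue_cons.
Proof.
move=> F mF tF mUF; rewrite /lebesgue_cons /pushforward preimage_bigcup.
apply: measure_semi_sigma_additive.
- by move=> k; rewrite -[X in measurable X]setTI; exact: measurable_cons_rV.
- apply/trivIsetP => /= i j _ _ ij; rewrite -preimage_setI.
  by move/trivIsetP : tF => /(_ _ _ _ _ ij) ->//; rewrite preimage_set0.
- rewrite -preimage_bigcup -[X in measurable X]setTI.
  exact: measurable_cons_rV.
Qed.

HB.instance Definition _ := isMeasure.Build _ _ _ lebesgue_cons
  lebesgue_cons0 lebesgue_cons_ge0 lebesgue_cons_sigma_additive.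

Let lebesgue_cons_sigma_finite : sigma_finite setT lebesgue_cons.
Proof.
have /sigma_finiteP[F [TF ndF Foo]] := sigma_finiteT (@lebesgue_measure R).
have /sigma_finiteP[G [TG ndG Goo]] := sigma_finiteT mu.
exists (fun k => @uncons_rV n @^-1` (F k `*` G k)).
  apply/seteqP; split => // v _.
  have [k _ Fk] : (\bigcup_k F k) (uncons_rV v).1 by rewrite -TF.
  have [l _ Gl] : (\bigcup_k G k) (uncons_rV v).2 by rewrite -TG.
  exists (maxn k l) => //; split.
  - by move: Fk; exact/subsetPset/ndF/leq_maxl.
  - by move: Gl; exact/subsetPset/ndG/leq_maxr.
move=> k; have [mF Fk] := Foo k; have [mG Gk] := Goo k; split.
  rewrite -[X in measurable X]setTI; apply: measurable_uncons_rV => //.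
  exact: measurableX.
rewrite /lebesgue_cons /pushforward -comp_preimage.
rewrite [X in X @^-1` _](_ : _ = id); last by apply/funext => p; exact: cons_rVK.
by rewrite preimage_id product_measure1E// lte_mul_pinfty// ge0_fin_numE.
Qed.

HB.instance Definition _ := Measure_isSigmaFinite.Build _ _ _ lebesgue_cons
  lebesgue_cons_sigma_finite.

End cons_measure.

Fixpoint lebesgue_rV n : {sigma_finite_measure set 'rV[R]_n -> \bar R} :=
  match n with
  | 0 => [the {sigma_finite_measure set 'rV[R]_0 -> \bar R} of dirac (0 : 'rV[R]_0)]
  | n'.+1 => [the {sigma_finite_measure set 'rV[R]_n'.+1 -> \bar R} of
               lebesgue_cons (lebesgue_rV n')]
  end.

Lemma measurable_box n (A : 'I_n -> set R) :
  (forall i, measurable (A i)) ->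
  measurable [set v : 'rV[R]_n | forall i, A i (v ord0 i)].
Proof.
move=> mA.
have -> : [set v : 'rV[R]_n | forall i, A i (v ord0 i)] =
    \bigcap_(i in [set: 'I_n]) ((fun v : 'rV[R]_n => v ord0 i) @^-1` A i).
  by apply/seteqP; split => [v vA i _|v vA i]; [exact: vA|exact: (vA i)].
apply: fin_bigcap_measurable => [|i _]; first exact: finite_finset.
by rewrite -[X in measurable X]setTI; exact: measurable_coord.
Qed.

Lemma lebesgue_rV_box n (A : 'I_n -> set R) :
  (forall i, measurable (A i)) ->
  lebesgue_rV n [set v | forall i, A i (v ord0 i)]
  = (\prod_(i < n) lebesgue_measure (A i))%E.
Proof.
elim: n A => [|n IH] A mA.
  rewrite big_ord0 /= diracE mem_set//=.
  by case.
have mB := measurable_box (fun j => mA (lift ord0 j)).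
rewrite big_ord_recl -IH//= -product_measure1E//; last exact: mA.
rewrite /lebesgue_cons /pushforward.
congr (_ _); apply/seteqP; split=> [p /= pA|p /= [p1 p2] i].
  by split=> [|i]; [have := pA ord0; rewrite cons_rV0|
    have := pA (lift ord0 i); rewrite cons_rVS].
by case: (unliftP ord0 i) => [j ->|->]; rewrite ?cons_rVS ?cons_rV0.
Qed.

Definition Omega d : set 'rV[R]_d := [set v | forall i, 0 < v ord0 i < 1].
Arguments Omega d : clear implicits.

Lemma OmegaE d : Omega d = [set v | forall i, `]0, 1[%classic (v ord0 i)].
Proof. by apply/seteqP; split => v vO i; have := vO i; rewrite /= in_itv. Qed.

Lemma measurable_Omega d : measurable (Omega d).
Proof.
rewrite OmegaE; apply: (@measurable_box _ (fun=> `]0, 1[%classic)) => i.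
exact: measurable_itv.
Qed.

(* L^d restricted to Omega, as a measure on R^d carried by Omega. *)
Definition leb_Omega d : set 'rV[R]_d -> \bar R :=
  mrestr (lebesgue_rV d) (@measurable_Omega d).

HB.instance Definition _ d := Measure.on (@leb_Omega d).

Let leb_OmegaT d : @leb_Omega d setT = 1%E.
Proof.
rewrite /leb_Omega /mrestr setTI.
rewrite OmegaE (@lebesgue_rV_box _ (fun=> `]0, 1[%classic)) ?big1// => i _.
by rewrite lebesgue_measure_itv/= lte_fin ltr01 oppr0 adde0.
Qed.

HB.instance Definition _ d :=
  Measure_isProbability.Build _ _ _ (@leb_Omega d) (@leb_OmegaT d).

End lebesgue_rV.
Arguments leb_Omega {R} d.

Section euclidean.
Context {R : realType} {d : nat}.
Implicit Types u v : 'rV[R]_d.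

Definition dotp u v : R := \sum_(i < d) u ord0 i * v ord0 i.

(* The norm [`|v|] of the library on matrices is the sup norm. *)
Definition enorm v : R := Num.sqrt (dotp v v).

Lemma measurable_enorm : measurable_fun [set: 'rV[R]_d] enorm.
Proof.
apply: measurableT_comp.
  by apply: continuous_measurable_fun; exact: sqrt_continuous.
by apply: measurable_sum => i; apply: measurable_funM; exact: measurable_coord.
Qed.

End euclidean.

(* Elements of H are represented by functions, not by classes modulo equality
   almost everywhere: [L2norm] below is then a seminorm, whose kernel is that
   equality, and every notion on H is stated through it. *)
Section hilbert.
Context (R : realType) (d : nat).

Record H := MkH {
  H_fun :> {mfun 'rV[R]_d >-> 'rV[R]_d} ;
  H_finite : finite_norm (leb_Omega d) 2%:E (enorm \o H_fun) }.

End hilbert.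

Section L2.
Context {R : realType} {d : nat}.
Implicit Types mu : {measure set 'rV[R]_d -> \bar R}.

Definition L2norm mu (f : 'rV[R]_d -> 'rV[R]_d) : R :=
  fine 'N[mu]_2%:E[EFin \o (enorm \o f)].

Definition normH (f : 'rV[R]_d -> 'rV[R]_d) : R := L2norm (leb_Omega d) f.

Definition dotH (f g : 'rV[R]_d -> 'rV[R]_d) : R :=
  \int[leb_Omega d]_w dotp (f w) (g w).

Definition is_gradH (F : H R d -> R) (x p : H R d) : Prop :=
  forall e : R, 0 < e -> exists2 r : R, 0 < r &
    forall y : H R d, normH (y \- x) < r ->
      `|F y - F x - dotH p (y \- x)| <= e * normH (y \- x).

Definition C1_H (F : H R d -> R) : Prop :=
  exists G : H R d -> H R d, (forall x, is_gradH F x (G x)) /\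
    forall (x : H R d) (e : R), 0 < e -> exists2 r : R, 0 < r &
      forall y : H R d, normH (y \- x) < r -> normH (G y \- G x) < e.

Definition C11_H (F : H R d -> R) : Prop :=
  exists G : H R d -> H R d, (forall x, is_gradH F x (G x)) /\
    exists C : R, forall x y : H R d, normH (G x \- G y) <= C * normH (x \- y).

End L2.

Section wasserstein.
Context (R : realType) (d : nat).

Record P2 := MkP2 {
  P2_prob :> probability 'rV[R]_d R ;
  P2_finite : (\int[P2_prob]_q (enorm q ^+ 2)%:E < +oo)%E }.

(* A [probability] also takes irrelevant values on non-measurable sets, so that
   one Borel measure has several representatives in [P2]. The functions on
   P_2(R^d) are the maps that identify these. *)
Definition P2_function (U : P2 -> R) : Prop :=
  forall mu nu : P2, (forall A, measurable A -> mu A = nu A) -> U mu = U nu.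

End wasserstein.

Section sharp.
Context {R : realType} {d : nat}.

Lemma sharp_finite (x : H R d) :
  (\int[distribution (leb_Omega d) x]_q (enorm q ^+ 2)%:E < +oo)%E.
Proof.
rewrite ge0_integral_distribution//; last 2 first.
  apply/measurable_EFinP; apply: measurable_funX; exact: measurable_enorm.
  by move=> q; rewrite lee_fin sqr_ge0.
have := H_finite x; rewrite /finite_norm => /(poweR_lty 2).
rewrite poweR_Lnorm//; congr (_ < _)%E; apply: eq_integral => w _ /=.
by rewrite powR_mulrn ?ger0_norm ?sqrtr_ge0.
Qed.

Definition sharp (x : H R d) : P2 R d := MkP2 (sharp_finite x).

Definition lift_P2 (U : P2 R d -> R) : H R d -> R := U \o sharp.

End sharp.

Section transport.
Context {R : realType} {d : nat}.
Implicit Types (mu nu : P2 R d) (gamma : probability ('rV[R]_d * 'rV[R]_d)%type R).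

Definition couplings mu nu : set (probability ('rV[R]_d * 'rV[R]_d)%type R) :=
  [set gamma | forall A, measurable A ->
    gamma (A `*` setT) = mu A /\ gamma (setT `*` A) = nu A].

Definition cost gamma : \bar R :=
  (\int[gamma]_z (enorm (z.1 - z.2) ^+ 2)%:E)%E.

Definition W2 mu nu : R :=
  Num.sqrt (fine (ereal_inf [set cost gamma | gamma in couplings mu nu])).

Definition optimal mu nu : set (probability ('rV[R]_d * 'rV[R]_d)%type R) :=
  [set gamma | couplings mu nu gamma /\
    forall gamma', couplings mu nu gamma' -> (cost gamma <= cost gamma')%E].

Definition spt mu : set 'rV[R]_d :=
  [set q | forall V, open_nbhs q V -> (0 < mu V)%E].

Definition iter_partial (s : seq 'I_d) (phi : 'rV[R]_d -> R) : 'rV[R]_d -> R :=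
  foldr (fun i f => 'D_(delta_mx ord0 i) f) phi s.

Definition test_function (phi : 'rV[R]_d -> R) : Prop :=
  (forall s, continuous (iter_partial s phi) /\
     forall i q, derivable (iter_partial s phi) q (delta_mx ord0 i)) /\
  compact (closure [set q | phi q != 0]).

Definition grad (phi : 'rV[R]_d -> R) (q : 'rV[R]_d) : 'rV[R]_d :=
  \row_i 'D_(delta_mx ord0 i) phi q.

(* T_mu P_2(R^d); its elements are again represented by functions. *)
Definition tangent mu : set ('rV[R]_d -> 'rV[R]_d) :=
  [set g | [/\ measurable_fun setT g, finite_norm mu 2%:E (enorm \o g) &
    forall e : R, 0 < e -> exists2 phi, test_function phi &
      L2norm mu (g \- grad phi) < e]].

Definition first_order (g : 'rV[R]_d -> 'rV[R]_d) gamma : R :=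
  \int[gamma]_z dotp (g z.1) (z.2 - z.1).

Definition is_wgrad (U : P2 R d -> R) mu (g : 'rV[R]_d -> 'rV[R]_d) : Prop :=
  tangent mu g /\
  forall e : R, 0 < e -> exists2 r : R, 0 < r &
    forall nu gamma, optimal mu nu gamma -> W2 mu nu < r ->
      `|U nu - U mu - first_order g gamma| <= e * W2 mu nu.

Definition C1_P2 (U : P2 R d -> R) : Prop := C1_H (lift_P2 U).

(* The Wasserstein gradient is only determined almost everywhere: [gradU mu] is
   the representative which is Lipschitz on the support of [mu]. *)
Definition C11_P2 (U : P2 R d -> R) : Prop :=
  C1_P2 U /\
  exists gradU : P2 R d -> 'rV[R]_d -> 'rV[R]_d,
    (forall mu, is_wgrad U mu (gradU mu)) /\
    exists C : R, [/\ 0 <= C,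
      forall mu q q', spt mu q -> spt mu q' ->
        enorm (gradU mu q - gradU mu q') <= C * enorm (q - q') &
      forall mu nu gamma, optimal mu nu gamma ->
        `|U nu - U mu - first_order (gradU mu) gamma| <= C * W2 mu nu ^+ 2].

End transport.

(* Main.v *)
(* The lift of [U] at [x] depends only on the law of [x].

   From left to right: a map [x] with finitely many values is the nearest point
   among those values to a small perturbation [x + s h], hence the coupling of
   their laws through Omega is optimal and (2) is a second-order estimate of the
   lift along [x + s h] for small [s]. A one-dimensional maximum argument makes it
   global, density makes it valid for all pairs, and a two-sided quadratic
   estimate forces the gradient to be Lipschitz.

   From right to left: the lift is invariant under measure-preserving involutions.
   Swapping small sets around two points [w], [w'] of the support of [(x, G x)] turns the
   Lipschitz estimate of the gradient [G] into [|G x w - G x w'| <= C |x w - x w'|],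
   so that [G x = g o x] with [g] Lipschitz, and [g] depends only on the law of [x].
   Every coupling is the law of a pair of maps on Omega, which gives (2).
   For tangency, replace [x] by the constant [q] on a thin slab of Omega: the
   lift at this modification, divided by the measure of the slab, is a C^{1,1} function of [q]
   whose gradient is close to [g]; gradients of C^{1,1} functions on R^d are
   in turn approximated by gradients of test functions, which glue the
   first-order Taylor polynomials at the nodes of a grid. *)

Require Import Defs.
From HB Require Import structures.
From mathcomp Require Import all_boot all_order all_algebra.
From mathcomp Require Import all_classical all_reals all_analysis.
From mathcomp Require Import measurable_realfun ring lra zify.

Set Implicit Arguments.
Unset Strict Implicit.
Unset Printing Implicit Defensive.
Import Order.TTheory GRing.Theory Num.Theory.
Import numFieldNormedType.Exports.

Local Open Scope classical_set_scope.
Local Open Scope ring_scope.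

(** * Euclidean space and square-integrable maps *)

(** Condition (2) speaks of optimal plans only, whereas a gradient on H is tested along all
    segments. Near a map with finitely many values short segments are optimal, but the admissible
    length varies along a segment and may tend to 0; the passage from local to global must therefore
    keep the constant.

    Conversely, an optimal plan is carried by maps other than the one chosen to define the gradient
    at its first marginal, which is why the gradient must be a function of the law. Composition with
    a swap is an isometry of H equal to its own inverse, so it carries gradients to gradients; the
    pair (x, G x) is localized instead of x because both must be nearly constant on the swapped
    sets.

    The slab supplies a potential: for perturbations constant on it, squared norms and first-order
    terms both carry its measure as a factor, and dividing by it leaves bounds independent of n.
    Gluing Taylor polynomials takes the place of a convolution; the constants of its error bounds do
    not depend on the mesh, so that dominated convergence applies. *)

Section euclidean_space.
Context {R : realType} {n : nat}.
Implicit Types u v w : 'rV[R]_n.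

Lemma dotpC u v : dotp u v = dotp v u.
Proof. by apply: eq_bigr => i _; rewrite mulrC. Qed.

Lemma dotpDl u v w : dotp (u + v) w = dotp u w + dotp v w.
Proof. by rewrite /dotp -big_split; apply: eq_bigr => i _; rewrite mxE mulrDl. Qed.

Lemma dotpZl (a : R) u v : dotp (a *: u) v = a * dotp u v.
Proof. by rewrite /dotp mulr_sumr; apply: eq_bigr => i _; rewrite mxE mulrA. Qed.

Lemma dotpNl u v : dotp (- u) v = - dotp u v.
Proof. by rewrite -scaleN1r dotpZl mulN1r. Qed.

Lemma dotpBl u v w : dotp (u - v) w = dotp u w - dotp v w.
Proof. by rewrite dotpDl dotpNl. Qed.

Lemma dotpDr u v w : dotp w (u + v) = dotp w u + dotp w v.
Proof. by rewrite dotpC dotpDl !(dotpC w). Qed.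

Lemma dotpZr (a : R) u v : dotp v (a *: u) = a * dotp v u.
Proof. by rewrite dotpC dotpZl (dotpC v). Qed.

Lemma dotpNr u v : dotp v (- u) = - dotp v u.
Proof. by rewrite dotpC dotpNl (dotpC v). Qed.

Lemma dotpBr u v w : dotp w (u - v) = dotp w u - dotp w v.
Proof. by rewrite dotpDr dotpNr. Qed.

Lemma dotp0l u : dotp 0 u = 0.
Proof. by rewrite -(scale0r 0) dotpZl mul0r. Qed.

Lemma dotp0r u : dotp u 0 = 0.
Proof. by rewrite dotpC dotp0l. Qed.

Lemma dotp_ge0 u : 0 <= dotp u u.
Proof. by apply: sumr_ge0 => i _; rewrite -expr2 sqr_ge0. Qed.

Lemma dotp_eq0 u : dotp u u = 0 -> u = 0.
Proof.
move=> /eqP; rewrite psumr_eq0 => [/allP u0|i _]; last by rewrite -expr2 sqr_ge0.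
apply/rowP => i; have := u0 i; rewrite mem_index_enum => /(_ isT)/=.
by rewrite -expr2 sqrf_eq0 mxE => /eqP.
Qed.

Lemma enorm_ge0 u : 0 <= enorm u.
Proof. exact: sqrtr_ge0. Qed.

Lemma sqr_enorm u : enorm u ^+ 2 = dotp u u.
Proof. by rewrite sqr_sqrtr ?dotp_ge0. Qed.

Lemma enorm0 : enorm (0 : 'rV[R]_n) = 0.
Proof. by rewrite /enorm dotp0l sqrtr0. Qed.

Lemma enorm_eq0 u : enorm u = 0 -> u = 0.
Proof. by move=> u0; apply: dotp_eq0; rewrite -sqr_enorm u0 expr0n. Qed.

Lemma enormZ a u : enorm (a *: u) = `|a| * enorm u.
Proof.
by rewrite /enorm dotpZl dotpZr mulrA -expr2 sqrtrM ?sqr_ge0// sqrtr_sqr.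
Qed.

Lemma enormN u : enorm (- u) = enorm u.
Proof. by rewrite /enorm dotpNl dotpNr opprK. Qed.

Lemma enormC u v : enorm (u - v) = enorm (v - u).
Proof. by rewrite -enormN opprB. Qed.

(** Cauchy-Schwarz from the nonnegative square of [enorm v *: u - enorm u *: v], divided by |u| |v|;
    vectors of norm zero are set apart first. *)
Lemma dotp_le_sqr u v : dotp u v <= enorm u * enorm v.
Proof.
have [u0|u0] := eqVneq (enorm u) 0.
  by rewrite u0 mul0r (enorm_eq0 u0) dotp0l.
have [v0|v0] := eqVneq (enorm v) 0.
  by rewrite v0 mulr0 (enorm_eq0 v0) dotp0r.
have pu : 0 < enorm u by rewrite lt_neqAle eq_sym u0 enorm_ge0.
have pv : 0 < enorm v by rewrite lt_neqAle eq_sym v0 enorm_ge0.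
have := dotp_ge0 (enorm v *: u - enorm u *: v).
rewrite dotpBl !dotpBr !dotpZl !dotpZr -!sqr_enorm (dotpC v u) => h.
have /ler_pM2l <- : 0 < enorm u * enorm v by rewrite mulr_gt0.
by nra.
Qed.

Lemma norm_dotp u v : `|dotp u v| <= enorm u * enorm v.
Proof.
by rewrite ler_norml dotp_le_sqr andbT lerNl -dotpNl -[enorm u]enormN dotp_le_sqr.
Qed.

Lemma enormD u v : enorm (u + v) <= enorm u + enorm v.
Proof.
rewrite -(@ler_pXn2r _ 2)// ?nnegrE ?addr_ge0 ?enorm_ge0//.
rewrite sqr_enorm dotpDl !dotpDr -!sqr_enorm (dotpC v u) sqrrD.
have := dotp_le_sqr u v; lra.
Qed.

Lemma enorm_dist u v w : enorm (u - v) <= enorm (u - w) + enorm (w - v).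
Proof. by rewrite -[u - v](subrKA w) enormD. Qed.

Lemma enorm_le_sum u : enorm u <= \sum_(i < n) `|u ord0 i|.
Proof.
rewrite -(@ler_pXn2r _ 2)// ?nnegrE ?enorm_ge0 ?sumr_ge0//.
rewrite sqr_enorm expr2 mulr_sumr ler_sum// => i _.
rewrite -expr2 -[leLHS]real_normK ?num_real// expr2 ler_wpM2r//.
by rewrite (bigD1 i)//= lerDl sumr_ge0.
Qed.

Lemma coord_le_enorm u i : `|u ord0 i| <= enorm u.
Proof.
rewrite -(@ler_pXn2r _ 2)// ?nnegrE ?enorm_ge0//.
rewrite sqr_enorm /dotp (bigD1 i)//= real_normK ?num_real// -expr2 lerDl.
by apply: sumr_ge0 => j _; rewrite -expr2 sqr_ge0.
Qed.

(** The topology, hence the Borel sets, come from the sup norm; this bound and [enorm_le_norm] pass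
    between its balls and the Euclidean ones. *)
Lemma norm_le_enorm u : `|u| <= enorm u.
Proof.
rewrite [X in X <= _]mx_normrE; apply: bigmax_le => [|[i j] _]; first exact: enorm_ge0.
by rewrite (ord1 i); exact: coord_le_enorm.
Qed.

Lemma enorm_le_norm u : enorm u <= n%:R * `|u|.
Proof.
apply: (le_trans (enorm_le_sum u)).
rewrite -[n in n%:R]card_ord -sum1_card natr_sum mulr_suml ler_sum// => i _.
by rewrite mul1r [X in _ <= X]mx_normrE; exact: (le_bigmax _ (fun ij => `|u ij.1 ij.2|) (ord0, i)).
Qed.

Lemma sqr_enormD u v : enorm (u + v) ^+ 2 <= 2 * (enorm u ^+ 2 + enorm v ^+ 2).
Proof.
have := enormD u v; have := enorm_ge0 (u + v).
have := enorm_ge0 u; have := enorm_ge0 v.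
move: (enorm u) (enorm v) (enorm (u + v)) => a b c ? ? ? ?.
apply: (@le_trans _ _ ((a + b) ^+ 2)); first by rewrite ler_pXn2r// nnegrE; lra.
have := sqr_ge0 (a - b); nra.
Qed.

End euclidean_space.

Section measurable_rV.
Context {R : realType} {n : nat} {disp : measure_display} {T : measurableType disp}.
Implicit Types f g : T -> 'rV[R]_n.

Lemma measurable_fun_coord f i :
  measurable_fun setT f -> measurable_fun setT (fun w => f w ord0 i).
Proof. exact: measurableT_comp (measurable_coord i). Qed.

Lemma measurable_dotp f g : measurable_fun setT f -> measurable_fun setT g ->
  measurable_fun setT (fun w => dotp (f w) (g w)).
Proof.
move=> mf mg; apply: measurable_sum => i.
by apply: measurable_funM; exact: measurable_fun_coord.
Qed.

Lemma measurable_sqr_enorm f : measurable_fun setT f ->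
  measurable_fun setT (fun w => enorm (f w) ^+ 2).
Proof. by move=> mf; under eq_fun do rewrite sqr_enorm; exact: measurable_dotp. Qed.

Lemma measurable_rVD f g : measurable_fun setT f -> measurable_fun setT g ->
  measurable_fun setT (fun w => f w + g w).
Proof.
move=> mf mg; apply: measurable_fun_rV => i; under eq_fun do rewrite mxE.
by apply: measurable_funD; exact: measurable_fun_coord.
Qed.

Lemma measurable_rVZ (a : T -> R) f : measurable_fun setT a ->
  measurable_fun setT f -> measurable_fun setT (fun w => a w *: f w).
Proof.
move=> ma mf; apply: measurable_fun_rV => i; under eq_fun do rewrite mxE.
by apply: measurable_funM => //; exact: measurable_fun_coord.
Qed.

Lemma measurable_rVN f : measurable_fun setT f ->
  measurable_fun setT (fun w => - f w).
Proof.
move=> mf; under eq_fun do rewrite -scaleN1r.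
by apply: measurable_rVZ => //; exact: measurable_cst.
Qed.

Lemma measurable_rVB f g : measurable_fun setT f -> measurable_fun setT g ->
  measurable_fun setT (fun w => f w - g w).
Proof. by move=> mf mg; apply: measurable_rVD => //; exact: measurable_rVN. Qed.

End measurable_rV.

Lemma continuous_measurable_rV (R : realType) (m n : nat)
    (f : 'rV[R]_m -> 'rV[R]_n) : continuous f -> measurable_fun setT f.
Proof.
move=> cf; apply: (@measurability _ _ _ _ _ _ (@open 'rV[R]_n)) => // _ [U oU <-].
by rewrite setTI; apply: open_measurable_rV; apply: open_comp.
Qed.

Section L2_theory.
Context {R : realType} {n : nat} {disp : measure_display} {T : measurableType disp}.
Variable mu : {measure set T -> \bar R}.
Implicit Types f g h : T -> 'rV[R]_n.

(** Membership in L^2 through an integrable square instead of [finite_norm], so that sums, multiples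
    and inner products reduce to comparisons of integrands; [sqi_finite_norm] and [finite_norm_sqi]
    connect the two. *)
Definition sqi f := measurable_fun setT f /\
  mu.-integrable setT (EFin \o (fun w => enorm (f w) ^+ 2)).

Definition ip f g : R := \int[mu]_w dotp (f w) (g w).

Definition n2 f : R := Num.sqrt (ip f f).

Lemma sqi_dominated f (k : T -> R) : measurable_fun setT f ->
  mu.-integrable setT (EFin \o k) -> (forall w, enorm (f w) ^+ 2 <= k w) -> sqi f.
Proof.
move=> mf ik fk; split => //; apply: (le_integrable _ _ _ ik) => //.
  by apply/measurable_EFinP; exact: measurable_sqr_enorm.
move=> w _; rewrite !abse_EFin lee_fin ger0_norm ?sqr_ge0//.
exact: le_trans (fk w) (ler_norm _).
Qed.

Lemma sqiD f g : sqi f -> sqi g -> sqi (fun w => f w + g w).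
Proof.
move=> [mf sf] [mg sg].
apply: (@sqi_dominated _ (fun w => 2 * (enorm (f w) ^+ 2 + enorm (g w) ^+ 2))).
- exact: measurable_rVD.
- by have := integrableZl measurableT 2 (integrableD measurableT sf sg).
- by move=> w; exact: sqr_enormD.
Qed.

Lemma sqiZ (a : R) f : sqi f -> sqi (fun w => a *: f w).
Proof.
move=> [mf sf].
apply: (@sqi_dominated _ (fun w => a ^+ 2 * enorm (f w) ^+ 2)).
- by apply: measurable_rVZ => //; exact: measurable_cst.
- by have := integrableZl measurableT (a ^+ 2) sf.
- by move=> w; rewrite enormZ exprMn real_normK// num_real.
Qed.

Lemma sqiN f : sqi f -> sqi (fun w => - f w).
Proof. by move=> /(sqiZ (-1)); under eq_fun do rewrite scaleN1r. Qed.

Lemma sqiB f g : sqi f -> sqi g -> sqi (fun w => f w - g w).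
Proof. by move=> sf /sqiN; exact: sqiD. Qed.

Lemma sqi_indic A f : measurable A -> sqi f -> sqi (fun w => \1_A w *: f w).
Proof.
move=> mA [mf sf].
apply: (@sqi_dominated _ (fun w => enorm (f w) ^+ 2)) => //.
  by apply: measurable_rVZ => //; exact: measurable_indic.
move=> w; rewrite indicE; case: (w \in A); rewrite ?scale1r// scale0r enorm0 expr0n.
exact: sqr_ge0.
Qed.

Lemma sqi_cst (c : 'rV[R]_n) : (mu setT < +oo)%E -> sqi (fun=> c).
Proof.
move=> fmu; apply: (@sqi_dominated _ (cst (enorm c ^+ 2))) => //.
apply/integrableP; split; first exact/measurable_EFinP/measurable_cst.
by under eq_integral do rewrite /=; rewrite integral_cst// lte_mul_pinfty.
Qed.

Lemma integrable_dotp f g : sqi f -> sqi g ->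
  mu.-integrable setT (EFin \o (fun w => dotp (f w) (g w))).
Proof.
move=> [mf sf] [mg sg].
apply: (le_integrable _ _ _ (integrableD measurableT sf sg)) => //.
  by apply/measurable_EFinP; exact: measurable_dotp.
move=> w _; rewrite /= lee_fin.
rewrite (ger0_norm (addr_ge0 (sqr_ge0 _) (sqr_ge0 _))).
apply: (le_trans (norm_dotp _ _)).
have := sqr_ge0 (enorm (f w) - enorm (g w)).
have := sqr_ge0 (enorm (f w) + enorm (g w)); nra.
Qed.

Lemma ipC f g : ip f g = ip g f.
Proof. by apply: eq_Rintegral => w _; rewrite dotpC. Qed.

Lemma ipDl f g h : sqi f -> sqi g -> sqi h ->
  ip (fun w => f w + g w) h = ip f h + ip g h.
Proof.
move=> sf sg sh; rewrite -RintegralD//; try exact: integrable_dotp.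
by apply: eq_Rintegral => w _; rewrite dotpDl.
Qed.

Lemma ipZl (a : R) f g : sqi f -> sqi g -> ip (fun w => a *: f w) g = a * ip f g.
Proof.
move=> sf sg; rewrite -RintegralZl//; last exact: integrable_dotp.
by apply: eq_Rintegral => w _; rewrite dotpZl.
Qed.

Lemma ipNl f g : sqi f -> sqi g -> ip (fun w => - f w) g = - ip f g.
Proof.
by move=> sf sg; rewrite -mulN1r -ipZl//; under [in RHS]eq_fun do rewrite scaleN1r.
Qed.

Lemma ipBl f g h : sqi f -> sqi g -> sqi h ->
  ip (fun w => f w - g w) h = ip f h - ip g h.
Proof. by move=> sf sg sh; rewrite -ipNl// -ipDl//; exact: sqiN. Qed.

Lemma ipDr f g h : sqi f -> sqi g -> sqi h ->
  ip h (fun w => f w + g w) = ip h f + ip h g.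
Proof. by move=> sf sg sh; rewrite ipC ipDl// !(ipC h). Qed.

Lemma ipZr (a : R) f g : sqi f -> sqi g -> ip g (fun w => a *: f w) = a * ip g f.
Proof. by move=> sf sg; rewrite ipC ipZl// (ipC g). Qed.

Lemma ipNr f g : sqi f -> sqi g -> ip g (fun w => - f w) = - ip g f.
Proof. by move=> sf sg; rewrite ipC ipNl// (ipC g). Qed.

Lemma ipBr f g h : sqi f -> sqi g -> sqi h ->
  ip h (fun w => f w - g w) = ip h f - ip h g.
Proof. by move=> sf sg sh; rewrite ipC ipBl// !(ipC h). Qed.

Lemma ip_ge0 f : 0 <= ip f f.
Proof. by apply: Rintegral_ge0 => w _; exact: dotp_ge0. Qed.

Lemma n2_ge0 f : 0 <= n2 f.
Proof. exact: sqrtr_ge0. Qed.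

Lemma n2_eq0 f : (forall w, f w = 0) -> n2 f = 0.
Proof.
move=> f0; rewrite /n2 /ip; under eq_Rintegral do rewrite f0 dotp0l.
by rewrite /Rintegral integral0 sqrtr0.
Qed.

Lemma sqr_n2 f : n2 f ^+ 2 = ip f f.
Proof. by rewrite sqr_sqrtr// ip_ge0. Qed.

Lemma ip_sqr_enorm f : ip f f = \int[mu]_w (enorm (f w) ^+ 2).
Proof. by apply: eq_Rintegral => w _; rewrite sqr_enorm. Qed.

(** For c > 0 the minimum is at t = -b/c. The case c = 0 occurs because [ip] is only semidefinite;
    there b <> 0 is refuted by t = -(a + 1)/(2b), where the expression equals -1. *)
Lemma discriminant_le (a b c : R) : 0 <= c ->
  (forall t, 0 <= a + 2 * t * b + t ^+ 2 * c) -> b ^+ 2 <= a * c.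
Proof.
rewrite le_eqVlt => /predU1P[<-|c0] h; last first.
  have := h (- b / c) => h1; have e : - b / c * c = - b by rewrite divfK// gt_eqF.
  move: h1 e; set t := - b / c => h1 e; nra.
have [->|b0] := eqVneq b 0; first by rewrite mulr0 expr0n.
have := h (- (a + 1) / (2 * b)); rewrite mulr0 addr0.
have -> : 2 * (- (a + 1) / (2 * b)) * b = - (a + 1) by field.
by move=> ?; exfalso; lra.
Qed.

Lemma ip_le f g : sqi f -> sqi g -> `|ip f g| <= n2 f * n2 g.
Proof.
move=> sf sg; rewrite -(@ler_pXn2r _ 2)// ?nnegrE ?mulr_ge0 ?n2_ge0//.
rewrite real_normK ?num_real// exprMn !sqr_n2; apply: discriminant_le => [|t]; first exact: ip_ge0.
have := ip_ge0 (fun w => f w + t *: g w).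
have sZ := sqiZ t sg; have sD := sqiD sf sZ.
by rewrite ipDl// !ipDr// !ipZr// !ipZl// (ipC g f); congr (_ <= _); ring.
Qed.

Lemma n2D f g : sqi f -> sqi g -> n2 (fun w => f w + g w) <= n2 f + n2 g.
Proof.
move=> sf sg; rewrite -(@ler_pXn2r _ 2)// ?nnegrE ?addr_ge0 ?n2_ge0//.
have sD := sqiD sf sg.
rewrite sqrrD !sqr_n2 ipDl// !ipDr// (ipC g f).
have := ip_le sf sg => /(le_trans (ler_norm _)); lra.
Qed.

Lemma n2Z (a : R) f : sqi f -> n2 (fun w => a *: f w) = `|a| * n2 f.
Proof.
move=> sf; have sZ := sqiZ a sf.
by rewrite /n2 ipZl// ipZr// mulrA -expr2 sqrtrM ?sqr_ge0// sqrtr_sqr.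
Qed.

Lemma n2C f g : n2 (fun w => f w - g w) = n2 (fun w => g w - f w).
Proof.
congr Num.sqrt; apply: eq_Rintegral => w _.
by rewrite -opprB dotpNl dotpNr opprK.
Qed.

Lemma n2_dist f g h : sqi f -> sqi g -> sqi h ->
  n2 (fun w => f w - g w) <= n2 (fun w => f w - h w) + n2 (fun w => h w - g w).
Proof.
move=> sf sg sh; have := n2D (sqiB sf sh) (sqiB sh sg).
by under eq_fun do rewrite subrKA.
Qed.

Lemma ip_null f g : sqi f -> sqi g -> n2 f = 0 -> ip f g = 0.
Proof.
by move=> sf sg f0; have := ip_le sf sg; rewrite f0 mul0r normr_le0 => /eqP.
Qed.

Lemma EFin_ip f : sqi f -> ((ip f f)%:E = \int[mu]_w (enorm (f w) ^+ 2)%:E)%E.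
Proof.
by move=> [mf sf]; rewrite ip_sqr_enorm /Rintegral fineK//; exact: integrable_fin_num.
Qed.

Lemma sqi_lty f : measurable_fun setT f ->
  (\int[mu]_w (enorm (f w) ^+ 2)%:E < +oo)%E -> sqi f.
Proof.
move=> mf fy; split => //; apply/integrableP; split.
  by apply/measurable_EFinP; exact: measurable_sqr_enorm.
by under eq_integral => w _ do rewrite /= ger0_norm ?sqr_ge0//.
Qed.

Lemma sqi_lty_inv f : sqi f -> (\int[mu]_w (enorm (f w) ^+ 2)%:E < +oo)%E.
Proof. by move=> sf; rewrite -EFin_ip// ltry. Qed.

Lemma integral_sqr_Lnorm f :
  ('N[mu]_2%:E[EFin \o (enorm \o f)] `^ 2 = \int[mu]_w (enorm (f w) ^+ 2)%:E)%E.
Proof.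
rewrite poweR_Lnorm//; apply: eq_integral => w _ /=.
by rewrite powR_mulrn ?ger0_norm ?enorm_ge0.
Qed.

Lemma sqi_finite_norm f : sqi f -> finite_norm mu 2%:E (enorm \o f).
Proof.
move=> /sqi_lty_inv; rewrite -integral_sqr_Lnorm /finite_norm => h.
by apply: (@lty_poweRy _ _ 2).
Qed.

Lemma finite_norm_sqi f : measurable_fun setT f ->
  finite_norm mu 2%:E (enorm \o f) -> sqi f.
Proof.
by move=> mf fy; apply: sqi_lty => //; rewrite -integral_sqr_Lnorm poweR_lty.
Qed.

Lemma fine_Lnorm f : sqi f -> fine 'N[mu]_2%:E[EFin \o (enorm \o f)] = n2 f.
Proof.
move=> sf; have := integral_sqr_Lnorm f; rewrite -EFin_ip// -sqr_n2.
have := Lnorm_ge0 mu 2%:E (EFin \o (enorm \o f)).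
have := sqi_finite_norm sf; rewrite /finite_norm.
case: (Lnorm _ _ _) => //= r _; rewrite lee_fin => r0 [].
rewrite powR_mulrn// => /eqP; rewrite eqrXn2 ?n2_ge0// => /eqP.
by [].
Qed.
End L2_theory.

Section L2_image.
Context {R : realType} {n : nat} {disp : measure_display} {T : measurableType disp}.

Definition mfun_of {disp' : measure_display} {S : measurableType disp'} (X : S -> T)
  (mX : measurable_fun setT X) : {mfun S >-> T} :=
  HB.pack X (isMeasurableFun.Build _ _ _ _ X mX).

(* [mu] is only assumed to agree with the image measure on measurable sets. *)
Lemma ip_image {disp' : measure_display} {S : measurableType disp'}
    (mu : {measure set T -> \bar R}) (nu : {measure set S -> \bar R}) (X : S -> T)
    (f g : T -> 'rV[R]_n) : measurable_fun setT X ->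
  (forall A, measurable A -> mu A = nu (X @^-1` A)) ->
  sqi nu (f \o X) -> sqi nu (g \o X) -> measurable_fun setT f -> measurable_fun setT g ->
  ip mu f g = ip nu (f \o X) (g \o X).
Proof.
move=> mX muE sf sg mf mg; rewrite /ip /Rintegral; congr fine.
rewrite (eq_measure_integral (pushforward nu (mfun_of mX))); last by move=> A mA _; rewrite muE.
rewrite integral_pushforward//.
  by apply/measurable_EFinP; exact: measurable_dotp.
exact: integrable_dotp.
Qed.

Lemma sqi_image {disp' : measure_display} {S : measurableType disp'}
    (mu : {measure set T -> \bar R}) (nu : {measure set S -> \bar R}) (X : S -> T)
    (f : T -> 'rV[R]_n) : measurable_fun setT X ->
  (forall A, measurable A -> mu A = nu (X @^-1` A)) ->
  measurable_fun setT f -> sqi mu f <-> sqi nu (f \o X).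
Proof.
move=> mX muE mf.
have E : (\int[mu]_w (enorm (f w) ^+ 2)%:E = \int[nu]_w (enorm (f (X w)) ^+ 2)%:E)%E.
  rewrite (eq_measure_integral (pushforward nu (mfun_of mX))); last by move=> A mA _; rewrite muE.
  rewrite ge0_integral_pushforward//.
    by apply/measurable_EFinP; exact: measurable_sqr_enorm.
  by move=> ? _; rewrite lee_fin sqr_ge0.
split=> h; apply: sqi_lty => //.
- exact: measurableT_comp.
- by rewrite -E; exact: sqi_lty_inv.
- by rewrite E; exact: sqi_lty_inv h.
Qed.
End L2_image.

(** * Gradients on the Hilbert space *)

Section real_line.
Context {R : realType}.
Implicit Types (f g : R -> R) (t l K : R).

Lemma is_derive_eps f t l :
  (forall e, 0 < e -> exists2 r, 0 < r &
    forall s, `|s| < r -> `|f (t + s) - f t - s * l| <= e * `|s|) ->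
  is_derive t 1 f l.
Proof.
move=> H; have cl : h^-1 *: ((f \o shift t) h - f t) @[h --> 0^'] --> l.
  apply/cvgrPdist_le => e e0; have [r r0 Hr] := H e e0.
  near=> s; have s0 : s != 0 by near: s; exact: nbhs_dnbhs_neq.
  have sr : `|s| < r by near: s; exact: dnbhs0_lt.
  rewrite -(ler_pM2r (_ : 0 < `|s|)) ?normr_gt0// -normrM.
  have := Hr s sr; rewrite /= [t + s]addrC; congr (_ <= _).
  rewrite -normrN; congr `|_|; rewrite /GRing.scale/=; by field.
apply: DeriveDef.
  rewrite /derivable; apply/cvg_ex; exists l.
  by under eq_fun do rewrite [_%:A]mulr1.
by apply/cvg_lim => //; under eq_fun do rewrite [_%:A]mulr1.
Unshelve. all: by end_near. Qed.

Lemma continuous_eps f t l :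
  (forall e, 0 < e -> exists2 r, 0 < r &
    forall s, `|s| < r -> `|f (t + s) - f t - s * l| <= e * `|s|) ->
  {for t, continuous f}.
Proof.
by move=> /is_derive_eps[df _]; apply: differentiable_continuous; apply/derivable1_diffP.
Qed.

(* The maximum of [f + L t^2] minus its chord cannot be interior for [K < L]. *)
Lemma local_lower_quadratic f (f' : R -> R) K L : K < L -> continuous f ->
  (forall t, exists2 r, 0 < r &
    forall s, `|s| < r -> - K * s ^+ 2 <= f (t + s) - f t - s * f' t) ->
  - L <= f 1 - f 0 - f' 0.
Proof.
move=> KL cf H; rewrite leNgt; apply/negP => neg.
pose c := f 1 - f 0 + L.
have fc : 0 < f' 0 - c by rewrite /c; lra.
(* [c] is the slope of the chord of f + L t^2, so [k] vanishes at 0 and at 1. A failure of the claim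
   makes the linear coefficient [f' 0 - c] at 0 positive, which forces a positive interior
   maximum. *)
pose k := fun t => f t + L * t ^+ 2 - f 0 - t * c.
have ck : continuous k.
  move=> t; rewrite /k; apply: cvgB; last by apply: cvgMl; exact: cvg_id.
  apply: cvgB; last exact: cvg_cst.
  apply: cvgD; first exact: cf.
  by apply: cvgMr; apply: exprn_continuous.
have k0 : k 0 = 0 by rewrite /k; ring.
have k1 : k 1 = 0 by rewrite /k /c; ring.
have [r r0 Hr] := H 0.
have locq (t s : R) : - K * s ^+ 2 <= f (t + s) - f t - s * f' t ->
    s * (f' t + 2 * L * t - c) + (L - K) * s ^+ 2 <= k (t + s) - k t.
  by rewrite /k => h; nra.
have [u [u0 u1 ku]] : exists u, [/\ 0 < u, u < 1 & 0 < k u].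
  have m0 : 0 < Num.min r 1 / 2 by rewrite divr_gt0// lt_min r0 ltr01.
  exists (Num.min r 1 / 2); split => //.
    have : Num.min r 1 <= 1 by rewrite ge_min lexx orbT.
    move: (Num.min r 1) => a; lra.
  have mr : Num.min r 1 / 2 < r.
    have : Num.min r 1 <= r by rewrite ge_min lexx.
    move: m0; move: (Num.min r 1) => a; lra.
  have := Hr (Num.min r 1 / 2); rewrite gtr0_norm// => /(_ mr)/locq.
  rewrite add0r k0 subr0; apply: lt_le_trans; rewrite mulr0 addr0.
  by rewrite addr_gt0// mulr_gt0// ?exprn_gt0// subr_gt0.
have [c0 c01 max] := @EVT_max _ k 0 1 ler01 (continuous_subspaceT ck).
have mpos : 0 < k c0.
  by apply: (lt_le_trans ku); apply: max; rewrite in_itv/= !ltW.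
have [c00 c11] : 0 < c0 /\ c0 < 1.
  move: c01; rewrite in_itv/= => /andP[]; rewrite !le_eqVlt.
  move=> /predU1P[e|->]; first by move: mpos; rewrite -e k0 ltxx.
  by move=> /predU1P[e|->]//; move: mpos; rewrite e k1 ltxx.
have [q q0 Hq] := H c0.
pose s := Num.min q (Num.min c0 (1 - c0)) / 2.
have mm : 0 < Num.min q (Num.min c0 (1 - c0)) by rewrite !lt_min q0 c00 subr_gt0.
have s0 : 0 < s by rewrite divr_gt0.
have [sq sc sc1] : [/\ s < q, s < c0 & s < 1 - c0].
  have ms : s < Num.min q (Num.min c0 (1 - c0)).
    by rewrite /s; move: mm; move: (Num.min _ _) => a ?; lra.
  by move: ms; rewrite !lt_min => /andP[-> /andP[-> ->]].
(* The lower bounds at [c0 + s] and [c0 - s] are added: the first-order terms cancel and leave 2 (L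
   - K) s^2 <= 0. *)
have nsq : `|s| < q by rewrite gtr0_norm.
have := locq _ _ (Hq _ nsq); rewrite -normrN in nsq; have := locq _ _ (Hq _ nsq).
have m1 : k (c0 + s) <= k c0 by apply: max; rewrite in_itv/=; apply/andP; split; lra.
have m2 : k (c0 - s) <= k c0 by apply: max; rewrite in_itv/=; apply/andP; split; lra.
have : 0 < (L - K) * s ^+ 2 by rewrite mulr_gt0 ?exprn_gt0// subr_gt0.
rewrite sqrrN; nra.
Qed.

(** The radius may shrink from one [t] to the next, so no subdivision is attempted: the maximum
    argument is applied to [f] and to its opposite with L = K + e, and e tends to 0. Continuity
    follows from the local estimate itself. *)
Lemma local_to_global_quadratic f (f' : R -> R) K : 0 <= K ->
  (forall t, exists2 r, 0 < r &
    forall s, `|s| < r -> `|f (t + s) - f t - s * f' t| <= K * s ^+ 2) ->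
  `|f 1 - f 0 - f' 0| <= K.
Proof.
move=> K0 H.
have cf : continuous f.
  move=> t; apply: (@continuous_eps f t (f' t)) => e e0.
  have [r r0 Hr] := H t; exists (Num.min r (e / (K + 1))).
    by rewrite lt_min r0 divr_gt0// ltr_wpDl.
  move=> s; rewrite lt_min => /andP[sr se]; apply: (le_trans (Hr s sr)).
  rewrite -[s ^+ 2]real_normK ?num_real// expr2 mulrA ler_wpM2r//.
  move: se; rewrite ltr_pdivlMr; last by rewrite ltr_wpDl.
  by move=> h; have := normr_ge0 s; nra.
apply/ler_addgt0Pr => e e0; rewrite ler_norml; apply/andP; split.
  apply: (@local_lower_quadratic f f' K); [lra|exact: cf|].
  move=> t; have [r r0 Hr] := H t; exists r => // s /Hr.
  by rewrite ler_norml mulNr => /andP[].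
have := @local_lower_quadratic (fun t => - f t) (fun t => - f' t) K (K + e).
move=> h; suff : - (K + e) <= - f 1 - - f 0 - - f' 0 by lra.
apply: h; [lra|by move=> t; apply: cvgN; exact: cf|].
move=> t; have [r r0 Hr] := H t; exists r => // s /Hr.
rewrite ler_norml mulNr => /andP[_]; lra.
Qed.
End real_line.

Section hilbert_space.
Context {R : realType} {d : nat}.
Local Notation leb := (leb_Omega d).
Implicit Types (x y h p : H R d) (F : H R d -> R) (f g : 'rV[R]_d -> 'rV[R]_d).

Lemma H_sqi x : sqi leb x.
Proof. by apply: finite_norm_sqi => //; exact: H_finite. Qed.

Lemma normHE f : sqi leb f -> normH f = n2 leb f.
Proof. exact: fine_Lnorm. Qed.

Definition ofL2 f (sf : sqi leb f) : H R d :=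
  MkH (H_fun := mfun_of sf.1) (sqi_finite_norm sf).

Definition lineH x h (t : R) : H R d :=
  ofL2 (sqiD (H_sqi x) (sqiZ t (H_sqi h))).

(** At distance zero both the linear term and the error of the expansion at [x] vanish.
    Differentiability thus makes F a function of the class modulo almost everywhere equality. *)
Lemma is_gradH_ext F x p y : is_gradH F x p -> n2 leb (fun w => y w - x w) = 0 ->
  F y = F x.
Proof.
move=> /(_ 1 ltr01)[r r0 H] yx0; have sB := sqiB (H_sqi y) (H_sqi x).
have := H y; rewrite normHE// yx0 => /(_ r0); rewrite mulr0 normr_le0 /dotH.
have -> : \int[leb]_w dotp (p w) ((y \- x) w) = ip leb p (fun w => y w - x w) by [].
rewrite ipC ip_null//; last exact: H_sqi.
by rewrite subr0 subr_eq0 => /eqP.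
Qed.

(** The point [y] is given by its values because the same point of a line occurs as different
    records, such as [lineH x h (t + s)] and [lineH (lineH x h t) h s]. *)
Lemma is_gradH_line F x p h : is_gradH F x p -> forall e : R, 0 < e ->
  exists2 r : R, 0 < r & forall y (s : R), `|s| < r -> (forall w, y w = x w + s *: h w) ->
    `|F y - F x - s * ip leb p h| <= e * `|s|.
Proof.
move=> Fxp e e0; have h0 := n2_ge0 leb h; have h1 : 0 < n2 leb h + 1 by lra.
have [r r0 H] := Fxp _ (divr_gt0 e0 h1).
exists (r / (n2 leb h + 1)); first exact: divr_gt0.
move=> y s; rewrite ltr_pdivlMr// => sr yE.
have yx : y \- x = fun w => s *: h w by apply/funext => w; rewrite /= yE addrC addKr.
have sh := H_sqi h; have sp := H_sqi p; have ss := sqiZ s sh.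
have := H y; rewrite yx normHE// n2Z//.
have -> : dotH p (fun w => s *: h w) = s * ip leb p h by rewrite -ipZr.
have slt : `|s| * n2 leb h < r by have := normr_ge0 s; nra.
move=> /(_ slt)/le_trans; apply.
rewrite mulrAC ler_pdivrMr// -!mulrA (ler_wpM2l (ltW e0))//.
by rewrite ler_wpM2l//; lra.
Qed.

(** Both expansions are tested in the direction h = p - q, each with error [e * n2 leb h / 2];
    subtracting them gives |h|^2 <= e |h|. *)
Lemma is_gradH_unique F x p q : is_gradH F x p -> is_gradH F x q ->
  n2 leb (fun w => p w - q w) = 0.
Proof.
move=> Fp Fq; apply/eqP; rewrite eq_le n2_ge0 andbT; apply/ler_addgt0Pr => e e0.
rewrite add0r; set h := ofL2 (sqiB (H_sqi p) (H_sqi q)).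
have [->|nh0] := eqVneq (n2 leb h) 0; first exact: ltW.
have nh : 0 < n2 leb h by rewrite lt_neqAle eq_sym nh0 n2_ge0.
have en : 0 < e * n2 leb h / 2 by rewrite divr_gt0// mulr_gt0.
have [r r0 Hp] := is_gradH_line h Fp en.
have [r' r'0 Hq] := is_gradH_line h Fq en.
pose s := Num.min r r' / 2.
have mm : 0 < Num.min r r' by rewrite lt_min r0.
have s0 : 0 < s by rewrite divr_gt0.
have [sr sr'] : s < r /\ s < r'.
  have ms : s < Num.min r r' by rewrite /s; move: mm; move: (Num.min _ _) => a ?; lra.
  by move: ms; rewrite lt_min => /andP[-> ->].
have := Hp (lineH x h s) s; rewrite gtr0_norm// => /(_ sr (fun=> erefl)).
have := Hq (lineH x h s) s; rewrite gtr0_norm// => /(_ sr' (fun=> erefl)).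
rewrite !ler_norml => /andP[q1 q2] /andP[p1 p2].
have E : ip leb p h - ip leb q h = n2 leb h * n2 leb h.
  rewrite -expr2 sqr_n2 -ipBl//; exact: H_sqi.
have : s * (n2 leb h * n2 leb h) <= s * (e * n2 leb h) by rewrite -E; lra.
by rewrite ler_pM2l// ler_pM2r.
Qed.

Lemma is_gradH_derive F (G : H R d -> H R d) x h : (forall y, is_gradH F y (G y)) ->
  forall t : R, is_derive t 1 (fun t => F (lineH x h t)) (ip leb (G (lineH x h t)) h).
Proof.
move=> FG t; apply: is_derive_eps => e e0.
have [r r0 H] := is_gradH_line h (FG (lineH x h t)) e0.
exists r => // s sr; apply: (H _ _ sr) => w /=.
by rewrite scalerDl addrA.
Qed.

(** Mean value theorem on the segment: a gradient at an intermediate point gives the exact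
    increment, and it differs from [G x] by at most C |y - x|. *)
Lemma lipschitz_grad_taylor F (G : H R d -> H R d) (C : R) : 0 <= C ->
  (forall x, is_gradH F x (G x)) ->
  (forall x y, n2 leb (fun w => G x w - G y w) <= C * n2 leb (fun w => x w - y w)) ->
  forall x y, `|F y - F x - ip leb (G x) (fun w => y w - x w)|
    <= C * n2 leb (fun w => y w - x w) ^+ 2.
Proof.
move=> C0 FG GC x y; set h := ofL2 (sqiB (H_sqi y) (H_sqi x)).
have df := is_gradH_derive x h FG.
have cf : {within `[0, 1], continuous (fun t : R => F (lineH x h t))}.
  apply: continuous_subspaceT => t; apply: differentiable_continuous.
  by apply/derivable1_diffP; have [] := df t.
have [c c01 E] := MVT ltr01 (fun t _ => df t) cf.
have e1 : F (lineH x h 1) = F y.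
  apply: (is_gradH_ext (FG y)); apply: n2_eq0 => w /=.
  by rewrite scale1r [x w + _]addrC subrK subrr.
have e0 : F (lineH x h 0) = F x.
  by apply: (is_gradH_ext (FG x)); apply: n2_eq0 => w /=; rewrite scale0r addr0 subrr.
rewrite -e1 -e0 E subr0 mulr1.
have -> : ip leb (G x) (fun w => y w - x w) = ip leb (G x) h by [].
have gx : n2 leb (fun w => G (lineH x h c) w - G x w) <= C * n2 leb h.
  apply: (le_trans (GC _ _)); rewrite ler_wpM2l//.
  rewrite (_ : n2 _ _ = `|c| * n2 leb h).
    rewrite ler_piMl ?n2_ge0//; move: c01; rewrite in_itv/= => /andP[? ?].
    by rewrite gtr0_norm// ltW.
  rewrite -n2Z; last exact: H_sqi.
  by congr n2; apply/funext => w /=; rewrite addrC addKr.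
have sG := H_sqi (G (lineH x h c)); have sg := H_sqi (G x); have sh := H_sqi h.
rewrite -ipBl//; apply: (le_trans (ip_le (sqiB sG sg) sh)).
by rewrite expr2 mulrA ler_wpM2r// n2_ge0.
Qed.

(** With g = G x - G y and z = x - a g, the increment of F from y to z is expanded directly and
    through x. The linear terms leave a |g|^2, bounded by three quadratic errors over the lengths a
    |g|, at most a |g| + r, and r. *)
Lemma taylor_lipschitz_grad F (G : H R d -> H R d) (C : R) : 0 <= C ->
  (forall x y, `|F y - F x - ip leb (G x) (fun w => y w - x w)|
    <= C * n2 leb (fun w => y w - x w) ^+ 2) ->
  forall x y, n2 leb (fun w => G x w - G y w) <= 6 * C * n2 leb (fun w => x w - y w).
Proof.
move=> C0 T x y; have sx := H_sqi x; have sy := H_sqi y.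
have sGx := H_sqi (G x); have sGy := H_sqi (G y).
have sxy := sqiB sx sy; have sg := sqiB sGx sGy.
set g := (fun w => G x w - G y w); set r := n2 leb (fun w => x w - y w).
have r0 : 0 <= r by exact: n2_ge0.
have [g0|gn0] := eqVneq (n2 leb g) 0; first by rewrite g0 !mulr_ge0.
have g0 : 0 < n2 leb g by rewrite lt_neqAle eq_sym gn0 n2_ge0.
have key (a : R) : 0 <= a -> a * n2 leb g ^+ 2 <=
    C * ((a * n2 leb g) ^+ 2 + (a * n2 leb g + r) ^+ 2 + r ^+ 2).
  move=> a0; have sa := sqiZ a sg.
  pose z := ofL2 (sqiB sx sa).
  have := T x z; have := T y z; have := T y x; clear T.
  have xz : (fun w => z w - x w) = fun w => - (a *: g w).
    by apply/funext => w /=; rewrite addrAC subrr add0r.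
  have yz : (fun w => z w - y w) = fun w => (x w - y w) - a *: g w.
    by apply/funext => w /=; rewrite addrAC.
  rewrite xz yz -/r.
  have -> : n2 leb (fun w => - (a *: g w)) = a * n2 leb g.
    rewrite -[a in RHS]ger0_norm// -n2Z//.
    by rewrite -[LHS]/(n2 leb (fun w => _)) /n2 ipNl// ?ipNr ?opprK//; exact: sqiN.
  have tri : n2 leb (fun w => (x w - y w) - a *: g w) <= a * n2 leb g + r.
    rewrite addrC -[a in leRHS]ger0_norm// -n2Z//.
    have := n2D sxy (sqiN sa); congr (_ <= _ + _).
    by rewrite /n2 ipNl// ?ipNr ?opprK//; exact: sqiN.
  have tri2 : n2 leb (fun w => (x w - y w) - a *: g w) ^+ 2 <= (a * n2 leb g + r) ^+ 2.
    apply: lerXn2r tri; rewrite nnegrE; first exact: n2_ge0.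
    exact: addr_ge0 (mulr_ge0 a0 (n2_ge0 _ _)) r0.
  rewrite (ipNr sa sGx) (ipZr a sg sGx) (ipBr sxy sa sGy) (ipZr a sg sGy).
  have -> : ip leb (G x) g = ip leb (G y) g + n2 leb g ^+ 2.
    by rewrite sqr_n2 -[in RHS]/g {2}/g ipBl//; ring.
  rewrite !ler_norml => /andP[a1 a2] /andP[b1 b2] /andP[c1 c2].
  move: (ler_wpM2l C0 tri2) a1 a2 b1 b2 c1 c2; clear tri tri2.
  move: (n2 leb (fun w => x w - y w - a *: g w)) (ip leb (G y) (fun w => x w - y w))
    (ip leb (G y) g) (n2 leb g) (F x) (F y) (F z) (r) => u i j m fx fy fz s; lra.
(* The choice a = r/|g| made below would be 0 here. Instead a = 1/(2C + 1) gives 2 C a < 1, which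
   contradicts |g| > 0. *)
clear T; have [r00|rn0] := eqVneq r 0.
  have := key (1 / (2 * C + 1)).
  have C1 : 0 < 2 * C + 1 by lra.
  rewrite r00 addr0 expr0n addr0 => /(_ (ltW (divr_gt0 ltr01 C1))).
  set a := 1 / _; have aC : a * (2 * C + 1) = 1 by rewrite /a divfK// gt_eqF.
  have a0 : 0 < a by exact: divr_gt0.
  have g2 : 0 < n2 leb g ^+ 2 by rewrite exprn_gt0.
  have -> : C * ((a * n2 leb g) ^+ 2 + (a * n2 leb g) ^+ 2) =
    a * n2 leb g ^+ 2 * (a * (2 * C)) by ring.
  rewrite -[X in X <= _]mulr1 (ler_pM2l (mulr_gt0 a0 g2)) => h; exfalso; nra.
have rp : 0 < r by rewrite lt_neqAle eq_sym rn0.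
(* This makes a |g| = r, so the three errors are r^2, 4 r^2 and r^2: the origin of the factor 6. *)
have := key (r / n2 leb g) (divr_ge0 r0 (ltW g0)).
rewrite (divfK gn0) /= expr2 mulrA (divfK gn0).
have -> : C * (r ^+ 2 + (r + r) ^+ 2 + r ^+ 2) = r * (6 * C * r) by ring.
by rewrite ler_pM2l.
Qed.
End hilbert_space.

(** * From the Wasserstein space to the Hilbert space *)

Section transport_plans.
Context {R : realType} {d : nat}.
Local Notation leb := (leb_Omega d).
Implicit Types (x y h : H R d) (g : 'rV[R]_d -> 'rV[R]_d).

Lemma measurable_pairH x y : measurable_fun setT (fun w => (x w, y w)).
Proof. exact: measurable_fun_pair. Qed.

Definition pair_law x y : probability ('rV[R]_d * 'rV[R]_d)%type R :=
  distribution leb (mfun_of (measurable_pairH x y)).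

Lemma coupling_pair_law x y : couplings (sharp x) (sharp y) (pair_law x y).
Proof.
move=> A mA; rewrite /pair_law /= /distribution /pushforward; split; congr (leb _).
  by apply/seteqP; split=> [w []|w].
by apply/seteqP; split=> [w []|w].
Qed.

Lemma integral_law {disp : measure_display} {T : measurableType disp}
    (gamma : {measure set T -> \bar R}) (X : 'rV[R]_d -> T) (f : T -> \bar R) :
  measurable_fun setT X -> (forall A, measurable A -> gamma A = leb (X @^-1` A)) ->
  measurable_fun setT f -> (forall z, (0 <= f z)%E) ->
  (\int[gamma]_z f z = \int[leb]_w f (X w))%E.
Proof.
move=> mX gE mf f0; rewrite (eq_measure_integral (pushforward leb (mfun_of mX))).
  by rewrite ge0_integral_pushforward.
by move=> A mA _; rewrite gE.
Qed.

Lemma measurable_cost_fun : measurable_fun setT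
  (fun z : 'rV[R]_d * 'rV[R]_d => (enorm (z.1 - z.2) ^+ 2)%:E).
Proof. by apply/measurable_EFinP; apply: measurable_sqr_enorm; exact: measurable_rVB. Qed.

Lemma cost_law x y (gamma : probability ('rV[R]_d * 'rV[R]_d)%type R) :
  (forall A, measurable A -> gamma A = leb ((fun w => (x w, y w)) @^-1` A)) ->
  cost gamma = (n2 leb (fun w => y w - x w) ^+ 2)%:E.
Proof.
move=> gE; rewrite /cost (integral_law (measurable_pairH x y) gE)//.
- rewrite sqr_n2 EFin_ip; last exact: sqiB (H_sqi y) (H_sqi x).
  by apply: eq_integral => w _ /=; rewrite enormC.
- exact: measurable_cost_fun.
- by move=> z; rewrite lee_fin sqr_ge0.
Qed.

Lemma first_order_law x y g (gamma : probability ('rV[R]_d * 'rV[R]_d)%type R) :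
  measurable_fun setT g -> sqi leb (g \o x) ->
  (forall A, measurable A -> gamma A = leb ((fun w => (x w, y w)) @^-1` A)) ->
  first_order g gamma = ip leb (g \o x) (fun w => y w - x w).
Proof.
move=> mg sg gE.
rewrite -[RHS]/(ip leb ((fun z => g z.1) \o fun w => (x w, y w))
  ((fun z => z.2 - z.1) \o fun w => (x w, y w))).
rewrite -(ip_image (mu := gamma))//.
- exact: measurable_pairH.
- exact: sqiB (H_sqi y) (H_sqi x).
- exact: measurableT_comp.
- exact: measurable_rVB.
Qed.

Lemma W2_optimal (mu nu : P2 R d) gamma : optimal mu nu gamma ->
  W2 mu nu = Num.sqrt (fine (cost gamma)).
Proof.
move=> [cg og]; congr (Num.sqrt (fine _)); apply/eqP; rewrite eq_le; apply/andP; split.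
  by apply: ereal_inf_lbound; exists gamma.
by apply: le_ereal_inf_tmp => _ [gamma' cg' <-]; exact: og.
Qed.

(** Every plan with these marginals moves mass from the finite set of values of [x], so it costs at
    least the integral of the squared distance to that set, which depends on the second marginal
    only. The plan carried by (x, y) attains this bound. *)
Lemma nearest_point_optimal x y : finite_set (range x) ->
  (forall w w', enorm (x w - y w) <= enorm (x w' - y w)) ->
  optimal (sharp x) (sharp y) (pair_law x y).
Proof.
move=> finx nearest; split=> [|gamma cgamma]; first exact: coupling_pair_law.
have /finite_seqP[S SE] := finx.
(* The default of the minimum is itself the squared distance to a value of [x], so it does not lower
   the minimum. *)
pose m q : R := \big[Num.min/enorm (x 0 - q) ^+ 2]_(s <- S) enorm (s - q) ^+ 2.
have mm : measurable_fun setT m.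
  rewrite /m; elim: S {m SE} => [|s S IH].
    under eq_fun do rewrite big_nil.
    by apply: measurable_sqr_enorm; apply: measurable_rVB => //; exact: measurable_cst.
  under eq_fun do rewrite big_cons; apply: measurable_minr => //.
  by apply: measurable_sqr_enorm; apply: measurable_rVB => //; exact: measurable_cst.
have m_le s q : s \in S -> m q <= enorm (s - q) ^+ 2.
  by move=> sS; apply: (ge_bigmin_seq _ s xpredT).
have m_ge0 q : 0 <= m q.
  by apply: le_bigmin => [|s _]; exact: sqr_ge0.
have mE w : m (y w) = enorm (x w - y w) ^+ 2.
  apply/eqP; rewrite eq_le; apply/andP; split.
    by apply: m_le; have : [set` S] (x w) by rewrite -SE; exists w.
  rewrite /m big_seq; apply: (@big_ind _ (fun r => enorm (x w - y w) ^+ 2 <= r)).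
  - by rewrite ler_pXn2r ?nnegrE ?enorm_ge0 ?nearest.
  - by move=> a b ha hb; rewrite le_min ha hb.
  - move=> s sS; have [w' _ <-] : range x s by rewrite SE.
    by rewrite ler_pXn2r ?nnegrE ?enorm_ge0 ?nearest.
rewrite (cost_law (x := x) (y := y))//.
have gS : gamma (~` ([set` S] `*` setT)) = 0%E.
  have mS : measurable [set` S].
    rewrite -[X in measurable X]setCK; apply: measurableC.
    apply: open_measurable_rV; apply: closed_openC.
    apply: (accessible_finite_set_closed.1 (hausdorff_accessible (@norm_hausdorff _ _))).
    by apply/finite_seqP; exists S.
  rewrite probability_setC; last exact: measurableX.
  rewrite (cgamma _ mS).1 /= /distribution /pushforward.
  rewrite (_ : x @^-1` _ = setT) ?probability_setT ?subee//.
  by apply/seteqP; split=> // w _; have : range x (x w) by [exists w]; rewrite SE.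
have -> : (n2 leb (fun w => y w - x w) ^+ 2)%:E = (\int[gamma]_z (m z.2)%:E)%E.
  rewrite (_ : (\int[gamma]_z (m z.2)%:E)%E = (\int[leb]_w (m (y w))%:E)%E).
    rewrite sqr_n2 EFin_ip; last exact: sqiB (H_sqi y) (H_sqi x).
    by apply: eq_integral => w _ /=; rewrite enormC mE.
  have mE2 : measurable_fun setT (EFin \o m) by exact/measurable_EFinP.
  rewrite -(integral_law (gamma := sharp y) (X := y) (f := EFin \o m))//.
  have -> : (\int[sharp y]_z (EFin \o m) z =
      \int[pushforward gamma (mfun_of (@measurable_snd _ _ _ _))]_z (EFin \o m) z)%E.
    apply: eq_measure_integral => A mA _; transitivity (gamma (setT `*` A)).
      exact/esym/(cgamma A mA).2.
    by rewrite /pushforward; congr (gamma _); apply/seteqP; split=> [z []|z].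
  by rewrite ge0_integral_pushforward// => z _; rewrite lee_fin.
apply: ae_ge0_le_integral => //.
- by move=> z _; rewrite lee_fin.
- by apply/measurable_EFinP; exact: measurableT_comp.
- by move=> z _; rewrite lee_fin sqr_ge0.
- exact: measurable_cost_fun.
- exists (~` ([set` S] `*` setT)); split => //.
    apply: measurableC; apply: measurableX => //.
    rewrite -[X in measurable X]setCK; apply: measurableC.
    apply: open_measurable_rV; apply: closed_openC.
    apply: (accessible_finite_set_closed.1 (hausdorff_accessible (@norm_hausdorff _ _))).
    by apply/finite_seqP; exists S.
  apply: subsetC => z [/= zS _] _; rewrite lee_fin; exact: m_le.
Qed.

(** [D] is at most the least gap between distinct values of [x] and [M] bounds |h|: a displacement
    of at most D/2 leaves every point no farther from its own value than from any other. *)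
Lemma nearest_point_line x h : finite_set (range x) -> finite_set (range h) ->
  exists2 r : R, 0 < r & forall s y, `|s| < r -> (forall w, y w = x w + s *: h w) ->
    forall w w', enorm (x w - y w) <= enorm (x w' - y w).
Proof.
move=> /finite_seqP[S SE] /finite_seqP[V VE].
pose M := \big[Num.max/1]_(v <- V) enorm v.
have hM w : enorm (h w) <= M.
  by apply: (le_bigmax_seq _ _ xpredT) => //; have : [set` V] (h w) by rewrite -VE; exists w.
have M0 : 0 < M by apply: (lt_le_trans ltr01); exact: bigmax_ge_id.
(* Equal pairs and the default contribute 1, so that [D] is positive even when [x] is constant. *)
pose D := \big[Num.min/1]_(p <- [seq (u, v) | u <- S, v <- S])
  (if p.1 == p.2 then 1 else enorm (p.1 - p.2)).
have D0 : 0 < D.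
  apply: lt_bigmin => // -[u v] _ /=; case: eqP => // uv.
  rewrite lt_neqAle enorm_ge0 andbT eq_sym; apply/eqP => /enorm_eq0/eqP.
  by rewrite subr_eq0 => /eqP.
have xD w w' : x w != x w' -> D <= enorm (x w - x w').
  move=> ne; have xS z : x z \in S by have : [set` S] (x z) by rewrite -SE; exists z.
  apply: (le_trans (ge_bigmin_seq _ (x w, x w') xpredT _ _ _)) => //.
    by apply/allpairsP; exists (x w, x w'); rewrite !xS.
  by rewrite /= (negbTE ne).
exists (D / (2 * M)); first by rewrite divr_gt0// mulr_gt0.
move=> s y sr yE w w'.
have [->//|ne] := eqVneq (x w') (x w).
have e1 : enorm (x w - y w) <= D / 2.
  rewrite yE opprD addNKr enormN enormZ; move: sr; rewrite ltr_pdivlMr ?mulr_gt0// => sr.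
  have := hM w; have := enorm_ge0 (h w); have := normr_ge0 s; nra.
have := enorm_dist (x w) (x w') (y w); rewrite (enormC (y w)).
have := xD _ _ ne; rewrite enormC => a b; lra.
Qed.
End transport_plans.

(** * Dominated convergence in L^2 and density of maps with finitely many values *)

Section dominated_L2.
Context {R : realType} {n : nat} {disp : measure_display} {T : measurableType disp}.

Lemma n2_dominated (mu : {measure set T -> \bar R}) (f : nat -> T -> 'rV[R]_n) (k : T -> R) :
  (forall m, measurable_fun setT (f m)) -> mu.-integrable setT (EFin \o k) ->
  (forall m w, enorm (f m w) ^+ 2 <= k w) ->
  {ae mu, forall w, enorm (f m w) @[m --> \oo] --> 0} ->
  forall e : R, 0 < e -> exists N, forall m, (N <= m)%N -> n2 mu (f m) < e.
Proof.
move=> mf ik fk f0 e e0.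
have sf m : sqi mu (f m) by exact: sqi_dominated (fk m).
have h1 : {ae mu, forall w, setT w ->
    (enorm (f m w) ^+ 2)%:E @[m --> \oo] --> (0 : \bar R)%E}.
  apply: filterS f0 => w fw _; apply: cvg_EFin; first exact: nearW.
  by rewrite -[X in _ --> X](mul0r 0); under eq_fun do rewrite expr2; exact: (cvgM fw fw).
have h2 : {ae mu, forall w m, setT w -> (`|(enorm (f m w) ^+ 2)%:E| <= (EFin \o k) w)%E}.
  by apply: aeW => w m _; rewrite /= lee_fin ger0_norm// sqr_ge0.
have [_ _] := dominated_convergence measurableT
  (fun m => (measurable_EFinP _ _).2 (measurable_sqr_enorm (mf m))) (measurable_cst _) h1 ik h2.
rewrite integral_cst// mul0e => /fine_cvgP[_] /cvgrPdist_lt /(_ (e ^+ 2)).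
rewrite exprn_gt0// => /(_ isT)[N _ HN]; exists N => m Nm.
have := HN m Nm; rewrite /= sub0r normrN.
rewrite -[fine _]/(\int[mu]_w (enorm (f m w) ^+ 2)) -ip_sqr_enorm ger0_norm ?ip_ge0//.
by rewrite -sqr_n2 ltr_pXn2r// nnegrE ?n2_ge0 ?ltW.
Qed.
End dominated_L2.

Section finite_range_density.
Context {R : realType} {d : nat}.
Local Notation leb := (leb_Omega d).

(** Truncation at height n + 1 leaves finitely many values on the mesh 1/(n + 1); truncating and
    rounding down are nondecreasing, whence measurability. *)
Definition clamp_floor (n : nat) (t : R) : R :=
  (Num.floor (n.+1%:R * Num.max (- n.+1%:R) (Num.min t n.+1%:R)))%:~R / n.+1%:R.

(** Truncation moves [t] by at most |t| and rounding by at most 1. Being uniform in [n], the bound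
    serves as a majorant. *)
Lemma clamp_floor_dist n t : `|clamp_floor n t - t| <= `|t| + 1.
Proof.
rewrite /clamp_floor; set c := Num.max _ _; set N := n.+1%:R : R.
have N0 : 0 < N by rewrite ltr0n.
have N1 : 1 <= N by rewrite ler1n.
have Nn0 : N != 0 by rewrite gt_eqF.
have /andP[f1 f2] := floor_itv (N * c); rewrite intrD in f2.
have e : `|(Num.floor (N * c))%:~R / N - c| <= 1.
  rewrite -[X in _ - X](mulfK Nn0) -mulrBl normrM normfV (gtr0_norm N0).
  by rewrite ler_pdivrMr// mul1r ler_norml; apply/andP; split; nra.
have ct : `|c - t| <= `|t|.
  have := ler_norm t; have := ler_norm (- t); rewrite normrN /c -/N => a1 a2.
  have [tN|tN] := lerP t N; [have [Nt|Nt] := lerP (- N) t|have [NN|NN] := lerP (- N) N];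
    by rewrite ler_norml; apply/andP; split; lra.
by rewrite -(subrKA c) addrC; apply: (le_trans (ler_normD _ _)); rewrite lerD.
Qed.

Lemma clamp_floor_near n t : `|t| <= n.+1%:R -> `|clamp_floor n t - t| <= n.+1%:R^-1.
Proof.
rewrite ler_norml => /andP[t1 t2].
rewrite /clamp_floor (min_idPl t2) (max_idPr t1); set N := n.+1%:R : R.
have N0 : 0 < N by rewrite ltr0n.
have /andP[f1 f2] := floor_itv (N * t); rewrite intrD in f2.
rewrite -[X in _ - X](mulfK (_ : N != 0)) ?gt_eqF//.
rewrite -mulrBl normrM normfV (gtr0_norm N0) -[leRHS]mul1r ler_pM2r ?invr_gt0//.
by rewrite (mulrC t) ler_norml; apply/andP; split; lra.
Qed.

Definition grid (n : nat) (q : 'rV[R]_d) : 'rV[R]_d := \row_i clamp_floor n (q ord0 i).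

Lemma measurable_grid n : measurable_fun setT (grid n).
Proof.
apply: measurable_fun_rV => i; under eq_fun do rewrite mxE.
apply: (@measurableT_comp _ _ _ _ _ _ (clamp_floor n)); last exact: measurable_coord.
apply: nondecreasing_measurable => // s t st.
rewrite /clamp_floor ler_wpM2r ?invr_ge0// ler_int le_floor// ler_wpM2l//.
by rewrite le_max2// le_min2.
Qed.

Lemma finite_grid n : finite_set (range (grid n)).
Proof.
(* The rounded values are z/N with |z| <= N^2, whence 2 N^2 + 1 indices per coordinate. *)
pose N := n.+1; pose F (k : {ffun 'I_d -> 'I_(2 * N ^ 2).+1}) : 'rV[R]_d :=
  \row_i (((k i)%:Z - (N ^ 2)%:Z)%:~R / N%:R).
apply: (@sub_finite_set _ _ (F @` setT)); last exact: finite_image.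
move=> _ [q _ <-]; rewrite /grid.
have H i : exists k : 'I_(2 * N ^ 2).+1,
    Num.floor (N%:R * Num.max (- N%:R) (Num.min (q ord0 i) N%:R)) = k%:Z - (N ^ 2)%:Z.
  set c := Num.max _ _; have c1 : - N%:R <= c by rewrite le_max lexx.
  have c2 : c <= N%:R.
    by rewrite ge_max ge_min lexx orbT andbT; apply: (@le_trans _ _ 0); rewrite ?oppr_le0.
  have N0 : 0 < N%:R :> R by rewrite ltr0n.
  have f1 : - (N ^ 2)%:Z <= Num.floor (N%:R * c).
    by rewrite floor_ge_int intrN -[_%:~R]/((N ^ 2)%:R) natrX; nra.
  have f2 : Num.floor (N%:R * c) <= (N ^ 2)%:Z.
    rewrite -(ler_int R); apply: (le_trans (floor_le _)).
    by rewrite -[_%:~R]/((N ^ 2)%:R) natrX; nra.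
  move: f1 f2; move: (Num.floor _) => z f1 f2.
  have h : (absz (z + Posz (N ^ 2)%N)%R < (2 * N ^ 2).+1)%N by lia.
  by exists (Ordinal h) => /=; lia.
have [k Hk] := choice H.
exists [ffun i => k i] => //; apply/rowP => i; rewrite !mxE ffunE /clamp_floor.
by rewrite Hk.
Qed.

Lemma grid_dist n q : enorm (grid n q - q) ^+ 2 <= 2 * (enorm q ^+ 2 + d%:R).
Proof.
rewrite !sqr_enorm /dotp (_ : d%:R = \sum_(i < d) 1); last by rewrite sumr_const card_ord.
rewrite -big_split mulr_sumr.
apply: ler_sum => i _ /=; rewrite !mxE -!expr2.
have := clamp_floor_dist n (q ord0 i).
rewrite -(real_normK (num_real (_ - _))) -(real_normK (num_real (q ord0 i))).
have := normr_ge0 (clamp_floor n (q ord0 i) - q ord0 i); have := normr_ge0 (q ord0 i).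
move: `|q ord0 i| `|_ - _| => a b a0 b0 ba.
by have := sqr_ge0 (a - 1); nra.
Qed.

Lemma grid_cvg q : enorm (grid n q - q) @[n --> \oo] --> 0.
Proof.
apply/cvgrPdist_le => e e0; near=> n.
rewrite sub0r normrN ger0_norm ?enorm_ge0//; apply: (le_trans (enorm_le_sum _)).
have nq : enorm q <= n.+1%:R.
  near: n; exists (Num.bound (enorm q)) => // m /= Nm.
  apply: (le_trans (ltW (archi_boundP (enorm_ge0 _)))).
  by rewrite ler_nat (leq_trans Nm).
apply: (@le_trans _ _ (\sum_(i < d) n.+1%:R^-1)).
  apply: ler_sum => i _; rewrite !mxE; apply: clamp_floor_near.
  exact: le_trans (coord_le_enorm _ _) nq.
rewrite sumr_const card_ord -[leLHS]mulr_natl ler_pdivrMr// mulrC -ler_pdivrMr//.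
near: n; exists (Num.bound (d%:R / e)) => // m /= Nm.
have de : 0 <= d%:R / e by rewrite divr_ge0// ltW.
apply: (le_trans (ltW (archi_boundP de))).
by rewrite ler_nat (leq_trans Nm).
Unshelve. all: by end_near. Qed.

Lemma finite_range_dense (x : H R d) (e : R) : 0 < e ->
  exists2 y : H R d, finite_set (range y) & n2 leb (fun w => y w - x w) < e.
Proof.
move=> e0; have sx := H_sqi x.
have mg n : measurable_fun setT (fun w => grid n (x w) - x w).
  by apply: measurable_rVB => //; apply: measurableT_comp => //; exact: measurable_grid.
have ik : leb.-integrable setT (EFin \o (fun w => 2 * (enorm (x w) ^+ 2 + d%:R))).
  have ic : leb.-integrable setT (EFin \o cst (d%:R : R)).
    exact: finite_measure_integrable_cst.
  by have := integrableZl measurableT 2 (integrableD measurableT sx.2 ic).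
have [N HN] := @n2_dominated _ _ _ _ leb _ _ mg ik (fun n w => grid_dist n (x w))
  (aeW leb (fun w => grid_cvg (x w))) e e0.
have sg : sqi leb (grid N \o x).
  have -> : grid N \o x = (fun w => (grid N (x w) - x w) + x w).
    by apply/funext => w /=; rewrite subrK.
  by apply: sqiD => //; exact: sqi_dominated (mg N) ik (fun w => grid_dist N (x w)).
exists (ofL2 sg); last exact: HN.
by apply: sub_finite_set (finite_grid N) => _ [w _ <-]; exists (x w).
Qed.
End finite_range_density.

(** * Regularity of the lift of a C^{1,1} function *)

Section lift_regularity.
Context {R : realType} {d : nat}.
Local Notation leb := (leb_Omega d).
Implicit Types (x y h p : H R d) (F : H R d -> R).

Lemma is_gradH_continuous F x p : is_gradH F x p -> forall e : R, 0 < e ->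
  exists2 r : R, 0 < r & forall y, n2 leb (fun w => y w - x w) < r -> `|F y - F x| < e.
Proof.
move=> /(_ 1 ltr01)[r r0 Hr] e e0; have np := n2_ge0 leb p.
exists (Num.min r (e / (n2 leb p + 1) / 2)).
  by rewrite lt_min r0 !divr_gt0// ltr_wpDl.
move=> y; have sB := sqiB (H_sqi y) (H_sqi x).
have := Hr y; rewrite normHE// mul1r => H1; rewrite lt_min => /andP[yr].
have N1 : 0 < n2 leb p + 1 by lra.
rewrite -mulrA -invfM ltr_pdivlMr ?mulr_gt0//.
have := H1 yr; have := ip_le (H_sqi p) sB; have := n2_ge0 leb (fun w => y w - x w).
rewrite -[dotH p _]/(ip leb p (fun w => y w - x w)) -[n2 leb (y \- x)]/(n2 leb (fun w => y w - x w)).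
move: (ip leb p _) (n2 leb (fun w => y w - x w)) (n2 leb p) (F y) (F x) np N1.
clear => a n c Fy Fx c0 c1 n0.
rewrite !ler_norml => /andP[a1 a2] /andP[b1 b2] h.
by rewrite ltr_norml; apply/andP; split; nra.
Qed.

Lemma finite_range_lineH x h (t : R) : finite_set (range x) -> finite_set (range h) ->
  finite_set (range (lineH x h t)).
Proof.
move=> fx fh; have := finite_image2 (fun u v => u + t *: v) fx fh.
by apply: sub_finite_set => _ [w _ <-]; exists (x w); [exists w|exists (h w); [exists w|]].
Qed.

Lemma C11_P2_C11_H (U : P2 R d -> R) : C11_P2 U -> C11_H (lift_P2 U).
Proof.
move=> [[G [UG cG]] [gU [gUw [C [C0 _ quad]]]]]; exists G; split=> //.
exists (6 * C).
(* The two-sided quadratic estimate for all pairs is enough: [taylor_lipschitz_grad] then yields 6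
   C. *)
suff T x y : `|lift_P2 U y - lift_P2 U x - ip leb (G x) (fun w => y w - x w)|
    <= C * n2 leb (fun w => y w - x w) ^+ 2.
  move=> x y; rewrite !normHE; [|exact: sqiB (H_sqi _) (H_sqi _)..].
  exact: taylor_lipschitz_grad.
have grad_cont (z : H R d) (e : R) : 0 < e -> exists2 r : R, 0 < r & forall y : H R d,
    n2 leb (fun w => y w - (z : H R d) w) < r -> n2 leb (fun w => G y w - G z w) < e.
  move=> e0; have [r r0 Hr] := cG z e e0; exists r => // v zv.
  by have := Hr v; rewrite !normHE; [apply|exact: sqiB (H_sqi _) (H_sqi _)..].
have simple (a b : H R d) : finite_set (range a) -> finite_set (range b) ->
    `|lift_P2 U b - lift_P2 U a - ip leb (G a) (fun w => b w - a w)|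
    <= C * n2 leb (fun w => b w - a w) ^+ 2.
  move=> fa fb; set h := ofL2 (sqiB (H_sqi b) (H_sqi a)).
  have fh : finite_set (range h).
    have := finite_image2 (fun u v => u - v) fb fa.
    by apply: sub_finite_set => _ [w _ <-]; exists (b w); [exists w|exists (a w); [exists w|]].
  (* Within the radius of [nearest_point_line] the coupling of [z] with its perturbation is optimal,
     so W2 is their L^2 distance and (2) becomes an estimate of order s^2. *)
  have loc t : exists2 r : R, 0 < r & forall s : R, `|s| < r ->
      `|lift_P2 U (lineH a h (t + s)) - lift_P2 U (lineH a h t)
        - s * ip leb (G (lineH a h t)) h| <= C * n2 leb h ^+ 2 * s ^+ 2.
    have [r r0 Hr] := nearest_point_line (finite_range_lineH t fa fh) fh.
    set z := lineH a h t in Hr *.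
    have [mg fg _] := (gUw (sharp z)).1.
    have sgz : sqi leb (gU (sharp z) \o z).
      apply/(sqi_image (mu := sharp z) (nu := leb) (X := z)) => //.
      exact: finite_norm_sqi.
    set q := ip leb (gU (sharp z) \o z) h.
    have Hs s : `|s| < r -> `|lift_P2 U (lineH a h (t + s)) - lift_P2 U z - s * q|
        <= C * n2 leb h ^+ 2 * s ^+ 2.
      move=> sr; set v := lineH a h (t + s).
      have yE w : v w = z w + s *: h w by rewrite /= scalerDl addrA.
      have fz := finite_range_lineH t fa fh.
      have opt := nearest_point_optimal fz (Hr s v sr yE).
      have := quad _ _ _ opt; rewrite (W2_optimal opt) (cost_law (x := z) (y := v))//.
      rewrite (first_order_law (x := z) (y := v))// sqr_sqrtr ?exprn_ge0 ?n2_ge0//=.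
      have -> : (fun w => v w - z w) = fun w => s *: h w.
        by apply/funext => w; rewrite yE addrC addKr.
      rewrite ipZr//; last exact: H_sqi.
      rewrite n2Z; last exact: H_sqi.
      move=> /le_trans; apply; rewrite exprMn real_normK ?num_real//.
      by rewrite le_eqVlt; apply/orP; left; apply/eqP; ring.
    (* The derivative of the lift along this line is <G z, h> because [G z] is its gradient and [q]
       because of (2). Uniqueness of derivatives identifies the two. *)
    suff -> : ip leb (G z) h = q by exists r.
    have [] := is_derive_eps (f := fun s => lift_P2 U (lineH a h s)) (t := t) (l := q).
      move=> e e0; exists (Num.min r (e / (C * n2 leb h ^+ 2 + 1))).
        by rewrite lt_min r0 divr_gt0// ltr_wpDl// mulr_ge0// exprn_ge0// n2_ge0.
      have K0 : 0 <= C * n2 leb h ^+ 2 by rewrite mulr_ge0// exprn_ge0// n2_ge0.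
      move=> s; rewrite lt_min => /andP[sr]; rewrite ltr_pdivlMr; last lra.
      move=> se; apply: (le_trans (Hs s sr)).
      rewrite -[s ^+ 2]real_normK ?num_real// [`|s| ^+ 2]expr2 mulrA ler_wpM2r//.
      by move: K0 se (normr_ge0 s); move: (_ * _) `|s| => K u; clear; nra.
    move=> _ <-; have [_ <-] := is_gradH_derive a h UG t.
    by [].
  have := local_to_global_quadratic (mulr_ge0 C0 (exprn_ge0 2 (n2_ge0 leb h))) loc.
  have -> : lift_P2 U (lineH a h 1) = lift_P2 U b.
    apply: (is_gradH_ext (UG b)); apply: n2_eq0 => w /=.
    by rewrite scale1r [a w + _]addrC subrK subrr.
  have -> : lift_P2 U (lineH a h 0) = lift_P2 U a.
    by apply: (is_gradH_ext (UG a)); apply: n2_eq0 => w /=; rewrite scale0r addr0 subrr.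
  suff -> : ip leb (G (lineH a h 0)) h = ip leb (G a) (fun w => b w - a w) by [].
  (* [lineH a h 0] has the values of [a] but is another record, for which [G] may choose another
     representative; continuity of [G] at distance zero puts the two gradients at distance zero. *)
  have sG0 := H_sqi (G (lineH a h 0)); have sGa := H_sqi (G a).
  apply/eqP; rewrite -subr_eq0 -ipBl//; last exact: H_sqi.
  rewrite ip_null//; [exact: sqiB|exact: H_sqi|].
  apply/eqP; rewrite eq_le n2_ge0 andbT; apply/ler_addgt0Pr => e e0; rewrite add0r.
  have [r r0 Hr] := grad_cont a e e0; apply/ltW/Hr.
  by rewrite n2_eq0// => w /=; rewrite scale0r addr0 subrr.
have sx := H_sqi x; have sy := H_sqi y; have sG := H_sqi (G x).
have sxy := sqiB sy sx.
set N := n2 leb (fun w => y w - x w); have N0 : 0 <= N by exact: n2_ge0.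
have g0 := n2_ge0 leb (G x).
(* For e <= 1, [e * K] bounds the total error: C ((N + 2e)^2 - N^2) from the quadratic term, e (N +
   2e) from the gradient, 2 e |G x| from the increment, and 2 e from the values at the two end
   points. *)
pose K := C * (4 * N + 4) + N + 2 * n2 leb (G x) + 4.
have K0 : 0 < K.
  rewrite /K ltr_wpDl// addr_ge0 ?mulr_ge0// addr_ge0// mulr_ge0//.
  by rewrite addr_ge0// mulr_ge0.
apply/ler_addgt0Pr => eta eta0.
have [e [e0 e1 eK]] : exists e, [/\ 0 < e, e <= 1 & e * K <= eta].
  exists (Num.min 1 (eta / K)); split; first by rewrite lt_min ltr01 divr_gt0.
    by rewrite ge_min lexx.
  by rewrite -ler_pdivlMr// ge_min lexx orbT.
have [r1 r10 H1] := is_gradH_continuous (UG x) e0.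
have [r2 r20 H2] := is_gradH_continuous (UG y) e0.
have [r3 r30 H3] := grad_cont x e e0.
have m0 : 0 < Num.min e (Num.min r1 (Num.min r2 r3)) by rewrite !lt_min e0 r10 r20.
have [a fa] := finite_range_dense x m0; rewrite !lt_min => /and4P[ae a1 a2 a3].
have [b fb] := finite_range_dense y m0; rewrite !lt_min => /and4P[be b1 b2 b3].
have sa := H_sqi a; have sb := H_sqi b; have sab := sqiB sb sa.
have sGa := H_sqi (G a).
have dd : n2 leb (fun w => (b w - a w) - (y w - x w)) <= 2 * e.
  have := n2D (sqiB sb sy) (sqiN (sqiB sa sx)).
  have -> : n2 leb (fun w => - (a w - x w)) = n2 leb (fun w => a w - x w).
    by rewrite [RHS]n2C; congr n2; apply/funext => w; rewrite opprB.
  have -> : (fun w => b w - y w + - (a w - x w)) = (fun w => (b w - a w) - (y w - x w)).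
    by apply/funext => w; apply/rowP => i; rewrite !mxE; ring.
  by move=> /le_trans; apply; rewrite [2 * e]mulr_natl mulr2n; exact: lerD (ltW be) (ltW ae).
have nD : n2 leb (fun w => b w - a w) <= N + 2 * e.
  have := n2D sxy (sqiB sab sxy).
  have -> : (fun w => y w - x w + (b w - a w - (y w - x w))) = fun w => b w - a w.
    by apply/funext => w; apply/rowP => i; rewrite !mxE; ring.
  by move=> /le_trans; apply; rewrite lerD2l.
have E1 := simple _ _ fa fb.
have E2 : `|ip leb (fun w => G a w - G x w) (fun w => b w - a w)| <= e * (N + 2 * e).
  apply: (le_trans (ip_le (sqiB sGa sG) sab)).
  apply: ler_pM; [exact: n2_ge0|exact: n2_ge0|exact: ltW (H3 _ a3)|exact: nD].
have E3 : `|ip leb (G x) (fun w => (b w - a w) - (y w - x w))| <= n2 leb (G x) * (2 * e).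
  apply: (le_trans (ip_le sG (sqiB sab sxy))).
  by rewrite ler_wpM2l.
rewrite (ipBl sGa sG sab) in E2; rewrite (ipBr sab sxy sG) in E3.
have E4 := H1 a a1; have E5 := H2 b b2.
have E6 : C * n2 leb (fun w => b w - a w) ^+ 2 <= C * (N + 2 * e) ^+ 2.
  apply: (ler_wpM2l C0); apply: lerXn2r nD; rewrite nnegrE; first exact: n2_ge0.
  by apply: (addr_ge0 N0); apply: mulr_ge0 (ltW e0).
have := le_trans E1 E6.
move: E2 E3 E4 E5; clear E1 E6 nD dd H1 H2 H3 simple grad_cont quad cG UG gUw.
clearbody N; move: (ip leb (G a) _) (ip leb (G x) _) (ip leb (G x) _) => i1 i2 i3.
move: (lift_P2 U a) (lift_P2 U b) (lift_P2 U x) (lift_P2 U y) => ua ub ux uy.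
move: eK; rewrite /K; clear K K0 sab sGa m0 ae a1 a2 a3 be b1 b2 b3; move: g0; move: (n2 leb (G x)) => g g0.
move: N N0 e e0 e1 C C0 => n n0 u u0 u1 c c0.
rewrite !ler_norml !ltr_norml => h /andP[? ?] /andP[? ?] /andP[? ?] /andP[? ?] /andP[? ?].
have uu : u * u <= u by rewrite ler_piMr// ltW.
have cuu : c * (u * u) <= c * u by rewrite ler_wpM2l.
have hu : c * (n + 2 * u) ^+ 2 <= c * n ^+ 2 + u * (c * (4 * n + 4)) by lra.
by apply/andP; split; lra.
Qed.
End lift_regularity.

(** * Couplings as laws of maps on the cube *)

Section cantor_coding.
Context {R : realType}.
Implicit Types (b : nat -> bool) (r : R).

(* Without the digit 1, the expansion determines its digits. *)
Definition ternary b : \bar R := (\sum_(0 <= k <oo) ((b k)%:R * 2 * 3 ^- k.+1)%:E)%E.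

Lemma ternary_ge0 b : (0 <= ternary b)%E.
Proof. by apply: nneseries_ge0 => k _ _; rewrite lee_fin !mulr_ge0// invr_ge0 exprn_ge0. Qed.

Lemma ternary_le1 b : (ternary b <= 1)%E.
Proof.
apply: lime_le.
  by apply: is_cvg_nneseries => k _ _; rewrite lee_fin !mulr_ge0// invr_ge0 exprn_ge0.
apply: nearW => n; rewrite sumEFin lee_fin.
apply: (@le_trans _ _ (1 - 3 ^- n)); last by rewrite gerBl invr_ge0 exprn_ge0.
elim: n => [|n IH]; first by rewrite big_geq// expr0 invr1 subrr.
rewrite big_nat_recr//= exprSr invfM.
have : 0 <= 3 ^- n :> R by rewrite invr_ge0 exprn_ge0.
move: IH; move: (\sum_(_ <= _ < _) _) (3 ^- n) => s t st t0.
case: (b n) => /=; lra.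
Qed.

Lemma ternaryS b : ternary b = (((b 0%N)%:R * 2 / 3)%:E + (3^-1)%:E * ternary (b \o S))%E.
Proof.
have p0 (c : nat -> bool) k : (0 <= ((c k)%:R * 2 * 3 ^- k.+1 : R)%:E)%E.
  by rewrite lee_fin !mulr_ge0// invr_ge0 exprn_ge0.
rewrite /ternary (nneseries_split _ 1%N) => [|k _]; last exact: p0.
rewrite add0n big_nat1 expr1; congr (_ + _)%E.
rewrite -nneseriesZl => [|k _]; last exact: p0.
rewrite -[1%N in LHS]add0n -nneseries_addn => [|k]; last exact: p0.
apply: eq_eseriesr => k _ /=; rewrite -EFinM !addn1; congr EFin.
by rewrite [in LHS]exprSr invfM [RHS]mulrC -!mulrA.
Qed.

Definition code b : R := fine (ternary b).

Lemma EFin_code b : (code b)%:E = ternary b.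
Proof.
rewrite /code fineK// ge0_fin_numE ?ternary_ge0//.
exact: le_lt_trans (ternary_le1 b) (ltry _).
Qed.

Lemma code_ge0 b : 0 <= code b.
Proof. by rewrite -lee_fin EFin_code ternary_ge0. Qed.

Lemma code_le1 b : code b <= 1.
Proof. by rewrite -lee_fin EFin_code ternary_le1. Qed.

Lemma codeS b : code b = (b 0%N)%:R * 2 / 3 + 3^-1 * code (b \o S).
Proof. by apply: EFin_inj; rewrite EFinD [in X in (_ + X)%E]EFinM !EFin_code ternaryS. Qed.

(** A code with first bit 0 is at most 1/3 and one with first bit 1 is at least 2/3, so 1/2
    separates them; [tail_digits] then shifts the expansion by one place. *)
Definition head_digit r : bool := 2^-1 < r.
Definition tail_digits r : R := 3 * r - (head_digit r)%:R * 2.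
Definition digit (n : nat) r : bool := head_digit (iter n tail_digits r).

Lemma head_digit_code b : head_digit (code b) = b 0%N.
Proof.
rewrite /head_digit codeS; have := code_ge0 (b \o S); have := code_le1 (b \o S).
case: (b 0%N) => /= c1 c0; [apply/idP|apply/negbTE; rewrite -leNgt]; lra.
Qed.

Lemma tail_digits_code b : tail_digits (code b) = code (b \o S).
Proof. by rewrite /tail_digits head_digit_code codeS; field. Qed.

Lemma digit_code n b : digit n (code b) = b n.
Proof.
rewrite /digit; elim: n b => [|n IH] b; first exact: head_digit_code.
by rewrite iterSr tail_digits_code IH.
Qed.

Lemma measurable_head_digit : measurable_fun setT head_digit.
Proof. by apply: measurable_fun_ltr => //; exact: measurable_cst. Qed.

Lemma measurable_digit n : measurable_fun setT (digit n).
Proof.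
apply: (measurableT_comp measurable_head_digit).
elim: n => [|n IH] /=; first exact: measurable_id.
apply: (@measurableT_comp _ _ _ _ _ _ tail_digits); last exact: IH.
apply: measurable_funB; first by apply: measurable_funM => //; exact: measurable_cst.
apply: measurable_funM; last exact: measurable_cst.
have -> : (fun x => (head_digit x)%:R : R) = (fun x => if head_digit x then 1 else 0).
  by apply/funext => x; case: head_digit.
apply: measurable_fun_ifT; [exact: measurable_head_digit|exact: measurable_cst..].
Qed.

Lemma measurable_code {disp : measure_display} {T : measurableType disp}
    (b : nat -> T -> bool) : (forall n, measurable_fun setT (b n)) ->
  measurable_fun setT (fun z => code (b ^~ z)).
Proof.
move=> mb; apply: (measurableT_comp (@fine_measurable _ _ measurableT)).
apply: (@ge0_emeasurable_sum _ _ _ _ _ xpredT) => [k z _ _|k _].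
  by rewrite lee_fin !mulr_ge0// invr_ge0 exprn_ge0.
apply/measurable_EFinP; apply: measurable_funM; last exact: measurable_cst.
apply: measurable_funM; last exact: measurable_cst.
have -> : (fun x => (b k x)%:R : R) = (fun x => if b k x then 1 else 0).
  by apply/funext => x; case: (b k x).
by apply: measurable_fun_ifT => //; exact: measurable_cst.
Qed.
End cantor_coding.

Section rational_cuts.
Context {R : realType} {disp : measure_display} {T : measurableType disp}.
Context {J : countType} (c : J -> T -> R) (mc : forall j, measurable_fun setT (c j)).

(* The bits [cut n z] are the answers to all questions [q < c j z], with [q] rational. *)
Definition cut (n : nat) (z : T) : bool :=
  if unpickle n is Some (j, q) then ratr q < c j z else false.

(** Coordinate [j] is read back as the supremum of the rationals whose bit is set; [-oo], neutral
    for suprema, stands at every index that says nothing about [j]. *)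
Definition uncut (j : J) (r : R) : R :=
  fine (ereal_sup [set u | exists2 n, True & u =
    if unpickle n is Some (j', q) then
      if (j' == j) && digit n r then (ratr q)%:E else -oo%E else -oo%E]).

Lemma measurable_cut n : measurable_fun setT (cut n).
Proof.
rewrite /cut; case: unpickle => [[j q]|]; last exact: measurable_cst.
by apply: measurable_fun_ltr => //; exact: measurable_cst.
Qed.

Lemma measurable_uncut j : measurable_fun setT (uncut j).
Proof.
apply: (measurableT_comp (@fine_measurable _ _ measurableT)).
pose f n (r : R) : \bar R := if @unpickle (J * rat)%type n is Some (j', q) then
      if (j' == j) && digit n r then (ratr q)%:E else -oo%E else -oo%E.
have -> : (fun r => ereal_sup [set u | exists2 n, True & u = f n r]) =
    (fun r => esups (f ^~ r) 0).
  apply/funext => r; rewrite /esups /sdrop; congr ereal_sup; apply/seteqP; split.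
    by move=> u [n _ ->]; exists n.
  by move=> u [n _ <-]; exists n.
apply: measurable_fun_esups => n; rewrite /f; case: unpickle => [[j' q]|]; last exact: measurable_cst.
apply: measurable_fun_ifT; [|exact: measurable_cst..].
case: (j' == j) => /=; [exact: measurable_digit|exact: measurable_cst].
Qed.

Lemma uncutK j z : uncut j (code (cut ^~ z)) = c j z.
Proof.
rewrite /uncut; rewrite [X in fine X](_ : _ = (c j z)%:E)//.
apply/eqP; rewrite eq_le; apply/andP; split.
  apply: ge_ereal_sup => _ [n _ ->]; case E : unpickle => [[j' q]|]; last exact: leNye.
  rewrite digit_code /cut E; case: eqP => [->/=|_ /=]; last exact: leNye.
  by case: ifPn => [/ltW|_]; [rewrite lee_fin|exact: leNye].
rewrite leNgt; apply/negP => lt; set s := ereal_sup _ in lt.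
have [q sq qc] : exists2 q : rat, (s < (ratr q)%:E)%E & ratr q < c j z.
  move: lt; case: s => [s| |]//.
    rewrite lte_fin => /rat_in_itvoo[q]; rewrite in_itv/= => /andP[sq qc].
    by exists q; rewrite ?lte_fin.
  move=> _; have : c j z - 1 < c j z by rewrite gtrBl.
  by move=> /rat_in_itvoo[q]; rewrite in_itv/= => /andP[_ qc]; exists q; rewrite ?ltNyr.
move: sq; rewrite ltNge => /negP; apply; apply: ereal_sup_ubound.
exists (pickle (j, q)) => //; rewrite pickleK eqxx /= digit_code /cut pickleK qc.
by [].
Qed.
End rational_cuts.

Section representation.
Context {R : realType} {d : nat}.
Local Notation leb := (leb_Omega d.+1).

Lemma leb_Omega_coord (A : set R) : measurable A ->
  leb ((fun w : 'rV[R]_d.+1 => w ord0 ord0) @^-1` A) = lebesgue_measure (A `&` `]0, 1[).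
Proof.
move=> mA; rewrite /leb_Omega /mrestr OmegaE.
pose B (i : 'I_d.+1) := if i == ord0 then A `&` `]0, 1[ else `]0%R, 1%R[%classic.
have -> : (fun w : 'rV[R]_d.+1 => w ord0 ord0) @^-1` A `&`
    [set v | forall i, `]0, 1[%classic (v ord0 i)] = [set v | forall i, B i (v ord0 i)].
  apply/seteqP; split=> [v [/= Av v01] i|v /= Bv].
    by rewrite /B; case: eqP => [->|_]; [split=> //; exact: v01|exact: v01].
  split=> [|i]; first by have := Bv ord0; rewrite /B eqxx => -[].
  by have := Bv i; rewrite /B; case: eqP => [-> []|].
rewrite lebesgue_rV_box => [|i]; last first.
  by rewrite /B; case: eqP => // _; exact: measurableI.
rewrite big_ord_recl big1 ?mule1 /B ?eqxx// => i _ /=.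
by rewrite lebesgue_measure_itv/= lte_fin ltr01 oppr0 adde0.
Qed.

Lemma leb_Omega_tail (t : R) : 0 <= t <= 1 ->
  leb [set w : 'rV[R]_d.+1 | t < w ord0 ord0] = (1 - t)%:E.
Proof.
move=> /andP[t0 t1].
rewrite -[X in leb X]/((fun w : 'rV[R]_d.+1 => w ord0 ord0) @^-1` [set u | t < u]).
have -> : [set u | t < u] = `]t, +oo[%classic.
  by apply/seteqP; split => u /=; rewrite in_itv/= andbT.
rewrite leb_Omega_coord// (_ : _ `&` _ = `]t, 1[%classic); last first.
  apply/seteqP; split => u /=; rewrite !in_itv/= andbT.
    by move=> [-> /andP[_ ->]].
  by move=> /andP[tu ->]; rewrite tu (le_lt_trans t0 tu).
rewrite lebesgue_measure_itv/= lte_fin; case: ltP => // ?.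
by have -> : t = 1; [apply/eqP; rewrite eq_le t1|rewrite subrr].
Qed.

Section quantile.
Context {disp : measure_display} {T : measurableType disp} (gamma : probability T R).
Context (e : T -> R) (me : measurable_fun setT e) (e01 : forall z, 0 <= e z <= 1).

Definition cdf_of (t : R) : R := fine (gamma (e @^-1` `]-oo, t])).

Let measurable_ray t : measurable (e @^-1` `]-oo, t]).
Proof. by rewrite -[X in measurable X]setTI; exact: me. Qed.

Let EFin_cdf t : (cdf_of t)%:E = gamma (e @^-1` `]-oo, t]).
Proof. by rewrite fineK// fin_num_measure. Qed.

Let cdf_nd s t : s <= t -> cdf_of s <= cdf_of t.
Proof.
move=> st; rewrite -lee_fin !EFin_cdf le_measure ?inE// => z /=.
by rewrite !in_itv/= => /le_trans; apply.
Qed.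

Let cdf_neg t : t < 0 -> cdf_of t = 0.
Proof.
move=> t0; rewrite /cdf_of (_ : _ @^-1` _ = set0) ?measure0//.
apply/seteqP; split=> z //=; rewrite in_itv/= leNgt => /negP; apply.
by have /andP[+ _] := e01 z; exact: lt_le_trans.
Qed.

Let cdf_ge1 t : 1 <= t -> cdf_of t = 1.
Proof.
move=> t1; rewrite /cdf_of (_ : _ @^-1` _ = setT) ?probability_setT//.
apply/seteqP; split=> z //= _; rewrite in_itv/=.
by have /andP[_ h] := e01 z; exact: le_trans t1.
Qed.

Let cdf_right t u : cdf_of t < u -> exists2 t', t < t' & cdf_of t' < u.
Proof.
move=> tu; have rc := @cdf_right_continuous _ _ _ gamma (mfun_of me).
have cE s : cdf (mfun_of me : {RV gamma >-> R}) s = (cdf_of s)%:E by rewrite EFin_cdf.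
have tu' : (cdf (mfun_of me : {RV gamma >-> R}) t < u%:E)%E by rewrite cE lte_fin.
have H : \forall s \near t^'+, (cdf (mfun_of me : {RV gamma >-> R}) s < u%:E)%E.
  apply: (rc t [set y | (y < u%:E)%E]); apply: open_nbhs_nbhs; split => //.
  exact: open_ereal_lt_ereal.
have [s [su ts]] := @filter_ex _ _ (at_right_proper_filter t) _
  (filterI H (nbhs_right_gt t)).
by exists s => //; rewrite -lte_fin -cE.
Qed.

(** Generalized inverse of the distribution function; 0 is adjoined so that the supremum is taken
    over a nonempty set for every [u]. *)
Definition quantile (u : R) : R :=
  sup [set t | t = 0 \/ [/\ 0 <= t, t <= 1 & cdf_of t < u]].

Let has_sup_quantile u : has_sup [set t | t = 0 \/ [/\ 0 <= t, t <= 1 & cdf_of t < u]].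
Proof. by split; [exists 0; left|exists 1 => t [->//|[]]]. Qed.

Lemma measurable_quantile : measurable_fun setT quantile.
Proof.
apply: nondecreasing_measurable => // u v uv; apply: ge_sup.
  by exists 0; left.
move=> t ht; apply: ub_le_sup; first exact: (has_sup_quantile v).2.
case: ht => [->|[t0 t1 tu]]; [by left|right; split=> //].
exact: lt_le_trans uv.
Qed.

Lemma quantileP t u : 0 < u < 1 -> (t < quantile u) = (cdf_of t < u).
Proof.
move=> /andP[u0 u1]; have S := has_sup_quantile u; apply/idP/idP.
  move=> tQ; have e0 : 0 < quantile u - t by rewrite subr_gt0.
  have [s hs] := sup_adherent e0 S; rewrite opprB addrC subrK => ts.
  case: hs ts => [->|[_ _ su]] ts; first by rewrite cdf_neg.
  exact: le_lt_trans (cdf_nd (ltW ts)) su.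
move=> tu; have [t0|t0] := ltP t 0.
  by apply: (lt_le_trans t0); apply: ub_le_sup S.2 _ _; left.
have t1 : t < 1 by rewrite ltNge; apply/negP => /cdf_ge1 E; move: tu; rewrite E ltNge ltW.
(* Right continuity leaves room above [t], which yields a strict inequality with the supremum. *)
have [s ts su] := cdf_right tu.
have m : t < Num.min s 1 by rewrite lt_min ts.
apply: (lt_le_trans m); apply: ub_le_sup S.2 _ _; right; split.
- exact: le_trans (ltW m).
- by rewrite ge_min lexx orbT.
- by apply: le_lt_trans su; apply: cdf_nd; rewrite ge_min lexx.
Qed.

(** Inverse transform sampling: the first coordinate is uniform on (0,1) under [leb], and by
    [quantileP] both laws agree on the rays ]t, +oo[, which are stable under intersection and
    generate the Borel sets. *)
Lemma law_quantile (A : set R) : measurable A ->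
  gamma (e @^-1` A) = leb ((fun w : 'rV[R]_d.+1 => quantile (w ord0 ord0)) @^-1` A).
Proof.
have mQ : measurable_fun setT (fun w : 'rV[R]_d.+1 => quantile (w ord0 ord0)).
  exact: (measurableT_comp measurable_quantile (measurable_coord ord0)).
pose m1 : probability R R := distribution gamma (mfun_of me).
pose m2 : probability R R := distribution leb (mfun_of mQ).
move=> mA; rewrite -[LHS]/(m1 A) -[RHS]/(m2 A).
refine (@measure_unique _ R _ (@RGenOInfty.G R)
  (fun n => `]- n%:R, +oo[%classic) _ _ _ _ m1 m2 _ _ A mA).
- exact: RGenOInfty.measurableE.
- move=> _ _ [a ->] [b ->]; exists (Num.max a b); apply/seteqP; split=> x /=.
    by rewrite !in_itv/= !andbT gt_max => -[-> ->].
  by rewrite !in_itv/= !andbT gt_max => /andP[].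
- by move=> n; exists (- n%:R).
- apply/seteqP; split=> // x _; exists (Num.bound `|x|) => //=.
  rewrite in_itv/= andbT ltrNl; apply: le_lt_trans (archi_boundP (normr_ge0 x)).
  by rewrite -normrN ler_norm.
- move=> _ [t ->]; rewrite /pushforward.
  rewrite /m1 /m2 /= /distribution /pushforward /=.
  have -> : e @^-1` `]t, +oo[ = ~` (e @^-1` `]-oo, t]).
    by rewrite preimage_setC setCitvl.
  rewrite probability_setC// -EFin_cdf -EFinB.
  have c01 : 0 <= cdf_of t <= 1.
    by rewrite -!lee_fin EFin_cdf measure_ge0 probability_le1.
  rewrite -leb_Omega_tail// /leb_Omega /mrestr; congr (lebesgue_rV _ _).
  apply/seteqP; split=> w /= [wt w01]; split=> //.
    by rewrite in_itv/= andbT quantileP.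
  by move: wt; rewrite in_itv/= andbT quantileP.
- by move=> k; rewrite (le_lt_trans (probability_le1 _ _))// ltry.
Qed.
End quantile.

(** Countably many real coordinates are packed into one number [e z] of [0,1], whose law is realized
    by its quantile function, and are then unpacked. Measurability of [D] is asked along measurable
    families, so that [J -> R] needs no sigma-algebra. *)
Lemma realization {disp : measure_display} {T : measurableType disp} {J : countType}
    (c : J -> T -> R) (D : (J -> R) -> T) (gamma : probability T R) :
  (forall j, measurable_fun setT (c j)) ->
  (forall f : J -> R -> R, (forall j, measurable_fun setT (f j)) ->
    measurable_fun setT (fun r => D (f ^~ r))) ->
  (forall z, D (c ^~ z) = z) ->
  exists2 X : 'rV[R]_d.+1 -> T, measurable_fun setT X &
    forall A, measurable A -> gamma A = leb (X @^-1` A).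
Proof.
move=> mc mD cK; pose e z : R := code (cut c ^~ z).
have me : measurable_fun setT e by apply: measurable_code => n; exact: measurable_cut.
have e01 z : 0 <= e z <= 1 by rewrite code_ge0 code_le1.
pose D' r := D ((fun j => uncut j) ^~ r).
have mD' : measurable_fun setT D' by apply: mD => j; exact: measurable_uncut.
exists (fun w => D' (quantile gamma e (w ord0 ord0))).
  apply: (measurableT_comp mD').
  exact: (measurableT_comp (measurable_quantile gamma e) (measurable_coord ord0)).
move=> A mA; have mA' : measurable (D' @^-1` A).
  by rewrite -[X in measurable X]setTI; exact: mD'.
(* [D'] is a left inverse of [e], so the preimage of [A] under [D'] and then under [e] is [A]
   again. *)
rewrite -[RHS](law_quantile gamma me e01 mA'); congr (gamma _).
apply/seteqP; split=> z /=; rewrite /D' /e; under [X in D X]eq_fun do rewrite uncutK.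
  by rewrite cK.
by rewrite cK.
Qed.
End representation.

(** In dimension 0 the product space is a single point and a constant map suffices. Otherwise the
    coordinates of both components, indexed by [bool * 'I_d.+1], feed [realization]. *)
Lemma coupling_realization (R : realType) (d : nat)
    (gamma : probability ('rV[R]_d * 'rV[R]_d)%type R) :
  exists2 X : 'rV[R]_d -> 'rV[R]_d * 'rV[R]_d, measurable_fun setT X &
    forall A, measurable A -> gamma A = leb_Omega d (X @^-1` A).
Proof.
case: d gamma => [|d] gamma.
  exists (fun=> (0, 0)); first exact: measurable_cst.
  have e0 (q : 'rV[R]_0) : q = 0 by apply/rowP; case.
  move=> A mA; have [A0|A0] := pselect (A (0, 0)).
    rewrite (_ : A = setT) ?preimage_setT ?probability_setT//.
    by apply/seteqP; split=> // -[p q] _; rewrite (e0 p) (e0 q).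
  rewrite (_ : A = set0) ?preimage_set0 ?measure0//.
  by apply/seteqP; split=> // -[p q]; rewrite (e0 p) (e0 q).
apply: (@realization R d _ _ (bool * 'I_d.+1)%type
  (fun j z => (if j.1 then z.1 else z.2 : 'rV[R]_d.+1) ord0 j.2)
  (fun f => (\row_i f (true, i), \row_i f (false, i))) gamma).
- move=> [b i]; case: b => /=.
    exact: (measurableT_comp (measurable_coord i) (@measurable_fst _ _ _ _)).
  exact: (measurableT_comp (measurable_coord i) (@measurable_snd _ _ _ _)).
- move=> f mf; apply: measurable_fun_pair; apply: measurable_fun_rV => i;
  by under eq_fun do rewrite mxE; exact: mf.
- by move=> [p q]; congr (_, _); apply/rowP => i; rewrite mxE.
Qed.

(** * Structure of the gradient of a lift *)

Section translation.
Context {R : realType}.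

Lemma lebesgue_measure_translation (a : R) (A : set R) : measurable A ->
  lebesgue_measure ((fun t => t + a) @^-1` A) = lebesgue_measure A.
Proof.
move=> mA; pose tau : measurableTypeR R -> measurableTypeR R := fun t => t + a.
have mt : measurable_fun setT tau.
  by apply: measurable_funD => //; exact: measurable_cst.
pose m1 : {measure set (measurableTypeR R) -> \bar R} :=
  pushforward (@lebesgue_measure R) tau.
apply/esym; rewrite -[RHS]/(m1 mt A); apply: (@lebesgue_measure_unique R (m1 mt)) => //.
move=> _ [[b c] _ <-].
rewrite /m1 /= /pushforward.
have -> : (fun t : R => t + a) @^-1` `]b, c] = `]b - a, c - a]%classic.
  by apply/seteqP; split=> t /=; rewrite !in_itv/= ltrBlDr lerBrDr.
rewrite !lebesgue_measure_itv/= !lte_fin ltrD2r; case: ifPn => // _.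
by rewrite -!EFinB; congr EFin; ring.
Qed.

Lemma ge0_integral_translation (a : R) (f : R -> \bar R) : measurable_fun setT f ->
  (forall t, (0 <= f t)%E) ->
  (\int[@lebesgue_measure R]_t f (t + a)%R = \int[@lebesgue_measure R]_t f t)%E.
Proof.
move=> mf f0; pose tau : measurableTypeR R -> measurableTypeR R := fun t => t + a.
have mt : measurable_fun setT tau.
  by apply: measurable_funD => //; exact: measurable_cst.
rewrite [RHS](eq_measure_integral (pushforward (@lebesgue_measure R) tau)).
  by rewrite ge0_integral_pushforward.
by move=> A mA _; apply/esym; exact: (lebesgue_measure_translation a mA).
Qed.

(** The measure is built by recursion on the dimension, so the induction slices along the first
    coordinate: slices are translated by the tail of [a], the base by its first entry. *)
Lemma lebesgue_rV_translation n (a : 'rV[R]_n) (A : set 'rV[R]_n) : measurable A ->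
  lebesgue_rV n ((fun v => v + a) @^-1` A) = lebesgue_rV n A.
Proof.
elim: n a A => [|n IH] a A mA.
  congr (lebesgue_rV 0 _); apply/seteqP; split=> v /=;
  by have -> : v + a = v by apply/rowP; case.
rewrite /= /lebesgue_cons /pushforward /product_measure1.
pose B := @cons_rV R n @^-1` A.
have mB : measurable B by rewrite -[B]setTI; exact: measurable_cons_rV.
pose a' : 'rV[R]_n := \row_i a ord0 (lift ord0 i).
pose phi (t : R) := lebesgue_rV n (xsection B t).
rewrite -[RHS]/(\int[@lebesgue_measure R]_t phi t)%E.
rewrite -[RHS](ge0_integral_translation (a ord0 ord0)).
- apply: eq_integral => t _ /=; rewrite /phi -[RHS](IH a'); last exact: measurable_xsection.
  have E v : cons_rV (t, v) + a = cons_rV (t + a ord0 ord0, v + a').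
    apply/rowP => i; rewrite mxE; case: (unliftP ord0 i) => [j ->|->].
      by rewrite !cons_rVS mxE mxE.
    by rewrite !cons_rV0.
  congr (lebesgue_rV n _); apply/seteqP; split=> v h.
    by apply: (xsectionP _ _ _).2; exact: (eq_ind _ A ((xsectionP _ _ _).1 h) _ (E v)).
  apply: (xsectionP _ _ _).2.
  exact: (eq_ind_r A ((xsectionP (t + a ord0 ord0) (v + a') B).1 h) (E v)).
- exact: measurable_fun_xsection.
- by move=> t; exact: measure_ge0.
Qed.

(** By Tonelli, the measure of the overlap integrated over all [t] equals the product of the
    measures of [A] and [B], so the overlaps cannot all be null. *)
Lemma positive_overlap n (A B : set 'rV[R]_n) : measurable A -> measurable B ->
  (0 < lebesgue_rV n A)%E -> (0 < lebesgue_rV n B)%E ->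
  exists t, (0 < lebesgue_rV n (A `&` (fun w => (w + t)%R) @^-1` B))%E.
Proof.
move=> mA mB A0 B0; apply/not_existsP => H.
pose f (z : 'rV[R]_n * 'rV[R]_n) : \bar R := (\1_A z.1 * \1_B (z.1 + z.2))%:E.
have mf : measurable_fun setT f.
  apply/measurable_EFinP; apply: measurable_funM.
    exact: (@measurableT_comp _ _ _ _ _ _ (\1_A : 'rV[R]_n -> R)).
  apply: (@measurableT_comp _ _ _ _ _ _ (\1_B : 'rV[R]_n -> R)) => //.
  exact: measurable_rVD.
have f0 z : (0 <= f z)%E by rewrite lee_fin mulr_ge0// indicE ler0n.
have := @fubini_tonelli _ _ _ _ R (lebesgue_rV n) (lebesgue_rV n) f mf f0.
have -> : (\int[lebesgue_rV n]_w \int[lebesgue_rV n]_t f (w, t) =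
    \int[lebesgue_rV n]_w ((\1_A w)%:E * lebesgue_rV n B))%E.
  apply: eq_integral => w _.
  have mBw : measurable ((fun t => t + w) @^-1` B).
    rewrite -[X in measurable X]setTI; apply: measurable_rVD => //; exact: measurable_cst.
  have -> : lebesgue_rV n B =
      (\int[lebesgue_rV n]_t (\1_((fun t : 'rV[R]_n => (t + w)%R) @^-1` B) t)%:E)%E.
    rewrite integral_indic// setIT; exact: (esym (lebesgue_rV_translation w mB)).
  rewrite -ge0_integralZl//.
  - apply: eq_integral => t _; rewrite /f -EFinM; congr (_ * _)%:E.
    by rewrite !indicE /= addrC.
  - by apply/measurable_EFinP; exact: measurable_indic.
have -> : (\int[lebesgue_rV n]_t \int[lebesgue_rV n]_w f (w, t) = 0)%E.
  apply: integral0_eq => t _.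
  have mBt : measurable ((fun w => w + t) @^-1` B).
    rewrite -[X in measurable X]setTI; apply: measurable_rVD => //; exact: measurable_cst.
  transitivity (lebesgue_rV n (A `&` (fun w => (w + t)%R) @^-1` B)).
    rewrite -[X in lebesgue_rV n X]setIT -integral_indic//; last exact: measurableI.
    by apply: eq_integral => w _; rewrite /f/= indicI.
  by apply/eqP; move: (H t) => /negP; rewrite lt0e measure_ge0 andbT negbK.
rewrite ge0_integralZr//; last by apply/measurable_EFinP; exact: measurable_indic.
rewrite integral_indic// setIT => /eqP; rewrite mule_eq0.
by move=> /orP[] /eqP E; [move: A0|move: B0]; rewrite E ltxx.
Qed.

(** An overlap of positive measure gives a translation [t] and a set [S] in [A] whose translate S'
    lies in [B]; [T] exchanges S and S' by adding and subtracting [t]. Intersecting with the cube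
    beforehand keeps both sets inside it. *)
Lemma measure_preserving_swap n (A B : set 'rV[R]_n) : measurable A -> measurable B ->
  A `&` B = set0 -> (0 < leb_Omega n A)%E -> (0 < leb_Omega n B)%E ->
  exists T : 'rV[R]_n -> 'rV[R]_n, exists S : set 'rV[R]_n,
  [/\ measurable_fun setT T, (forall E, measurable E -> leb_Omega n (T @^-1` E) = leb_Omega n E),
      measurable S, (0 < leb_Omega n S)%E &
      involutive T /\ (forall w, S w -> A w /\ B (T w)) /\
      (forall w, ~ S w -> ~ S (T w) -> T w = w)].
Proof.
move=> mA mB AB0 A0 B0; have mO := @measurable_Omega R n.
have mAO := measurableI _ _ mA mO; have mBO := measurableI _ _ mB mO.
have [t St] := positive_overlap mAO mBO A0 B0.
set S := (X in lebesgue_rV n X) in St.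
have mtr (a : 'rV[R]_n) : measurable_fun setT (fun w : 'rV[R]_n => w + a).
  by apply: measurable_rVD => //; exact: measurable_cst.
have mpre (a : 'rV[R]_n) E : measurable E -> measurable ((fun w : 'rV[R]_n => w + a) @^-1` E).
  by move=> mE; rewrite -[X in measurable X]setTI; exact: mtr.
have mS : measurable S by apply: measurableI => //; exact: mpre.
pose S' := (fun w => w - t) @^-1` S.
have mS' : measurable S' by exact: mpre.
have SS' w : S w -> ~ S' w.
  move=> [[Aw _] _] [_ /=]; rewrite subrK => -[Bw _].
  by have : (A `&` B) w by []; rewrite AB0.
pose T w := if w \in S then w + t else if w \in S' then w - t else w.
have TS w : S w -> T w = w + t by move=> Sw; rewrite /T mem_set.
have TS' w : S' w -> T w = w - t.
  by move=> Sw; rewrite /T memNset ?mem_set// => /SS'.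
have TN w : ~ S w -> ~ S' w -> T w = w by move=> Sw Sw'; rewrite /T !memNset.
have S'T w : S w -> S' (w + t) by rewrite /S' /= addrK.
have ST w : S' w -> S (w - t) by [].
have mem_meas E : measurable E -> measurable_fun setT (fun w : 'rV[R]_n => w \in E).
  move=> mE; apply: (measurable_fun_bool true).
  by rewrite setTI (_ : _ @^-1` _ = E)//; apply/seteqP; split=> w; [exact: set_mem|exact: mem_set].
have mT : measurable_fun setT T.
  apply: measurable_fun_ifT; [exact: mem_meas|exact: mtr|].
  by apply: measurable_fun_ifT; [exact: mem_meas|exact: mtr|exact: measurable_id].
pose N := @Omega R n `\` (S `|` S').
have mN : measurable N by apply: measurableD => //; exact: measurableU.
have SO : S `<=` @Omega R n by move=> w [[]].
have SO' : S' `<=` @Omega R n by move=> w [_ [/=]]; rewrite subrK.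
(* A set is cut along S, S' and the rest: [T] exchanges the first two pieces up to a translation and
   fixes the third. *)
have dec F : measurable F -> lebesgue_rV n (F `&` @Omega R n) =
    (lebesgue_rV n (F `&` S) + lebesgue_rV n (F `&` S') + lebesgue_rV n (F `&` N))%E.
  move=> mF; rewrite -measureU; [|exact: measurableI|exact: measurableI|]; last first.
    by apply/seteqP; split=> // w [[_ Sw] [_ /(SS' _ Sw)]].
  rewrite -measureU; [|by apply: measurableU; exact: measurableI|exact: measurableI|]; last first.
    by apply/seteqP; split=> // w [[[_ Sw]|[_ Sw]]] [_ [_ /=]] []; [left|right].
  congr (lebesgue_rV n _); apply/seteqP; split=> w.
    move=> [Fw Ow]; have [Sw|Sw] := pselect (S w); first by left; left.
    have [Sw'|Sw'] := pselect (S' w); first by left; right.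
    by right; split=> //; split=> // -[].
  by move=> [[[Fw /SO]|[Fw /SO']]|[Fw [Ow _]]].
exists T, S; split => //.
- move=> E mE; rewrite /leb_Omega /mrestr dec; last by rewrite -[X in measurable X]setTI; exact: mT.
  rewrite dec//; congr (_ + _)%E.
    rewrite addeC; congr (_ + _)%E.
      rewrite -(lebesgue_rV_translation (- t) (measurableI _ _ mE mS)).
      congr (lebesgue_rV n _); apply/seteqP; split=> w [/= Ew Sw].
        by split=> //; move: Ew; rewrite TS'.
      by split=> //=; rewrite TS'.
    rewrite -(lebesgue_rV_translation t (measurableI _ _ mE mS')).
    congr (lebesgue_rV n _); apply/seteqP; split=> w [/= Ew Sw].
      by split; [move: Ew; rewrite TS|exact: S'T].
    have Sw0 : S w by move: Sw; rewrite /S' /= addrK.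
    by split=> //=; rewrite TS.
  congr (lebesgue_rV n _); apply/seteqP; split=> w [/= Ew [Ow nS]]; split=> //.
    by move: Ew; rewrite TN// => h; apply: nS; [left|right].
  by rewrite /= TN// => h; apply: nS; [left|right].
- rewrite /leb_Omega /mrestr; suff -> : S `&` @Omega R n = S by [].
  by apply/seteqP; split=> [w []//|w Sw]; split=> //; case: Sw => -[].
split; last split.
- move=> w; have [Sw|Sw] := pselect (S w); first by rewrite (TS _ Sw) (TS' _ (S'T _ Sw)) addrK.
  have [Sw'|Sw'] := pselect (S' w); last by rewrite !(TN w).
  by rewrite (TS' _ Sw') (TS _ (ST _ Sw')) subrK.
- by move=> w Sw; rewrite TS//; case: Sw => -[? _] [? _].
- move=> w Sw; have [Sw'|Sw' _] := pselect (S' w); last exact: TN.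
  by rewrite TS'// => /(_ (ST _ Sw')).
Qed.
End translation.

Section lipschitz_extension.
Context {R : realType} {m : nat} {I : Type} (S : set I) (x : I -> 'rV[R]_m).
Context (C : R) (C0 : 0 <= C) (S0 : S !=set0).

Definition mcshane (a : I -> R) (q : 'rV[R]_m) : R :=
  inf [set a i + C * enorm (q - x i) | i in S].

Lemma mcshane_has_inf a q : (forall i j, S i -> S j -> `|a i - a j| <= C * enorm (x i - x j)) ->
  has_inf [set a i + C * enorm (q - x i) | i in S].
Proof.
move=> aL; have [i0 Si0] := S0; split; first by exists (a i0 + C * enorm (q - x i0)), i0.
exists (a i0 - C * enorm (q - x i0)) => _ [i Si <-].
have := aL _ _ Si Si0; rewrite ler_norml => /andP[h _].
have := ler_wpM2l C0 (enorm_dist (x i) (x i0) q); rewrite mulrDr (enormC (x i) q) => k.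
lra.
Qed.

Lemma mcshane_lipschitz a q q' :
  (forall i j, S i -> S j -> `|a i - a j| <= C * enorm (x i - x j)) ->
  `|mcshane a q - mcshane a q'| <= C * enorm (q - q').
Proof.
move=> aL.
have one u v : mcshane a u <= mcshane a v + C * enorm (u - v).
  rewrite -lerBlDr; apply: lb_le_inf; first exact: (mcshane_has_inf v aL).1.
  move=> _ [i Si <-]; rewrite lerBlDr.
  apply: (@le_trans _ _ (a i + C * enorm (u - x i))).
    by apply: ge_inf; [exact: (mcshane_has_inf u aL).2|exists i].
  by rewrite -addrA lerD2l -mulrDr ler_wpM2l// [leRHS]addrC enorm_dist.
have := one q q'; have := one q' q; rewrite (enormC q' q) => h1 h2.
by rewrite ler_norml; apply/andP; split; lra.
Qed.

Lemma mcshane_extends a i :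
  (forall i j, S i -> S j -> `|a i - a j| <= C * enorm (x i - x j)) -> S i ->
  mcshane a (x i) = a i.
Proof.
move=> aL Si; apply/eqP; rewrite eq_le; apply/andP; split.
  apply: ge_inf; first exact: (mcshane_has_inf _ aL).2.
  by exists i => //; rewrite subrr enorm0 mulr0 addr0.
apply: lb_le_inf; first exact: (mcshane_has_inf _ aL).1.
move=> _ [j Sj <-]; have := aL _ _ Si Sj; rewrite ler_norml => /andP[_]; lra.
Qed.

(** The hypothesis forces equal values of [p] at equal points [x i], which is how [p] becomes a
    function of [x]. Extending each coordinate separately costs the factor [n]. *)
Lemma lipschitz_extension n (p : I -> 'rV[R]_n) :
  (forall i j, S i -> S j -> enorm (p i - p j) <= C * enorm (x i - x j)) ->
  exists g : 'rV[R]_m -> 'rV[R]_n, (forall i, S i -> g (x i) = p i) /\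
    forall q q', enorm (g q - g q') <= n%:R * C * enorm (q - q').
Proof.
move=> pL; have aL (k : 'I_n) i j : S i -> S j ->
    `|p i ord0 k - p j ord0 k| <= C * enorm (x i - x j).
  move=> Si Sj; apply: le_trans (pL _ _ Si Sj).
  by have := coord_le_enorm (p i - p j) k; rewrite !mxE.
exists (fun q => \row_k mcshane (fun i => p i ord0 k) q); split=> [i Si|q q'].
  by apply/rowP => k; rewrite mxE mcshane_extends// => ? ?; exact: aL.
apply: (le_trans (enorm_le_sum _)).
apply: (@le_trans _ _ (\sum_(k < n) C * enorm (q - q'))).
  by apply: ler_sum => k _; rewrite !mxE; apply: mcshane_lipschitz => ? ?; exact: aL.
by rewrite sumr_const card_ord -[leLHS]mulr_natl mulrA.
Qed.
End lipschitz_extension.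

Section topology_rV.
Context {R : realType}.

Lemma lipschitz_continuous m n (f : 'rV[R]_m -> 'rV[R]_n) (K : R) :
  (forall q q', enorm (f q - f q') <= K * enorm (q - q')) -> continuous f.
Proof.
move=> fL q A /nbhs_ballP[e /= e0 eA].
have K1 : 0 < `|K| * m%:R + 1 by rewrite ltr_wpDl// mulr_ge0.
apply/nbhs_ballP; exists (e / (`|K| * m%:R + 1)) => [|u]; first exact: divr_gt0.
move=> qu; apply: eA; move: qu; rewrite -!ball_normE /=.
move=> qu; apply: (le_lt_trans (norm_le_enorm _)); apply: (le_lt_trans (fL _ _)).
move: qu; rewrite ltr_pdivlMr// => h; apply: le_lt_trans h.
apply: (@le_trans _ _ (`|K| * enorm (q - u))); first by rewrite ler_wpM2r ?enorm_ge0// ler_norm.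
apply: (@le_trans _ _ (`|K| * (m%:R * `|q - u|))); first by rewrite ler_wpM2l// enorm_le_norm.
by rewrite mulrA mulrC ler_wpM2l// lerDl.
Qed.

Lemma enorm_ball_nbhs n (q : 'rV[R]_n) (e : R) : 0 < e ->
  exists2 V, open_nbhs q V & forall v, V v -> enorm (v - q) < e.
Proof.
move=> e0; have n1 : 0 < n%:R + 1 :> R by rewrite ltr_wpDl.
exists (ball q (e / (n%:R + 1))).
  have r0 : 0 < e / (n%:R + 1) by exact: divr_gt0.
  by split; [exact: ball_open|exact: ballxx].
move=> v; rewrite -ball_normE /= => qv; apply: (le_lt_trans (enorm_le_norm _)).
move: qv; rewrite distrC ltr_pdivlMr// => h; apply: le_lt_trans h.
rewrite mulrC ler_wpM2l//; lra.
Qed.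

Lemma enorm_row_mxl m n (a : 'rV[R]_m) (b : 'rV[R]_n) : enorm a <= enorm (row_mx a b).
Proof.
rewrite -(@ler_pXn2r _ 2)// ?nnegrE ?enorm_ge0// !sqr_enorm {2}/dotp big_split_ord/=.
have -> : dotp a a = \sum_(i < m) row_mx a b ord0 (lshift n i) * row_mx a b ord0 (lshift n i).
  by apply: eq_bigr => i _; rewrite !row_mxEl.
by rewrite lerDl; apply: sumr_ge0 => i _; rewrite -expr2 sqr_ge0.
Qed.

Lemma enorm_row_mxr m n (a : 'rV[R]_m) (b : 'rV[R]_n) : enorm b <= enorm (row_mx a b).
Proof.
rewrite -(@ler_pXn2r _ 2)// ?nnegrE ?enorm_ge0// !sqr_enorm {2}/dotp big_split_ord/=.
have -> : dotp b b = \sum_(i < n) row_mx a b ord0 (rshift m i) * row_mx a b ord0 (rshift m i).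
  by apply: eq_bigr => i _; rewrite !row_mxEr.
by rewrite lerDr; apply: sumr_ge0 => i _; rewrite -expr2 sqr_ge0.
Qed.

Lemma measurable_enorm_lt (disp : measure_display) (T : measurableType disp) n
    (f : T -> 'rV[R]_n) (c : 'rV[R]_n) (r : R) : measurable_fun setT f ->
  measurable [set w | enorm (f w - c) < r].
Proof.
move=> mf; have mn : measurable_fun setT (fun w => enorm (f w - c)).
  apply: (measurableT_comp measurable_enorm).
  by apply: measurable_rVB => //; exact: measurable_cst.
rewrite (_ : [set _ | _] = (fun w => enorm (f w - c)) @^-1` `]-oo, r[).
  by rewrite -[X in measurable X]setTI; exact: mn.
by apply/seteqP; split=> w /=; rewrite in_itv.
Qed.

(** Almost every value of [f] lies in the support of its law: an exceptional point belongs to a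
    rational ball whose preimage is null, and there are countably many of these. *)
Lemma ae_mem_support (disp : measure_display) (T : measurableType disp)
    (mu : {measure set T -> \bar R}) n (f : T -> 'rV[R]_n) : measurable_fun setT f ->
  {ae mu, forall w, forall e : R, 0 < e -> (0 < mu [set w' | enorm (f w' - f w) < e]%R)%E}.
Proof.
move=> mf; pose B (k : 'rV[rat]_n * rat) := [set w | enorm (f w - map_mx ratr k.1) < ratr k.2].
have mB k : measurable (B k) by exact: measurable_enorm_lt.
pose N n : set T := if unpickle n is Some k then
  if mu (B k) == 0%E then B k else set0 else set0.
have N0 : mu.-negligible (\bigcup_n N n).
  apply: negligible_bigcup => k; rewrite /N; case: unpickle => [c|]; last exact: negligible_set0.
  by case: eqP => [c0|_]; [apply/negligibleP|exact: negligible_set0].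
apply: negligibleS N0 => w /= /existsNP[e /not_implyP[e0 H]].
(* A rational ball of radius below e/2 that contains [f w] lies within distance e of it. Below, its
   centre is chosen within r/(n + 1) in each coordinate, so that the [n] errors add up to less than
   r. *)
have e2 : 0 < e / 2 by rewrite divr_gt0.
have [r] := rat_in_itvoo e2; rewrite in_itv/= => /andP[r0 re].
have n1 : 0 < n%:R + 1 :> R by rewrite ltr_wpDl.
have /choice[c Hc] i : exists q : rat, `|f w ord0 i - ratr q| < ratr r / (n%:R + 1).
  have : f w ord0 i < f w ord0 i + ratr r / (n%:R + 1) by rewrite ltrDl divr_gt0.
  move=> /rat_in_itvoo[q]; rewrite in_itv/= => /andP[h1 h2]; exists q.
  by rewrite ltr_norml; apply/andP; split; lra.
pose k : 'rV[rat]_n * rat := (\row_i c i, r).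
have wk : enorm (f w - map_mx ratr k.1) < ratr k.2.
  apply: (le_lt_trans (enorm_le_sum _)).
  apply: (@le_lt_trans _ _ (\sum_(i < n) ratr r / (n%:R + 1))).
    by apply: ler_sum => i _; rewrite !mxE ltW.
  rewrite sumr_const card_ord -[ltLHS]mulr_natl mulrA ltr_pdivrMr// mulrC ltr_pM2l//; lra.
exists (pickle k) => //; rewrite /N pickleK; case: eqP => // mk.
apply: H; apply: (@lt_le_trans _ _ (mu (B k))).
  by rewrite lt0e measure_ge0 andbT; apply/eqP.
apply: le_measure; rewrite ?inE//; first exact: measurable_enorm_lt.
move=> w' wk'; have {}wk' : enorm (f w' - map_mx ratr k.1) < ratr k.2 := wk'.
have {}re : ratr k.2 < e / 2 := re.
rewrite /=; apply: (le_lt_trans (enorm_dist _ _ (map_mx ratr k.1))).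
by rewrite (enormC (map_mx ratr k.1) (f w)); lra.
Qed.
End topology_rV.

(** * The gradient of a law-invariant function *)

Section law_invariant_gradient.
Context {R : realType} {d : nat} (U : P2 R d -> R) (hU : P2_function U).
Local Notation leb := (leb_Omega d).
Local Notation F := (lift_P2 U).
Implicit Types (x y h p : H R d) (f : 'rV[R]_d -> 'rV[R]_d).

Lemma lift_same_law x y :
  (forall A, measurable A -> leb (x @^-1` A) = leb (y @^-1` A)) -> F x = F y.
Proof. by move=> E; apply: hU => A mA; exact: E. Qed.

Section composition.
Context (T : 'rV[R]_d -> 'rV[R]_d) (mT : measurable_fun setT T).
Context (pT : forall A, measurable A -> leb (T @^-1` A) = leb A).

Lemma sqi_compT f : sqi leb f -> sqi leb (f \o T).
Proof.
move=> sf; have := sqi_image (mu := leb) (nu := leb) mT (fun A mA => esym (pT mA)) sf.1.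
by move=> -[+ _]; exact.
Qed.

Lemma n2_compT f : sqi leb f -> n2 leb (f \o T) = n2 leb f.
Proof.
move=> sf; congr Num.sqrt; apply/esym; have sfT := sqi_compT sf.
exact: (ip_image mT (fun A mA => esym (pT mA)) sfT sfT sf.1 sf.1).
Qed.

Definition compH x : H R d := ofL2 (sqi_compT (H_sqi x)).

Lemma lift_compH x : F (compH x) = F x.
Proof.
apply: lift_same_law => A mA; rewrite -[LHS]/(leb (T @^-1` (x @^-1` A))) pT//.
by rewrite -[X in measurable X]setTI; exact: (H_sqi x).1.
Qed.

(** Composition with [T] preserves the inner product and the lift and is its own inverse: the
    expansion at [compH x] towards [y] is the one at [x] towards [compH y]. *)
Lemma is_gradH_compH x p : involutive T -> is_gradH F x p -> is_gradH F (compH x) (compH p).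
Proof.
move=> TT Fxp e e0; have [r r0 Hr] := Fxp e e0; exists r => // y.
have sp := H_sqi p; have sx := H_sqi x.
have s1 := sqiB (H_sqi (compH y)) sx; have s2 := sqiB (H_sqi y) (H_sqi (compH x)).
have E : (fun w => y w - compH x w) = (fun w => compH y w - x w) \o T.
  by apply/funext => w /=; rewrite TT.
have := Hr (compH y); rewrite lift_compH lift_compH.
rewrite (normHE s1) (normHE s2) -[y \- compH x]/(fun w => y w - compH x w) E (n2_compT s1).
have -> : dotH p (compH y \- x) = dotH (compH p) ((fun w => compH y w - x w) \o T).
  exact: (ip_image mT (fun A mA => esym (pT mA)) (sqi_compT sp) (sqi_compT s1) sp.1 s1.1).
by [].
Qed.
End composition.

Context (G : H R d -> H R d) (FG : forall x, is_gradH F x (G x)).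
Context (C : R) (C0 : 0 <= C).
Context (GC : forall x y, n2 leb (fun w => G x w - G y w) <= C * n2 leb (fun w => x w - y w)).

Lemma grad_swap x (T : 'rV[R]_d -> 'rV[R]_d) : measurable_fun setT T ->
  (forall A, measurable A -> leb (T @^-1` A) = leb A) -> involutive T ->
  n2 leb (fun w => G x (T w) - G x w) <= C * n2 leb (fun w => x (T w) - x w).
Proof.
move=> mT pT TT; have := GC (compH mT pT x) x; apply: le_trans.
have sG := H_sqi (G x); have s1 := H_sqi (compH mT pT (G x)).
have s2 := H_sqi (G (compH mT pT x)).
apply: (le_trans (n2_dist s1 sG s2)).
rewrite (is_gradH_unique (is_gradH_compH mT pT TT (FG x)) (FG (compH mT pT x))).
by rewrite add0r.
Qed.

Lemma integrable_scaled_indic (A : set 'rV[R]_d) (c : R) : measurable A ->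
  leb.-integrable setT (EFin \o (fun w => c * \1_A w)).
Proof. by move=> mA; have := integrableZl measurableT c (integrable_indic leb mA). Qed.

Lemma Rintegral_scaled_indic (A : set 'rV[R]_d) (c : R) : measurable A ->
  \int[leb]_w (c * \1_A w) = c * fine (leb A).
Proof.
move=> mA; rewrite RintegralZl//; last exact: integrable_indic.
by congr (_ * _); rewrite /Rintegral integral_indic// setIT.
Qed.

Lemma n2_lower (A : set 'rV[R]_d) f (c : R) : measurable A -> sqi leb f -> 0 <= c ->
  (forall w, A w -> c <= enorm (f w)) -> c ^+ 2 * fine (leb A) <= n2 leb f ^+ 2.
Proof.
move=> mA sf c0 cf; rewrite sqr_n2 ip_sqr_enorm -Rintegral_scaled_indic//.
apply: le_Rintegral => //; [exact: integrable_scaled_indic|exact: sf.2|].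
move=> w _; rewrite indicE; case: (pselect (A w)) => Aw.
  by rewrite mem_set// mulr1 ler_pXn2r// ?nnegrE ?enorm_ge0 ?cf.
by rewrite memNset// mulr0 sqr_ge0.
Qed.

Lemma n2_upper (A : set 'rV[R]_d) f (c : R) : measurable A -> sqi leb f -> 0 <= c ->
  (forall w, A w -> enorm (f w) <= c) -> (forall w, ~ A w -> f w = 0) ->
  n2 leb f ^+ 2 <= c ^+ 2 * fine (leb A).
Proof.
move=> mA sf c0 cf f0; rewrite sqr_n2 ip_sqr_enorm -Rintegral_scaled_indic//.
apply: le_Rintegral => //; [exact: sf.2|exact: integrable_scaled_indic|].
move=> w _; rewrite indicE; case: (pselect (A w)) => Aw.
  by rewrite mem_set// mulr1 ler_pXn2r// ?nnegrE ?enorm_ge0 ?cf.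
by rewrite memNset// mulr0 f0// enorm0 expr0n.
Qed.

(** Closeness of the values of [x] says nothing yet about those of [G x]; localizing the pair
    controls both on the same set. *)
Let pair_at x w := row_mx (x w) (G x w).

Lemma measurable_pair_at x : measurable_fun setT (pair_at x).
Proof.
apply: measurable_fun_rV => i; case: (splitP i) => j ij.
- have -> : i = lshift d j by exact: val_inj.
  under eq_fun do rewrite row_mxEl; exact: measurable_fun_coord (H_sqi x).1.
- have -> : i = rshift d j by exact: val_inj.
  under eq_fun do rewrite row_mxEr; exact: measurable_fun_coord (H_sqi (G x)).1.
Qed.

Lemma grad_lipschitz x w1 w2 :
  (forall e : R, 0 < e -> (0 < leb [set w | enorm (pair_at x w - pair_at x w1) < e]%R)%E) ->
  (forall e : R, 0 < e -> (0 < leb [set w | enorm (pair_at x w - pair_at x w2) < e]%R)%E) ->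
  enorm (G x w1 - G x w2) <= C * enorm (x w1 - x w2).
Proof.
move=> h1 h2; have [E|E] := eqVneq (enorm (pair_at x w1 - pair_at x w2)) 0.
  have := enorm_eq0 E; rewrite /pair_at opp_row_mx add_row_mx => /eqP.
  rewrite -row_mx0 => /eqP /eq_row_mx[-> ->]; rewrite enorm0 mulr0//.
have D0 : 0 < enorm (pair_at x w1 - pair_at x w2) by rewrite lt_neqAle eq_sym E enorm_ge0.
set D := enorm _ in D0.
(* Below D/2 the two neighbourhoods are disjoint, as the swap requires. *)
have small (e : R) : 0 < e -> e < D / 2 ->
    enorm (G x w1 - G x w2) - 2 * e <= C * (enorm (x w1 - x w2) + 2 * e).
  move=> e0 eD; pose A i := [set w | enorm (pair_at x w - pair_at x i) < e].
  have mA i : measurable (A i) by apply: measurable_enorm_lt; exact: measurable_pair_at.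
  have AB : A w1 `&` A w2 = set0.
    apply/seteqP; split=> // w [a1 a2]; exfalso.
    rewrite /A /= in a1 a2.
    have := enorm_dist (pair_at x w1) (pair_at x w2) (pair_at x w).
    rewrite (enormC (pair_at x w1) (pair_at x w)) -/D; lra.
  have [T [S [mT pT mS S0 [TT [ST TN]]]]] :=
    measure_preserving_swap (mA w1) (mA w2) AB (h1 e e0) (h2 e e0).
  have [neg|pos] := leP (enorm (G x w1 - G x w2)) (2 * e).
    apply: (@le_trans _ _ 0); first by rewrite subr_le0.
    by rewrite mulr_ge0// addr_ge0 ?enorm_ge0// mulr_ge0// ltW.
  (* [T] moves no point outside [S2]. On [S2], [G x] changes by at least |G x w1 - G x w2| - 2e and
     [x] by at most |x w1 - x w2| + 2e, so that the measure of [S2] cancels from the Lipschitz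
     estimate. *)
  pose S2 := S `|` T @^-1` S.
  have mS2 : measurable S2.
    by apply: measurableU => //; rewrite -[X in measurable X]setTI; exact: mT.
  have S20 : 0 < fine (leb S2).
    rewrite -lte_fin fineK ?fin_num_measure//; apply: lt_le_trans S0 _.
    by apply: le_measure; rewrite ?inE//; exact: subsetUl.
  have S2P w : S2 w -> (A w1 w /\ A w2 (T w)) \/ (A w1 (T w) /\ A w2 w).
    by move=> [/ST|/ST]; [left|rewrite TT; right].
  have px z w : enorm (x z - x w) <= enorm (pair_at x z - pair_at x w).
    rewrite /pair_at opp_row_mx add_row_mx; exact: enorm_row_mxl.
  have pG z w : enorm (G x z - G x w) <= enorm (pair_at x z - pair_at x w).
    rewrite /pair_at opp_row_mx add_row_mx; exact: enorm_row_mxr.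
  have sx := sqiB (sqi_compT mT pT (H_sqi x)) (H_sqi x).
  have sG := sqiB (sqi_compT mT pT (H_sqi (G x))) (H_sqi (G x)).
  have lo : (enorm (G x w1 - G x w2) - 2 * e) ^+ 2 * fine (leb S2)
      <= n2 leb (fun w => G x (T w) - G x w) ^+ 2.
    apply: n2_lower => //; first by rewrite subr_ge0 ltW.
    move=> w /S2P[] [/= a1 a2].
      have k1 := le_lt_trans (pG _ _) a1; have k2 := le_lt_trans (pG _ _) a2.
      have := enorm_dist (G x w1) (G x w2) (G x w).
      have := enorm_dist (G x w) (G x w2) (G x (T w)).
      rewrite (enormC (G x w1) (G x w)) (enormC (G x w) (G x (T w))); lra.
    have k1 := le_lt_trans (pG _ _) a1; have k2 := le_lt_trans (pG _ _) a2.
    have := enorm_dist (G x w1) (G x w2) (G x (T w)).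
    have := enorm_dist (G x (T w)) (G x w2) (G x w).
    rewrite (enormC (G x w1) (G x (T w))); lra.
  have up : n2 leb (fun w => x (T w) - x w) ^+ 2 <=
      (enorm (x w1 - x w2) + 2 * e) ^+ 2 * fine (leb S2).
    apply: n2_upper => //; first by rewrite addr_ge0 ?enorm_ge0// mulr_ge0// ltW.
      move=> w /S2P[] [/= a1 a2].
        have k1 := le_lt_trans (px _ _) a1; have k2 := le_lt_trans (px _ _) a2.
        have := enorm_dist (x (T w)) (x w) (x w2); have := enorm_dist (x w2) (x w) (x w1).
        rewrite (enormC (x w2) (x w1)) (enormC (x w1) (x w)); lra.
      have k1 := le_lt_trans (px _ _) a1; have k2 := le_lt_trans (px _ _) a2.
      have := enorm_dist (x (T w)) (x w) (x w1); have := enorm_dist (x w1) (x w) (x w2).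
      rewrite (enormC (x w2) (x w)); lra.
    move=> w nS; rewrite TN ?subrr//; first by move=> Sw; apply: nS; left.
    by move=> Sw; apply: nS; right.
  have gs := grad_swap x mT pT TT.
  have gs2 : n2 leb (fun w => G x (T w) - G x w) ^+ 2 <=
      C ^+ 2 * n2 leb (fun w => x (T w) - x w) ^+ 2.
    by rewrite -exprMn; apply: lerXn2r gs; rewrite nnegrE ?mulr_ge0 ?n2_ge0.
  have b0 : 0 <= enorm (x w1 - x w2) + 2 * e by rewrite addr_ge0 ?enorm_ge0// mulr_ge0// ltW.
  rewrite -(@ler_pXn2r _ 2)// ?nnegrE ?subr_ge0 ?mulr_ge0 ?(ltW pos)// exprMn.
  rewrite -(ler_pM2r S20); apply: (le_trans lo); apply: (le_trans gs2).
  by rewrite -[leRHS]mulrA ler_wpM2l// exprn_ge0.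
apply/ler_addgt0Pr => eta eta0.
have K0 : 0 < 2 * C + 2 by rewrite ltr_wpDl// mulr_ge0.
(* The first bound ensures e < D/2, the second absorbs the error (2C + 2) e. *)
pose e := Num.min (D / 4) (eta / (2 * C + 2)).
have e0 : 0 < e by rewrite lt_min !divr_gt0.
have e1 : e <= D / 4 by rewrite ge_min lexx.
have e2 : e * (2 * C + 2) <= eta by rewrite -ler_pdivlMr// ge_min lexx orbT.
have := small e e0; clearbody e; lra.
Qed.
End law_invariant_gradient.

Section lipschitz_L2.
Context {R : realType} {n : nat} {disp : measure_display} {T : measurableType disp}.
Variable mu : {measure set T -> \bar R}.

Lemma n2_ae_eq0 (f : T -> 'rV[R]_n) : sqi mu f -> {ae mu, forall w, f w = 0} -> n2 mu f = 0.
Proof.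
move=> sf f0; rewrite /n2; suff -> : ip mu f f = 0 by rewrite sqrtr0.
apply: EFin_inj; rewrite EFin_ip// (ae_eq_integral (cst 0%E))//.
- by rewrite integral_cst// mul0e.
- exact/measurable_EFinP/measurable_sqr_enorm/sf.1.
- by apply: filterS f0 => w -> _; rewrite enorm0 expr0n.
Qed.

Lemma sqi_lipschitz m (g : 'rV[R]_m -> 'rV[R]_n) (K : R) (f : T -> 'rV[R]_m) :
  (mu setT < +oo)%E -> (forall q q', enorm (g q - g q') <= K * enorm (q - q')) ->
  sqi mu f -> sqi mu (g \o f).
Proof.
move=> fmu gK sf.
have mg : measurable_fun setT (g \o f).
  apply: measurableT_comp sf.1.
  exact: continuous_measurable_rV (lipschitz_continuous gK).
have sK := integrableZl measurableT (K ^+ 2) sf.2.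
have := sqi_cst (g 0) fmu => -[_ s0].
have ik := integrableZl measurableT 2 (integrableD measurableT sK s0).
apply: (sqi_dominated (k := fun w => 2 * (K ^+ 2 * enorm (f w) ^+ 2 + enorm (g 0) ^+ 2)) mg).
  by move: ik.
move=> w; rewrite -exprMn -{1}[(g \o f) w](subrK (g 0)).
apply: (le_trans (sqr_enormD _ _)); rewrite ler_wpM2l// lerD2r.
have := gK (f w) 0; rewrite subr0 => h; have e0 := enorm_ge0 (g (f w) - g 0).
by rewrite ler_pXn2r// nnegrE// (le_trans e0).
Qed.
End lipschitz_L2.

Lemma leb_Omega_fin (R : realType) (d : nat) : (@leb_Omega R d setT < +oo)%E.
Proof. by rewrite probability_setT ltry. Qed.

Section gradient_structure.
Context {R : realType} {d : nat} (U : P2 R d -> R) (hU : P2_function U).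
Local Notation leb := (leb_Omega d).
Local Notation F := (lift_P2 U).
Implicit Types (x y h p : H R d).
Context (G : H R d -> H R d) (FG : forall x, is_gradH F x (G x)).
Context (C : R) (C0 : 0 <= C).
Context (GC : forall x y, n2 leb (fun w => G x w - G y w) <= C * n2 leb (fun w => x w - y w)).

(** Almost all values of (x, G x) lie in the support of its law; there [grad_lipschitz] makes G x a
    Lipschitz function of x, which is then extended with constant d C. On the support of the law of
    x the constant C survives, since the values of x at good points are dense there. *)
Lemma grad_structure x : exists g : 'rV[R]_d -> 'rV[R]_d,
  [/\ forall q q', enorm (g q - g q') <= d%:R * C * enorm (q - q'),
      n2 leb (fun w => G x w - g (x w)) = 0 &
      forall q q', spt (sharp x) q -> spt (sharp x) q' ->
        enorm (g q - g q') <= C * enorm (q - q')].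
Proof.
pose P w := row_mx (x w) (G x w).
pose good w := forall e : R, 0 < e -> (0 < leb [set w' | enorm (P w' - P w) < e]%R)%E.
have ae : {ae leb, forall w, good w}.
  exact: (ae_mem_support leb (measurable_pair_at G x)).
have goodV V : measurable V -> (0 < leb V)%E -> exists2 w, V w & good w.
  move=> mV V0; apply: contrapT => H.
  have : leb.-negligible V.
    by apply: negligibleS ae => w Vw gw; apply: H; exists w.
  by move/negligibleP => /(_ mV) V00; move: V0; rewrite V00 ltxx.
have good0 : good !=set0.
  have [||w _ gw] := goodV setT => //; last by exists w.
  by rewrite probability_setT lte_fin.
have pL i j : good i -> good j -> enorm (G x i - G x j) <= C * enorm (x i - x j).
  by move=> gi gj; exact: (grad_lipschitz hU FG C0 GC gi gj).
have [g [gE gL]] := lipschitz_extension C0 good0 pL.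
exists g; split => //.
  have sgx := sqi_lipschitz (leb_Omega_fin R d) gL (H_sqi x).
  apply: n2_ae_eq0; first exact: sqiB (H_sqi (G x)) sgx.
  by apply: filterS ae => w gw; rewrite gE// subrr.
move=> q q' sq sq'; apply/ler_addgt0Pr => eta eta0.
set K := d%:R * C in gL; have K0 : 0 <= K by rewrite mulr_ge0.
(* Replacing [q] and [q'] by values of [x] at good points costs 2 K e for the extension and 2 C e
   for the distance between the points. *)
have K1 : 0 < 2 * K + 2 * C + 1 by rewrite ltr_wpDl// addr_ge0// mulr_ge0.
pose e := eta / (2 * K + 2 * C + 1); have e0 : 0 < e by exact: divr_gt0.
have near_pt u : spt (sharp x) u -> exists2 w, good w & enorm (x w - u) < e.
  move=> su; have [V oV VE] := enorm_ball_nbhs u e0.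
  have [||w Vw gw] := goodV (x @^-1` V).
  - by rewrite -[X in measurable X]setTI; apply: (H_sqi x).1 => //; apply: open_measurable_rV; case: oV.
  - exact: (su V oV).
  by exists w => //; exact: VE.
have [w gw we] := near_pt q sq; have [w' gw' we'] := near_pt q' sq'.
have l1 := gL q (x w); have l2 := gL (x w') q'; have l3 := pL _ _ gw gw'.
rewrite -(gE _ gw) -(gE _ gw') in l3.
have d1 := enorm_dist (g q) (g q') (g (x w)); have d2 := enorm_dist (g (x w)) (g q') (g (x w')).
have d3 := enorm_dist (x w) (x w') q; have d4 := enorm_dist q (x w') q'.
rewrite (enormC q (x w)) in l1; rewrite (enormC q' (x w')) in d4.
have l1' : K * enorm (x w - q) <= K * e by rewrite ler_wpM2l// ltW.
have l2' : K * enorm (x w' - q') <= K * e by rewrite ler_wpM2l// ltW.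
have l3' : C * enorm (x w - x w') <= C * (enorm (q - q') + 2 * e).
  by rewrite ler_wpM2l//; lra.
have eE : e * (2 * K + 2 * C + 1) = eta by rewrite /e divfK// gt_eqF.
by move: l1 l2 l3 l1' l2' l3' d1 d2 eE e0; clear; move: e => e; lra.
Qed.

Lemma is_gradH_derive0 x p h : is_gradH F x p ->
  is_derive (0 : R) 1 (fun t => F (lineH x h t)) (ip leb p h).
Proof.
move=> Fxp; apply: is_derive_eps => e e0; have [r r0 Hr] := is_gradH_line h Fxp e0.
exists r => // s sr; rewrite add0r.
have -> : F (lineH x h 0) = F x.
  by apply: (lift_same_law hU) => A mA; congr (leb _); apply/seteqP; split=> w /=;
    rewrite scale0r addr0.
exact: Hr.
Qed.

Lemma ip_same_law x y (f g : 'rV[R]_d -> 'rV[R]_d) :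
  (forall A, measurable A -> leb (x @^-1` A) = leb (y @^-1` A)) ->
  measurable_fun setT f -> measurable_fun setT g ->
  sqi leb (f \o x) -> sqi leb (g \o x) -> sqi leb (f \o y) -> sqi leb (g \o y) ->
  ip leb (f \o x) (g \o x) = ip leb (f \o y) (g \o y).
Proof.
move=> E mf mg sfx sgx sfy sgy.
rewrite -(ip_image (mu := sharp x) (H_sqi x).1 (fun A _ => erefl) sfx sgx mf mg).
exact: (ip_image (mu := sharp x) (H_sqi y).1 E sfy sgy mf mg).
Qed.

(** The direction psi = g - g' is tested: x + t psi(x) and y + t psi(y) have the same law, so the
    derivatives <g o x, psi o x> and <g' o y, psi o y> agree. The former also equals <g o y, psi o
    y>, and the difference is the squared norm of psi o y. *)
Lemma grad_same_law x y (g g' : 'rV[R]_d -> 'rV[R]_d) (K : R) :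
  (forall A, measurable A -> leb (x @^-1` A) = leb (y @^-1` A)) ->
  (forall q q', enorm (g q - g q') <= K * enorm (q - q')) ->
  (forall q q', enorm (g' q - g' q') <= K * enorm (q - q')) ->
  n2 leb (fun w => G x w - g (x w)) = 0 -> n2 leb (fun w => G y w - g' (y w)) = 0 ->
  n2 leb (fun w => G y w - g (y w)) = 0.
Proof.
move=> E gK g'K gx gy.
have mg := continuous_measurable_rV (lipschitz_continuous gK).
have mg' := continuous_measurable_rV (lipschitz_continuous g'K).
have sgx := sqi_lipschitz (leb_Omega_fin R d) gK (H_sqi x).
have sgy := sqi_lipschitz (leb_Omega_fin R d) gK (H_sqi y).
have sg'x := sqi_lipschitz (leb_Omega_fin R d) g'K (H_sqi x).
have sg'y := sqi_lipschitz (leb_Omega_fin R d) g'K (H_sqi y).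
pose psi q := g q - g' q; have mpsi : measurable_fun setT psi by exact: measurable_rVB.
have spx : sqi leb (psi \o x) by exact: sqiB.
have spy : sqi leb (psi \o y) by exact: sqiB.
have D1 := is_gradH_derive0 (ofL2 spx) (FG x).
have D2 := is_gradH_derive0 (ofL2 spy) (FG y).
have lineE : (fun t : R => F (lineH x (ofL2 spx) t)) = (fun t => F (lineH y (ofL2 spy) t)).
  apply/funext => t; apply: (lift_same_law hU) => A mA.
  have mA' : measurable ((fun q => q + t *: psi q) @^-1` A).
    rewrite -[X in measurable X]setTI; apply: measurable_rVD => //.
    by apply: measurable_rVZ => //; exact: measurable_cst.
  exact: (E _ mA').
have E1 : ip leb (G x) (psi \o x) = ip leb (G y) (psi \o y).
  by have [_ <-] := D1; have [_ <-] := D2; rewrite lineE.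
have sGx := H_sqi (G x); have sGy := H_sqi (G y).
have E2 : ip leb (G x) (psi \o x) = ip leb (g \o x) (psi \o x).
  apply/eqP; rewrite -subr_eq0 -ipBl// ip_null//; exact: sqiB.
have E3 : ip leb (G y) (psi \o y) = ip leb (g' \o y) (psi \o y).
  apply/eqP; rewrite -subr_eq0 -ipBl// ip_null//; exact: sqiB.
have E4 := ip_same_law E mg mpsi sgx spx sgy spy.
have z : n2 leb (psi \o y) = 0.
  have : ip leb (psi \o y) (psi \o y) = 0.
    rewrite -[psi \o y in X in ip _ X _]/(fun w => (g \o y) w - (g' \o y) w) ipBl//.
    by rewrite -E4 -E2 E1 E3 subrr.
  by rewrite /n2 => ->; rewrite sqrtr0.
apply/eqP; rewrite eq_le n2_ge0 andbT.
apply: (le_trans (n2_dist sGy sgy sg'y)); rewrite gy add0r n2C.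
by rewrite -[X in X <= _]/(n2 leb (psi \o y)) z.
Qed.
End gradient_structure.

Section coupling_laws.
Context {R : realType} {d : nat}.
Local Notation leb := (leb_Omega d).

Lemma sqi_law (mu : P2 R d) (f : 'rV[R]_d -> 'rV[R]_d) : measurable_fun setT f ->
  (forall A, measurable A -> mu A = leb (f @^-1` A)) -> sqi leb f.
Proof.
move=> mf E; have mid : measurable_fun setT (id : 'rV[R]_d -> 'rV[R]_d) by exact: measurable_id.
have := sqi_image (mu := mu) (nu := leb) mf E mid => -[+ _]; apply.
exact: sqi_lty (P2_finite mu).
Qed.

Lemma coupling_law (mu nu : P2 R d) gamma : couplings mu nu gamma ->
  exists x y : H R d, [/\ forall A, measurable A -> gamma A = leb ((fun w => (x w, y w)) @^-1` A),
    forall A, measurable A -> mu A = leb (x @^-1` A) &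
    forall A, measurable A -> nu A = leb (y @^-1` A)].
Proof.
move=> cg; have [X mX XE] := coupling_realization gamma.
have m1 : measurable_fun setT (fst \o X) by exact: measurableT_comp.
have m2 : measurable_fun setT (snd \o X) by exact: measurableT_comp.
have E1 A : measurable A -> mu A = leb ((fst \o X) @^-1` A).
  move=> mA; rewrite -(cg A mA).1 XE; last exact: measurableX.
  by congr (leb _); apply/seteqP; split=> [w []|w].
have E2 A : measurable A -> nu A = leb ((snd \o X) @^-1` A).
  move=> mA; rewrite -(cg A mA).2 XE; last exact: measurableX.
  by congr (leb _); apply/seteqP; split=> [w []|w].
exists (ofL2 (sqi_law m1 E1)), (ofL2 (sqi_law m2 E2)); split => // A mA.
rewrite XE//; congr (leb _); apply/seteqP; split=> w /=; by case: (X w).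
Qed.

(** The diagonal plan of [mu] reduces this to the realization of plans. *)
Lemma law_exists (mu : P2 R d) : exists x : H R d,
  forall A, measurable A -> mu A = leb (x @^-1` A).
Proof.
have md : measurable_fun setT (fun q : 'rV[R]_d => (q, q)) by exact: measurable_fun_pair.
pose gamma : probability ('rV[R]_d * 'rV[R]_d)%type R := distribution mu (mfun_of md).
have cg : couplings mu mu gamma.
  move=> A mA; split; congr (mu _); first by apply/seteqP; split=> [q []|q].
  by apply/seteqP; split=> [q []|q].
by have [x [y [_ E _]]] := coupling_law cg; exists x.
Qed.
End coupling_laws.

(** * Approximation by test functions *)

Section smooth_real_functions.
Context {R : realType}.
Implicit Types (u v : R -> R) (n : nat).

Fixpoint Cn n u : Prop :=
  if n is n'.+1 then exists v, (forall t : R, is_derive t (1 : R) u (v t)) /\ Cn n' v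
  else continuous u.

Lemma is_derive_continuous u v : (forall t : R, is_derive t (1 : R) u (v t)) -> continuous u.
Proof.
move=> du t; apply: differentiable_continuous; apply/derivable1_diffP.
by have [] := du t.
Qed.

Lemma Cn_continuous n u : Cn n u -> continuous u.
Proof. by case: n => // n [v [du _]]; exact: is_derive_continuous du. Qed.

Lemma CnS n u : Cn n.+1 u -> Cn n u.
Proof.
elim: n u => [|n IH] u; first exact: Cn_continuous.
by move=> [v [du cv]]; exists v; split=> //; exact: IH.
Qed.

Lemma Cn_cst n (c : R) : Cn n (fun=> c).
Proof.
elim: n c => [|n IH] c; first exact: cst_continuous.
by exists (fun=> 0); split=> [t|//]; exact: is_derive_cst.
Qed.

Lemma CnD n u v : Cn n u -> Cn n v -> Cn n (fun t => u t + v t).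
Proof.
elim: n u v => [|n IH] u v; first by move=> cu cv t; apply: cvgD; [exact: cu|exact: cv].
move=> [u' [du cu]] [v' [dv cv]]; exists (fun t => u' t + v' t); split=> [t|]; last exact: IH.
by have dut := du t; have dvt := dv t; exact: is_deriveD.
Qed.

Lemma CnM n u v : Cn n u -> Cn n v -> Cn n (fun t => u t * v t).
Proof.
elim: n u v => [|n IH] u v; first by move=> cu cv t; apply: cvgM; [exact: cu|exact: cv].
move=> Hu Hv; have cu := CnS Hu; have cv := CnS Hv.
move: Hu Hv => [u' [du cu']] [v' [dv cv']].
exists (fun t => u' t * v t + v' t * u t); split=> [t|]; last by apply: CnD; exact: IH.
have dut := du t; have dvt := dv t.
have h : is_derive t 1 (u * v) (u t *: v' t + v t *: u' t) by exact: is_deriveM.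
by apply: (is_derive_eq (f := u * v)); rewrite /GRing.scale/= addrC mulrC (mulrC (u t)).
Qed.

Lemma is_derive_affine (a b t : R) : is_derive t (1 : R) (fun t => a * t + b) a.
Proof.
have h : is_derive t (1 : R) (fun t : R => a *: t + b) (a *: (1 : R) + 0) by exact: is_deriveD.
by apply: (is_derive_eq h); rewrite addr0 /GRing.scale/= mulr1.
Qed.

Lemma is_derive_comp_affine u v (a b : R) : (forall t : R, is_derive t (1 : R) u (v t)) ->
  forall t : R, is_derive t (1 : R) (fun t => u (a * t + b)) (a * v (a * t + b)).
Proof.
move=> du t; have dl := is_derive_affine a b t.
have dd := du (a * t + b).
have h := @is_derive1_comp R u (fun t : R => a * t + b) t _ _ dd dl.
by apply: (is_derive_eq h); rewrite mulrC.
Qed.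

Lemma Cn_comp_affine n u (a b : R) : Cn n u -> Cn n (fun t => u (a * t + b)).
Proof.
elim: n u => [|n IH] u.
  move=> cu t; apply: continuous_comp; last exact: cu.
  by apply: cvgD; [apply: cvgMr; exact: cvg_id|exact: cvg_cst].
move=> [v [du cv]]; exists (fun t => a * v (a * t + b)).
split=> [t|]; first exact: is_derive_comp_affine.
by apply: CnM; [exact: Cn_cst|exact: IH].
Qed.

Lemma is_derive_inv u v (t : R) : u t != 0 -> is_derive t (1 : R) u (v t) ->
  is_derive t (1 : R) (fun t => (u t)^-1) (- (v t * ((u t)^-1 * (u t)^-1))).
Proof.
move=> u0 [du <-]; apply: DeriveDef; first exact: derivableV.
by rewrite deriveV// /GRing.scale/= -invfM expr2 mulNr mulrC.
Qed.

Lemma CnV n u : (forall t, u t != 0) -> Cn n u -> Cn n (fun t => (u t)^-1).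
Proof.
move=> u0; elim: n => [|n IH]; first by move=> cu t; apply: cvgV; [exact: u0|exact: cu].
move=> Hu; have cu := IH (CnS Hu); move: Hu => [v [du cv]].
exists (fun t => - 1 * (v t * ((u t)^-1 * (u t)^-1))); split=> [t|].
  by rewrite mulN1r; exact: is_derive_inv.
by apply: CnM; [exact: Cn_cst|apply: CnM => //; exact: CnM].
Qed.

(** exp(-1/t) extended by 0, times a power of 1/t: a family whose derivatives are combinations of
    its members, which permits the induction of [Cn_flat]. *)
Definition flat (k : nat) (t : R) : R := if t <= 0 then 0 else t^-1 ^+ k * expR (- t^-1).

(** One term of the exponential series, exp(1/t) >= t^-(k+2) / (k+2)!, gives quadratic decay at 0,
    hence a zero derivative there. *)
Lemma flat_le k t : 0 <= flat k t <= k.+2`!%:R * t ^+ 2.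
Proof.
rewrite /flat; have [t0|t0] := leP t 0; first by rewrite lexx mulr_ge0// sqr_ge0.
rewrite mulr_ge0 ?expR_ge0 ?exprn_ge0 ?invr_ge0 ?(ltW t0)//=.
have t1 : 0 <= t^-1 by rewrite invr_ge0 ltW.
have := expR_ge1Dxn k.+1 t1; rewrite expRN => h.
have f0 : 0 < (k.+2)`!%:R :> R by rewrite ltr0n fact_gt0.
have h2 : t^-1 ^+ k.+2 / k.+2`!%:R <= expR t^-1 by apply: le_trans h; rewrite lerDr.
have p0 : 0 < t^-1 ^+ k.+2 / k.+2`!%:R by rewrite divr_gt0// exprn_gt0// invr_gt0.
have := lef_pV2 (x := expR t^-1) (y := t^-1 ^+ k.+2 / k.+2`!%:R).
rewrite !posrE expR_gt0 p0 h2 => /(_ isT isT) h3.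
apply: (@le_trans _ _ (t^-1 ^+ k * (t^-1 ^+ k.+2 / k.+2`!%:R)^-1)).
  by rewrite ler_wpM2l ?h3// exprn_ge0.
have tn : t != 0 by rewrite gt_eqF.
rewrite invfM invrK -exprVn invrK -addn2 exprD exprVn [_ * t ^+ 2 * _]mulrAC.
by rewrite !mulrA mulVf ?expf_neq0// mul1r mulrC.
Qed.

Lemma is_derive_flat_pos k (t : R) : 0 < t ->
  is_derive t (1 : R) (fun t : R => t^-1 ^+ k * expR (- t^-1))
    (t^-1 ^+ k.+2 * expR (- t^-1) - k%:R * (t^-1 ^+ k.+1 * expR (- t^-1))).
Proof.
move=> t0; have tn : t != 0 by rewrite gt_eqF.
have di : is_derive t (1 : R) (fun t : R => t^-1) (- (1 * (t^-1 * t^-1))).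
  exact: (@is_derive_inv id (fun=> 1) t tn (is_derive_id t 1)).
have dn : is_derive t (1 : R) (fun t : R => - t^-1) (- (- (1 * (t^-1 * t^-1)))).
  exact: is_deriveN.
have de := @is_derive1_comp R expR (fun t : R => - t^-1) t _ _ (is_derive_expR (- t^-1)) dn.
have dk : is_derive t (1 : R) (fun t : R => t^-1 ^+ k) (- (k%:R * t^-1 ^+ k.+1)).
  case: k => [|k].
    apply: (is_derive_eq (is_derive_cst (1 : R) t 1)).
    by rewrite mul0r oppr0.
  have h := @is_deriveX _ _ (fun t : R => t^-1) k.+1 t 1 _ di.
  rewrite exprfctE in h.
  apply: (is_derive_eq h); rewrite /GRing.scale/= mul1r mulrN -mulrA; congr (- (_ * _)).
  by rewrite !exprSr mulrA.
have h := @is_deriveM _ _ _ _ t 1 _ _ dk de.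
apply: (is_derive_eq h); rewrite /GRing.scale/= mul1r opprK !exprSr; ring.
Qed.

Lemma is_derive_flat k (t : R) : is_derive t (1 : R) (flat k) (flat k.+2 t - k%:R * flat k.+1 t).
Proof.
have [t0|t0|->] := ltgtP t 0.
- rewrite /flat (ltW t0) mulr0 subr0.
  apply: (@near_eq_is_derive _ _ _ (fun=> 0)).
  by near=> s; rewrite ifT// ltW//; near: s; exact: lt_nbhsl.
- rewrite /flat leNgt t0/=; apply: near_eq_is_derive (is_derive_flat_pos k t0).
  by near=> s; rewrite leNgt ifF//; apply/negbTE; rewrite negbK; near: s; exact: lt_nbhsr.
- rewrite /flat lexx mulr0 subr0 -/(flat k).
  apply: is_derive_eps => e e0.
  have f0 : 0 < (k.+2)`!%:R :> R by rewrite ltr0n fact_gt0.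
  exists (e / k.+2`!%:R); first exact: divr_gt0.
  move=> s; rewrite ltr_pdivlMr// => se.
  rewrite add0r mulr0 !subr0 -/(flat k s) {2}/flat lexx subr0.
  have /andP[h1 h2] := flat_le k s; rewrite ger0_norm//; apply: (le_trans h2).
  by rewrite -real_normK ?num_real// expr2 mulrA ler_wpM2r// mulrC ltW.
Unshelve. all: by end_near. Qed.

Lemma Cn_flat n k : Cn n (flat k).
Proof.
elim: n k => [|n IH] k; first exact: is_derive_continuous (is_derive_flat k).
exists (fun t => flat k.+2 t + (- k%:R) * flat k.+1 t); split=> [t|].
  by rewrite mulNr; exact: is_derive_flat.
by apply: CnD => //; apply: CnM => //; exact: Cn_cst.
Qed.

Let den t := flat 0 t + flat 0 (- 1 * t + 1).

Let flat0_gt0 t : 0 < t -> 0 < flat 0 t.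
Proof. by move=> t0; rewrite /flat leNgt t0/= expr0 mul1r expR_gt0. Qed.

Let flat_le0 k t : t <= 0 -> flat k t = 0.
Proof. by rewrite /flat => ->. Qed.

Let flat_ge0 k t : 0 <= flat k t.
Proof. by have /andP[] := flat_le k t. Qed.

Let den_gt0 t : 0 < den t.
Proof.
rewrite /den; have [t0|t0] := leP t 0.
  by rewrite ltr_wpDl ?flat_ge0// flat0_gt0//; lra.
by rewrite ltr_wpDr ?flat_ge0// flat0_gt0.
Qed.

(** The classical smooth transition from 0 on t <= 0 to 1 on t >= 1; its denominator never vanishes
    because t or 1 - t is positive. *)
Definition step t : R := flat 0 t / den t.

Definition dstep t : R :=
  flat 2 t / den t - flat 0 t * ((flat 2 t - flat 2 (- 1 * t + 1)) / den t ^+ 2).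

Lemma is_derive_step t : is_derive t (1 : R) step (dstep t).
Proof.
have d0 := den_gt0 t; have dn : den t != 0 by rewrite gt_eqF.
have f0 (s : R) : is_derive s (1 : R) (flat 0) (flat 2 s).
  by apply: (is_derive_eq (is_derive_flat 0 s)); rewrite mul0r subr0.
have dd : is_derive t (1 : R) den (flat 2 t + - 1 * flat 2 (- 1 * t + 1)).
  have h1 := f0 t; have h2 := is_derive_comp_affine (- 1) 1 f0 t.
  exact: is_deriveD.
have di := is_derive_inv (v := fun t => flat 2 t + - 1 * flat 2 (- 1 * t + 1)) dn dd.
have h := @is_deriveM _ _ _ _ t 1 _ _ (f0 t) di.
apply: (is_derive_eq h); rewrite /GRing.scale/= /dstep mulN1r.
by rewrite [in RHS]expr2 invfM; ring.
Qed.

Lemma continuous_dstep : continuous dstep.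
Proof.
have cf k : continuous (flat k) by exact: (Cn_continuous (Cn_flat 0 k)).
have ca k : continuous (fun t : R => flat k (- 1 * t + 1)).
  exact: (@Cn_comp_affine 0 (flat k) (- 1) 1 (cf k)).
have cd : continuous den by move=> t; apply: cvgD; [exact: cf|exact: ca].
have dn t : den t != 0 by rewrite gt_eqF// den_gt0.
have ci : continuous (fun t => (den t)^-1) by exact: (@CnV 0 den dn cd).
move=> t; apply: cvgB; first by apply: cvgM; [exact: cf|exact: ci].
apply: cvgM; first exact: cf.
apply: cvgM; first by apply: cvgB; [exact: cf|exact: ca].
have -> : (fun x => (den x ^+ 2)^-1) = (fun x => (den x)^-1 * (den x)^-1).
  by apply/funext => x; rewrite expr2 invfM.
by rewrite expr2 invfM; apply: cvgM; exact: ci.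
Qed.

Lemma Cn_step n : Cn n step.
Proof.
apply: CnM; first exact: Cn_flat.
apply: CnV => [t|]; first by rewrite gt_eqF// den_gt0.
by apply: CnD; [exact: Cn_flat|apply: Cn_comp_affine; exact: Cn_flat].
Qed.

Lemma step0 t : t <= 0 -> step t = 0.
Proof. by move=> t0; rewrite /step flat_le0// mul0r. Qed.

Lemma step1 t : 1 <= t -> step t = 1.
Proof.
move=> t1; have d0 := den_gt0 t.
rewrite /step; have -> : flat 0 t = den t by rewrite /den (@flat_le0 _ (_ + _)) ?addr0//; lra.
by rewrite divff// gt_eqF.
Qed.

Lemma step01 t : 0 <= step t <= 1.
Proof.
rewrite /step divr_ge0 ?flat_ge0 ?(ltW (den_gt0 _))//=.
by rewrite ler_pdivrMr ?den_gt0// mul1r lerDl flat_ge0.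
Qed.

Lemma dstep_out t : t <= 0 \/ 1 <= t -> dstep t = 0.
Proof.
rewrite /dstep => -[t0|t1]; first by rewrite (flat_le0 2 t0) (flat_le0 0 t0) !mul0r subr0.
have E : flat 0 (- 1 * t + 1) = 0 by apply: flat_le0; lra.
have E2 : flat 2 (- 1 * t + 1) = 0 by apply: flat_le0; lra.
have d0 := den_gt0 t; rewrite /den E addr0 in d0 *; rewrite E2 subr0.
by field; rewrite gt_eqF.
Qed.

(** The derivative is continuous and vanishes outside ]0,1[, so its maximum over [0,1] is global;
    adding 1 makes the bound positive. *)
Lemma dstep_bounded : exists2 M, 0 < M & forall t, `|dstep t| <= M.
Proof.
have ca : {within `[0, 1], continuous (fun t => `|dstep t|)}.
  by apply: continuous_subspaceT => t; apply: cvg_norm; exact: continuous_dstep.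
have [c _ cmax] := EVT_max ler01 ca.
exists (`|dstep c| + 1); first by rewrite ltr_wpDl.
move=> t; have [t0|t0] := leP t 0; first by rewrite dstep_out ?normr0 ?addr_ge0//; left.
have [t1|t1] := leP 1 t; first by rewrite dstep_out ?normr0 ?addr_ge0//; right.
apply: (@le_trans _ _ `|dstep c|); last by rewrite lerDl.
by apply: cmax; rewrite in_itv/= !ltW.
Qed.
End smooth_real_functions.

Section smooth_functions_rV.
Context {R : realType} {d : nat}.
Implicit Types (F : 'rV[R]_d -> R) (q : 'rV[R]_d) (i j : 'I_d).

Local Notation e_ i := (delta_mx ord0 i : 'rV[R]_d).

(** Continuity is required at every order, since the existence of partial derivatives does not imply
    it. *)
Fixpoint CN (n : nat) F : Prop :=
  continuous F /\ if n is n'.+1 then exists F' : 'I_d -> 'rV[R]_d -> R,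
    (forall i q, is_derive q (e_ i) F (F' i q)) /\ forall i, CN n' (F' i) else True.

Lemma CNS n F : CN n.+1 F -> CN n F.
Proof.
elim: n F => [|n IH] F; first by move=> [].
by move=> [cF [F' [dF CF]]]; split=> //; exists F'; split=> // i; exact: IH.
Qed.

Lemma CN_cst n (c : R) : CN n (fun=> c).
Proof.
elim: n c => [|n IH] c; first by split=> //; exact: cst_continuous.
split; first exact: cst_continuous.
by exists (fun _ _ => 0); split=> [i q|i //]; exact: is_derive_cst.
Qed.

Lemma CND n F G : CN n F -> CN n G -> CN n (fun q => F q + G q).
Proof.
elim: n F G => [|n IH] F G.
  by move=> [cF _] [cG _]; split=> // q; apply: continuousD; [exact: cF|exact: cG].
move=> [cF [F' [dF CF]]] [cG [G' [dG CG]]]; split.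
  by move=> q; apply: continuousD; [exact: cF|exact: cG].
exists (fun i q => F' i q + G' i q); split=> [i q|i]; last by apply: IH; [exact: CF|exact: CG].
by have h1 := dF i q; have h2 := dG i q; exact: is_deriveD.
Qed.

Lemma CNM n F G : CN n F -> CN n G -> CN n (fun q => F q * G q).
Proof.
elim: n F G => [|n IH] F G.
  by move=> [cF _] [cG _]; split=> // q; apply: continuousM; [exact: cF|exact: cG].
move=> HF HG; have cF' := CNS HF; have cG' := CNS HG.
move: HF HG => [cF [F' [dF CF]]] [cG [G' [dG CG]]]; split.
  by move=> q; apply: continuousM; [exact: cF|exact: cG].
exists (fun i q => F' i q * G q + G' i q * F q); split=> [i q|i]; last first.
  by apply: CND; apply: IH => //; [exact: CF|exact: CG].
have h1 := dF i q; have h2 := dG i q.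
have h : is_derive q (e_ i) (F * G) (F q *: G' i q + G q *: F' i q) by exact: is_deriveM.
by apply: (is_derive_eq (f := F * G)); rewrite /GRing.scale/= addrC mulrC (mulrC (F q)).
Qed.

Lemma is_derive_coord (u : R -> R) (a : R) q i j : is_derive (q ord0 j) 1 u a ->
  is_derive q (e_ i) (fun q => u (q ord0 j)) ((i == j)%:R * a).
Proof.
move=> [du <-]; have [->|ij] := eqVneq i j.
  have E : (fun h => h^-1 *: (((fun q => u (q ord0 j)) \o shift q) (h *: e_ j) - u (q ord0 j))) =
      (fun h => h^-1 *: ((u \o shift (q ord0 j)) (h *: 1) - u (q ord0 j))).
    by apply/funext => h; rewrite /= !mxE !eqxx.
  by rewrite mul1r; apply: DeriveDef; rewrite /derivable /derive E.
have E : (fun h => h^-1 *: (((fun q => u (q ord0 j)) \o shift q) (h *: e_ i) - u (q ord0 j))) =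
    (fun h => 0).
  by apply/funext => h; rewrite /= !mxE eq_sym (negbTE ij) andbF mulr0 add0r subrr scaler0.
rewrite mul0r; apply: DeriveDef; rewrite /derivable /derive E; first exact: is_cvg_cst.
exact: lim_cst.
Qed.

Lemma CN_coord n (u : R -> R) j : Cn n u -> CN n (fun q => u (q ord0 j)).
Proof.
elim: n u => [|n IH] u cu.
  by split=> // q; apply: continuous_comp; [exact: coord_continuous|exact: cu].
split; first by move=> q; apply: continuous_comp; [exact: coord_continuous|exact: (Cn_continuous cu)].
move: cu => [v [du cv]]; exists (fun i q => (i == j)%:R * v (q ord0 j)).
split=> [i q|i]; first by apply: is_derive_coord; exact: du.
by apply: CNM; [exact: CN_cst|exact: IH].
Qed.

Lemma CN_sum n (I : Type) (s : seq I) (F : I -> 'rV[R]_d -> R) :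
  (forall a, CN n (F a)) -> CN n (fun q => \sum_(a <- s) F a q).
Proof.
move=> CF; elim: s => [|a s IH].
  by under eq_fun do rewrite big_nil; exact: CN_cst.
by under eq_fun do rewrite big_cons; exact: CND.
Qed.

Lemma CN_prod n (I : Type) (s : seq I) (F : I -> 'rV[R]_d -> R) :
  (forall a, CN n (F a)) -> CN n (fun q => \prod_(a <- s) F a q).
Proof.
move=> CF; elim: s => [|a s IH].
  by under eq_fun do rewrite big_nil; exact: CN_cst.
by under eq_fun do rewrite big_cons; exact: CNM.
Qed.

Lemma iter_partial_CN s n F : CN (size s + n) F -> CN n (iter_partial s F).
Proof.
elim: s n F => [|i s IH] n F //= CF.
have : CN n.+1 (iter_partial s F) by apply: IH; rewrite addnS.
move=> [_ [F' [dF CF']]]; have -> : 'D_(e_ i) (iter_partial s F) = F' i.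
  by apply/funext => q; have [] := dF i q.
exact: CF'.
Qed.

Lemma closed_norm_le (r : R) : closed [set q : 'rV[R]_d | `|q| <= r].
Proof.
rewrite (_ : [set _ | _] = (fun q : 'rV[R]_d => `|q|) @^-1` [set t | t <= r])//.
by apply: closed_comp => [q _|]; [exact: norm_continuous|exact: closed_le].
Qed.

Lemma smooth_test_function F (r : R) : (forall n, CN n F) ->
  (forall q, F q != 0 -> `|q| <= r) -> test_function F.
Proof.
move=> CF Fr; split=> [s|].
  have : CN 1 (iter_partial s F) by apply: iter_partial_CN; exact: CF.
  by move=> [cF [F' [dF _]]]; split=> // i q; have [] := dF i q.
have : compact [set q : 'rV[R]_d | `|q| <= r].
  apply: bounded_closed_compact.
    by exists r; split; rewrite ?num_real// => M rM q /= qr; exact: le_trans qr (ltW rM).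
  exact: closed_norm_le.
move=> cr; apply: subclosed_compact cr _; first exact: closed_closure.
by rewrite closureE => q; apply; split; [exact: closed_norm_le|].
Qed.
End smooth_functions_rV.

(** * Partition of unity by integer translates *)

Section partition_of_unity.
Context {R : realType}.

(** As a difference of two consecutive translates of [step], it makes sums over integer translates
    telescope: to 1 for [bump], to 0 for its derivative. *)
Definition bump (t : R) : R := step (t + 1) - step t.
Definition dbump (t : R) : R := dstep (t + 1) - dstep t.

Lemma is_derive_bump (t : R) : is_derive t (1 : R) bump (dbump t).
Proof.
have h1 := is_derive_comp_affine 1 1 (@is_derive_step R) t.
have h2 := is_derive_step t.
have E : bump = (fun t => step (1 * t + 1)) - step :> (R -> R).
  by apply/funext => s; rewrite /bump -[X in step (X + 1)]mul1r.
rewrite E; have h := is_deriveB h1 h2; apply: (is_derive_eq h).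
by rewrite /dbump !mul1r.
Qed.

Lemma Cn_bump n : Cn n bump.
Proof.
have E : bump = (fun t => step (1 * t + 1) + - 1 * step t) :> (R -> R).
  by apply/funext => s; rewrite /bump mul1r mulN1r.
rewrite E; apply: CnD; first exact: Cn_comp_affine (Cn_step n).
by apply: CnM; [exact: Cn_cst|exact: Cn_step].
Qed.

Lemma bump_out t : 1 <= `|t| -> bump t = 0.
Proof.
rewrite ler_normr /bump => /orP[] h; first by rewrite !step1 ?subrr//; lra.
by rewrite !step0 ?subrr//; lra.
Qed.

Lemma dbump_out t : 1 <= `|t| -> dbump t = 0.
Proof.
rewrite ler_normr /dbump => /orP[] h; first by rewrite !dstep_out ?subrr//; right; lra.
by rewrite !dstep_out ?subrr//; left; lra.
Qed.

Lemma bump_bounded t : `|bump t| <= 1.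
Proof.
have := @step01 R t; have := @step01 R (t + 1); rewrite /bump => /andP[? ?] /andP[? ?].
by rewrite ler_norml; apply/andP; split; lra.
Qed.

Lemma sum_bump (N : nat) (s : R) : `|s| <= N%:R ->
  \sum_(k < (2 * N).+1) bump (s + N%:R - k%:R) = 1.
Proof.
rewrite ler_norml => /andP[s1 s2].
pose f k := - step (s + N%:R + 1 - k%:R) : R.
have E (k : 'I_(2 * N).+1) : bump (s + N%:R - k%:R) = f k.+1 - f k.
  rewrite /f /bump; have -> : s + N%:R - k%:R + 1 = s + N%:R + 1 - k%:R by ring.
  have -> : s + N%:R - k%:R = s + N%:R + 1 - k.+1%:R by rewrite -natr1; ring.
  by rewrite opprK addrC.
under eq_bigr do rewrite E.
rewrite -(big_mkord xpredT (fun k => f k.+1 - f k)) telescope_sumr// /f subr0 -natr1 natrM.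
by rewrite step0 ?step1; lra.
Qed.

Lemma sum_dbump (N : nat) (s : R) : `|s| <= N%:R ->
  \sum_(k < (2 * N).+1) dbump (s + N%:R - k%:R) = 0.
Proof.
rewrite ler_norml => /andP[s1 s2].
pose f k := - dstep (s + N%:R + 1 - k%:R) : R.
have E (k : 'I_(2 * N).+1) : dbump (s + N%:R - k%:R) = f k.+1 - f k.
  rewrite /f /dbump; have -> : s + N%:R - k%:R + 1 = s + N%:R + 1 - k%:R by ring.
  have -> : s + N%:R - k%:R = s + N%:R + 1 - k.+1%:R by rewrite -natr1; ring.
  by rewrite opprK addrC.
under eq_bigr do rewrite E.
rewrite -(big_mkord xpredT (fun k => f k.+1 - f k)) telescope_sumr// /f subr0 -natr1 natrM.
rewrite (@dstep_out _ (_ + 1)); last by right; lra.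
by rewrite dstep_out ?subrr//; left; lra.
Qed.

(** Only the integers floor(s) and floor(s) + 1 can be at distance less than 1 from [s], so at most
    two terms survive whatever [N] is. *)
Lemma sum_local (N : nat) (w : R -> R) (B s : R) : (forall t, `|w t| <= B) ->
  (forall t, 1 <= `|t| -> w t = 0) -> \sum_(k < N) `|w (s - k%:R)| <= 2 * B.
Proof.
move=> wB w0; have B0 : 0 <= B by apply: le_trans (wB 0).
have one (z : int) : \sum_(k < N) ((k%:Z == z)%:R : R) <= 1.
  have [/existsP[k0 /eqP k0z]|/existsPn H] := boolP [exists k : 'I_N, k%:Z == z].
    rewrite (bigD1 k0)//= k0z eqxx big1 ?addr0// => k kk0.
    case: eqP => // kz; move: kk0; rewrite -(inj_eq val_inj) /=.
    by move: k0z; rewrite -kz => -[->]; rewrite eqxx.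
  by rewrite big1// => k _; rewrite (negbTE (H k)).
pose z := Num.floor s; have /andP[z1 z2] := floor_itv s; rewrite intrD in z2.
apply: (@le_trans _ _ (\sum_(k < N) B * ((k%:Z == z)%:R + (k%:Z == z + 1)%:R))).
  apply: ler_sum => k _.
  have [h|h] := leP 1 `|s - k%:R|; first by rewrite w0// normr0 mulr_ge0// addr_ge0.
  have [kz|kz] := eqVneq (k%:Z) z.
    by rewrite (le_trans (wB _))// -[leLHS]mulr1 ler_wpM2l// lerDl.
  have [kz1|kz1] := eqVneq (k%:Z) (z + 1).
    by rewrite (le_trans (wB _))// add0r mulr1.
  exfalso; move: h; rewrite ltr_norml => /andP[h1 h2].
  have a1 : (z - 1 < k%:Z)%R by rewrite -(ltr_int R) intrB /z; move: h2 z1; rewrite /=; lra.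
  have a2 : (k%:Z < z + 2)%R by rewrite -(ltr_int R) intrD /z; move: h1 z2; rewrite /=; lra.
  by move: kz kz1 a1 a2; lia.
rewrite -mulr_sumr big_split/= mulrC ler_wpM2r//.
by rewrite -[2]/(1 + 1) lerD.
Qed.
End partition_of_unity.

Section derivative_rules.
Context {R : realType} {d : nat}.
Implicit Types (q : 'rV[R]_d) (i j : 'I_d).
Local Notation e_ i := (delta_mx ord0 i : 'rV[R]_d).

Lemma is_derive_prod_coord (u v : 'I_d -> R -> R) q i :
  (forall j (t : R), is_derive t (1 : R) (u j) (v j t)) ->
  is_derive q (e_ i) (fun q => \prod_j u j (q ord0 j))
    (\prod_j (if j == i then v j (q ord0 j) else u j (q ord0 j))).
Proof.
move=> du; pose c := \prod_(j | j != i) u j (q ord0 j).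
have dc : is_derive (q ord0 i) (1 : R) (fun t => c * u i t) (c * v i (q ord0 i)).
  have h := du i (q ord0 i); have h2 := is_deriveZ c h; exact: h2.
rewrite (bigD1 i)//= eqxx (eq_bigr (fun j => u j (q ord0 j))); last by move=> j /negbTE ->.
rewrite mulrC -/c; move: dc => [dc <-].
have E : (fun h => h^-1 *: (((fun q => \prod_j u j (q ord0 j)) \o shift q) (h *: e_ i)
      - \prod_j u j (q ord0 j))) =
    (fun h => h^-1 *: (((fun t => c * u i t) \o shift (q ord0 i)) (h *: 1) - c * u i (q ord0 i))).
  apply/funext => h; rewrite /= (bigD1 i)//= [in X in _ - X](bigD1 i)//= !mxE !eqxx.
  congr (_ *: (_ - _)); last by rewrite mulrC.
  rewrite mulrC; congr (_ * _); apply: eq_bigr => j ji.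
  by rewrite !mxE (negbTE ji) andbF mulr0 add0r.
by apply: DeriveDef; rewrite /derivable /derive E.
Qed.

Lemma is_derive_sum_seq (I : Type) (s : seq I) (F : I -> 'rV[R]_d -> R) (F' : I -> R) q w :
  (forall a, is_derive q w (F a) (F' a)) ->
  is_derive q w (fun q => \sum_(a <- s) F a q) (\sum_(a <- s) F' a).
Proof.
move=> dF; elim: s => [|a s IH].
  by rewrite big_nil; under eq_fun do rewrite big_nil; exact: is_derive_cst.
rewrite big_cons; under eq_fun do rewrite big_cons.
have h := dF a; exact: is_deriveD.
Qed.

Lemma Cn_affine n (a b : R) : Cn n (fun t => a * t + b).
Proof.
case: n => [|n].
  by move=> t; apply: cvgD; [apply: cvgMr; exact: cvg_id|exact: cvg_cst].
by exists (fun=> a); split=> [t|]; [exact: is_derive_affine|exact: Cn_cst].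
Qed.

End derivative_rules.

Section cutoff.
Context {R : realType} {d : nat} (r : R) (r0 : 0 < r).
Implicit Types (u v : 'rV[R]_d).

Definition cutoff u : R := Num.min 1 (Num.max 0 (2 - enorm u / r)).

Lemma cutoff01 u : 0 <= cutoff u <= 1.
Proof. by rewrite /cutoff le_min ler01 le_max lexx ge_min lexx. Qed.

Lemma cutoff1 u : enorm u <= r -> cutoff u = 1.
Proof.
move=> ur; have h : enorm u / r <= 1 by rewrite ler_pdivrMr// mul1r.
by rewrite /cutoff max_r ?min_l//; lra.
Qed.

Lemma cutoff0 u : 2 * r <= enorm u -> cutoff u = 0.
Proof.
move=> ur; have h : 2 <= enorm u / r by rewrite ler_pdivlMr.
by rewrite /cutoff max_l ?min_r//; lra.
Qed.

Lemma cutoff_lipschitz u v : `|cutoff u - cutoff v| <= enorm (u - v) / r.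
Proof.
have h : `|enorm u / r - enorm v / r| <= enorm (u - v) / r.
  rewrite -mulrBl normrM (@gtr0_norm _ r^-1) ?invr_gt0// ler_pM2r ?invr_gt0//.
  have h1 := enormD (u - v) v; have h2 := enormD (v - u) u.
  rewrite subrK in h1; rewrite subrK (enormC v) in h2.
  by rewrite ler_norml; apply/andP; split; lra.
move: h; rewrite /cutoff; move: (enorm u / r) (enorm v / r) (enorm (u - v) / r) => a b c.
rewrite ler_norml => /andP[h1 h2].
pose m (x : R) := Num.min 1 (Num.max 0 x).
have mono x y : x <= y -> m x <= m y <= m x + (y - x).
  move=> xy; rewrite /m; have [x0|x0] := lerP 0 x; have [y0|y0] := lerP 0 y;
  have [x1|x1] := lerP 1 x; have [y1|y1] := lerP 1 y;
  rewrite ?(min_l ler01) ?(min_r ler01); apply/andP; split; lra.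
rewrite -/(m (2 - a)) -/(m (2 - b)).
have [ab|ab] := leP a b.
  have := mono (2 - b) (2 - a); rewrite lerD2l lerN2 => /(_ ab)/andP[k1 k2].
  by rewrite ler_norml; apply/andP; split; lra.
have := mono (2 - a) (2 - b); rewrite lerD2l lerN2 => /(_ (ltW ab))/andP[k1 k2].
by rewrite ler_norml; apply/andP; split; lra.
Qed.
End cutoff.

(** * Gluing first-order Taylor polynomials on a grid *)

Section smoothing.
Context {R : realType} {d : nat} (phi : 'rV[R]_d -> R) (g : 'rV[R]_d -> 'rV[R]_d) (K : R).
Context (K0 : 0 <= K).
Context (quad : forall q q', `|phi q' - phi q - dotp (g q) (q' - q)| <= K * enorm (q' - q) ^+ 2).
Context (gK : forall q q', enorm (g q - g q') <= K * enorm (q - q')).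
Implicit Types (q : 'rV[R]_d) (i j : 'I_d).
Local Notation e_ i := (delta_mx ord0 i : 'rV[R]_d).

(** A common constant for the linear growth of [g] and the quadratic growth of [phi]. *)
Let c0 := `|phi 0| + enorm (g 0) + K.

Let c0_ge0 : 0 <= c0.
Proof. by rewrite /c0 !addr_ge0// enorm_ge0. Qed.

Let g_growth q : enorm (g q) <= c0 * (1 + enorm q).
Proof.
have := enormD (g q - g 0) (g 0); rewrite subrK => /le_trans; apply.
have := gK q 0; rewrite subr0; rewrite /c0.
have := enorm_ge0 q; have := enorm_ge0 (g 0); have := normr_ge0 (phi 0).
move: (enorm q) (enorm (g 0)) `|phi 0| (enorm (g q - _)) K0 => a b c e; nra.
Qed.

Let phi_growth q : `|phi q| <= c0 * (1 + enorm q ^+ 2).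
Proof.
have := quad 0 q; rewrite subr0 => h; have h2 := norm_dotp (g 0) q.
have h3 : `|phi q| <= `|phi 0| + `|dotp (g 0) q| + K * enorm q ^+ 2.
  have -> : phi q = (phi q - phi 0 - dotp (g 0) q) + (phi 0 + dotp (g 0) q) by ring.
  apply: (le_trans (ler_normD _ _)); rewrite addrC lerD//; exact: ler_normD.
apply: (le_trans h3); move: h2; rewrite /c0.
have := enorm_ge0 q; have := enorm_ge0 (g 0); have := normr_ge0 (phi 0).
move: (enorm q) (enorm (g 0)) `|phi 0| `|dotp _ _| K0 => a b c e.
have := sqr_ge0 (a - 1); nra.
Qed.

Section grid.
Context (M : R) (M0 : 0 < M) (hM : forall t : R, `|dstep t| <= M) (n : nat).
(* The nodes form a grid of mesh 1/(n+1) with partition of unity [chi]; the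
   cutoff [zeta] is only Lipschitz, but it is evaluated at the nodes. *)
Let r : R := (n + d).+1%:R.
(** The nodes reach 2r + 1 in each coordinate, one unit beyond the radius 2r where [zeta] vanishes.
    In turn [r] exceeds n by more than [d], which bounds the distance from a point to the nodes
    active there. *)
Let N := (n.+1 * (2 * (n + d).+1).+1)%N.
Let idx := {ffun 'I_d -> 'I_(2 * N).+1}.
Let s q (f : idx) j : R := n.+1%:R * q ord0 j + N%:R - (f j)%:R.
Let node (f : idx) : 'rV[R]_d := \row_j (((f j)%:R - N%:R) / n.+1%:R).
Let chi (f : idx) q := \prod_j bump (n.+1%:R * q ord0 j + (N%:R - (f j)%:R)).
Let dchi (f : idx) i q := \prod_j (if j == i then n.+1%:R * dbump (s q f j) else bump (s q f j)).
Let lin (f : idx) q := phi (node f) + dotp (g (node f)) (q - node f).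
Let zeta q := cutoff r q.

Definition smoothing q := \sum_(f : idx) chi f q * (zeta (node f) * lin f q).

Let n1 : 0 < n.+1%:R :> R.
Proof. by rewrite ltr0n. Qed.

Let r0 : 0 < r.
Proof. by rewrite ltr0n. Qed.

Let is_derive_chi f i q : is_derive q (e_ i) (chi f) (dchi f i q).
Proof.
have h j (t : R) := is_derive_comp_affine n.+1%:R (N%:R - (f j)%:R) (@is_derive_bump R) t.
apply: (is_derive_eq (is_derive_prod_coord q i h)).
by apply: eq_bigr => j _; rewrite /s addrA.
Qed.

Let CN_chi f m : CN m (chi f).
Proof.
apply: CN_prod => j; apply: (CN_coord (u := fun t => bump (n.+1%:R * t + (N%:R - (f j)%:R)))).
by apply: Cn_comp_affine; exact: Cn_bump.
Qed.

Let linE f : lin f = (fun q => phi (node f) +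
  \sum_j (g (node f) ord0 j * q ord0 j + - (g (node f) ord0 j * node f ord0 j))).
Proof.
apply/funext => q; rewrite /lin /dotp; congr (_ + _); apply: eq_bigr => j _.
by rewrite !mxE; ring.
Qed.

Let is_derive_lin f i q : is_derive q (e_ i) (lin f) (g (node f) ord0 i).
Proof.
rewrite linE; have h1 : is_derive q (e_ i) (fun=> phi (node f)) 0 by exact: is_derive_cst.
have h2 : is_derive q (e_ i)
    (fun q => \sum_j (g (node f) ord0 j * q ord0 j + - (g (node f) ord0 j * node f ord0 j)))
    (\sum_j ((i == j)%:R * g (node f) ord0 j)).
  apply: is_derive_sum_seq => j.
  exact: (is_derive_coord (u := fun t => g (node f) ord0 j * t + _) i (is_derive_affine _ _ _)).
have h := is_deriveD h1 h2; apply: (is_derive_eq h).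
rewrite add0r (bigD1 i)//= eqxx mul1r big1 ?addr0// => j ji.
by rewrite eq_sym (negbTE ji) mul0r.
Qed.

Let CN_lin f m : CN m (lin f).
Proof.
rewrite linE; apply: CND; first exact: CN_cst.
apply: CN_sum => j; apply: (CN_coord (u := fun t => g (node f) ord0 j * t + _)).
exact: Cn_affine.
Qed.

Let grad_smoothing q i : grad smoothing q ord0 i =
  \sum_(f : idx) (dchi f i q * (zeta (node f) * lin f q) +
    chi f q * (zeta (node f) * g (node f) ord0 i)).
Proof.
rewrite mxE; have h : is_derive q (e_ i) smoothing
    (\sum_(f : idx) (dchi f i q * (zeta (node f) * lin f q) +
      chi f q * (zeta (node f) * g (node f) ord0 i))).
  apply: is_derive_sum_seq => f.
  have h1 := is_derive_chi f i q; have h2 := is_derive_lin f i q.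
  have h3 := is_deriveZ (zeta (node f)) h2; have h4 := is_deriveM h1 h3.
  by apply: (is_derive_eq h4); rewrite /GRing.scale/= addrC mulrC.
by have [_ ->] := h.
Qed.

Let CN_smoothing m : CN m smoothing.
Proof.
apply: CN_sum => f; apply: CNM; first exact: CN_chi.
by apply: CNM; [exact: CN_cst|exact: CN_lin].
Qed.

(** [B] dominates both [bump] (at most 1) and [dbump] (at most 2M); by [sum_local] each coordinate
    contributes at most 2B to a sum over the nodes, whence [Q]. *)
Let B : R := 2 * M + 1.
Let Q : R := (2 * B) ^+ d.
Let D : R := d%:R.
Let h : R := n.+1%:R^-1.

Let B0 : 0 <= B.
Proof. by rewrite /B addr_ge0// mulr_ge0// ltW. Qed.

Let Q0 : 0 <= Q.
Proof. by rewrite exprn_ge0// mulr_ge0. Qed.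

Let h0 : 0 <= h.
Proof. by rewrite invr_ge0. Qed.

Let h1 : h <= 1.
Proof. by rewrite invf_le1// ler1n. Qed.

Let r1 : 1 <= r.
Proof. by rewrite ler1n. Qed.

Let Dr : D <= r.
Proof. by rewrite ler_nat leqW// leq_addl. Qed.

Let D0 : 0 <= D.
Proof. exact: ler0n. Qed.

Let pos1 : 0 <= K * D ^+ 2 + 3 * c0 * D.
Proof.
by apply: addr_ge0; apply: mulr_ge0 => //; [exact: sqr_ge0|exact: mulr_ge0].
Qed.

Let pos2 : 0 <= K * D + c0.
Proof. by apply: addr_ge0 => //; exact: mulr_ge0. Qed.

Let pos3 : 0 <= K * D ^+ 2 + K * D.
Proof. by apply: addr_ge0; apply: mulr_ge0 => //; exact: sqr_ge0. Qed.

Let bumpB t : `|bump t| <= B.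
Proof. by apply: le_trans (bump_bounded t) _; rewrite /B lerDr mulr_ge0// ltW. Qed.

Let dbumpB t : `|dbump t| <= B.
Proof.
apply: (le_trans (ler_normB _ _)); apply: (@le_trans _ _ (M + M)); first exact: lerD.
by rewrite /B; lra.
Qed.

Let sum_prod (w : 'I_d -> R -> R) q : \sum_(f : idx) \prod_j w j (s q f j) =
  \prod_j \sum_(k < (2 * N).+1) w j (n.+1%:R * q ord0 j + N%:R - k%:R).
Proof.
by rewrite (bigA_distr_bigA (fun j (k : 'I_(2 * N).+1) => w j (n.+1%:R * q ord0 j + N%:R - k%:R))).
Qed.

Let sum_abs_prod (w : 'I_d -> R -> R) q : (forall j t, `|w j t| <= B) ->
  (forall j t, 1 <= `|t| -> w j t = 0) -> \sum_(f : idx) `|\prod_j w j (s q f j)| <= Q.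
Proof.
move=> wB w0; under eq_bigr do rewrite normr_prod.
rewrite (sum_prod (fun j t => `|w j t|)) /Q -[in X in _ ^+ X](card_ord d) -prodr_const.
apply: ler_prod => j _; rewrite sumr_ge0//=.
exact: (sum_local _ _ (wB j) (w0 j)).
Qed.

Let chiE f q : chi f q = \prod_j bump (s q f j).
Proof. by apply: eq_bigr => j _; rewrite /s addrA. Qed.

Let dchiE f i q : dchi f i q = n.+1%:R * \prod_j (if j == i then dbump else bump) (s q f j).
Proof.
rewrite /dchi (bigD1 i)//= [in RHS](bigD1 i)//= eqxx -mulrA; congr (_ * (_ * _)).
by apply: eq_bigr => j /negbTE ->.
Qed.

Let sum_abs_chi q : \sum_(f : idx) `|chi f q| <= Q.
Proof.
under eq_bigr do rewrite chiE.
by apply: (sum_abs_prod (w := fun=> bump)) => // j t; exact: bump_out.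
Qed.

Let sum_abs_dchi i q : \sum_(f : idx) `|dchi f i q| <= n.+1%:R * Q.
Proof.
under eq_bigr do rewrite dchiE normrM (gtr0_norm n1).
rewrite -mulr_sumr ler_pM2l//.
apply: (sum_abs_prod (w := fun j => if j == i then dbump else bump)) => j t; case: (j == i) => //.
  exact: dbump_out.
exact: bump_out.
Qed.

Let sum_chi q : (forall j, `|n.+1%:R * q ord0 j| <= N%:R) -> \sum_(f : idx) chi f q = 1.
Proof.
move=> qN; under eq_bigr do rewrite chiE.
by rewrite (sum_prod (fun=> bump)) big1// => j _; exact: sum_bump.
Qed.

Let sum_dchi i q : (forall j, `|n.+1%:R * q ord0 j| <= N%:R) -> \sum_(f : idx) dchi f i q = 0.
Proof.
move=> qN; under eq_bigr do rewrite dchiE.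
rewrite -mulr_sumr (sum_prod (fun j => if j == i then dbump else bump)) (bigD1 i)//= eqxx.
by rewrite sum_dbump ?mul0r ?mulr0.
Qed.

Let inactive f i q j : 1 <= `|s q f j| -> chi f q = 0 /\ dchi f i q = 0.
Proof.
move=> sj; rewrite chiE dchiE (bigD1 j)//= bump_out// mul0r; split=> //.
rewrite (bigD1 j)//=; case: (j == i); first by rewrite dbump_out// mul0r mulr0.
by rewrite bump_out// mul0r mulr0.
Qed.

Let node_coord f q j : q ord0 j - node f ord0 j = s q f j * h.
Proof. by rewrite /node mxE /s /h; field; rewrite gt_eqF. Qed.

Let near_node f q : (forall j, `|s q f j| < 1) -> enorm (q - node f) <= D * h.
Proof.
move=> sj; apply: (le_trans (enorm_le_sum _)).
apply: (@le_trans _ _ (\sum_(j < d) h)).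
  apply: ler_sum => j _; rewrite !mxE -[X in _ + X]mulN1r mulN1r.
  have := node_coord f q j; rewrite /node !mxE => ->.
  by rewrite normrM (ger0_norm h0) ler_piMl// ltW.
by rewrite sumr_const card_ord -[leLHS]mulr_natl.
Qed.

(** The node differs from [q] by less than 1/(n + 1) in coordinate [j], so it lies at distance at
    least 2r from the origin, outside the support of the cutoff. *)
Let far_node f q j : N%:R < `|n.+1%:R * q ord0 j| -> `|s q f j| < 1 -> zeta (node f) = 0.
Proof.
move=> qN sj; apply: cutoff0 => //; apply: le_trans (coord_le_enorm _ j).
rewrite mxE normrM normfV (gtr0_norm n1) ler_pdivlMr//.
have Nr : N%:R = n.+1%:R * (2 * r + 1) :> R.
  by rewrite /N /r natrM -[(2 * _).+1]addn1 natrD natrM.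
have e : (f j)%:R - N%:R = n.+1%:R * q ord0 j - s q f j by rewrite /s; ring.
rewrite e; have := ler_normB (n.+1%:R * q ord0 j - s q f j) (- s q f j).
rewrite opprK subrK normrN => k.
have n11 : 1 <= n.+1%:R :> R by rewrite ler1n.
by rewrite Nr in qN; lra.
Qed.

Let combine (u v a b : idx -> R) (U V al be : R) : 0 <= al -> 0 <= be ->
  \sum_f `|u f| <= U -> \sum_f `|v f| <= V ->
  (forall f, u f = 0 \/ `|a f| <= al) -> (forall f, v f = 0 \/ `|b f| <= be) ->
  `|\sum_f (u f * a f + v f * b f)| <= U * al + V * be.
Proof.
move=> al0 be0 hU hV ha hb; apply: (le_trans (ler_norm_sum _ _ _)).
apply: (@le_trans _ _ (\sum_f (`|u f| * al + `|v f| * be))).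
  apply: ler_sum => f _; apply: (le_trans (ler_normD _ _)); rewrite !normrM lerD//.
    by case: (ha f) => [->|k]; rewrite ?normr0 ?mul0r ?ler_wpM2l.
  by case: (hb f) => [->|k]; rewrite ?normr0 ?mul0r ?ler_wpM2l.
by rewrite big_split/= -!mulr_suml lerD// ler_wpM2r.
Qed.

(** Since [chi] sums to 1 and [dchi] to 0, terms independent of the node may be subtracted. With
    [dchi], which has size n + 1, the subtracted term is [zeta q * phi q], so that only a small
    variation of the product remains. *)
Let in_range_error q i : (forall j, `|n.+1%:R * q ord0 j| <= N%:R) ->
  grad smoothing q ord0 i - g q ord0 i =
  \sum_(f : idx) (dchi f i q * (zeta (node f) * lin f q - zeta q * phi q) +
    chi f q * (zeta (node f) * g (node f) ord0 i - g q ord0 i)).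
Proof.
move=> qN; rewrite grad_smoothing.
under [in RHS]eq_bigr do rewrite !mulrBr addrACA -opprD.
rewrite [in RHS]big_split/= sumrN; congr (_ - _).
by rewrite big_split/= -!mulr_suml sum_dchi// sum_chi// mul0r mul1r add0r.
Qed.

Let out_range_error q i j : N%:R < `|n.+1%:R * q ord0 j| -> grad smoothing q ord0 i = 0.
Proof.
move=> qN; rewrite grad_smoothing big1// => f _.
have [sj|sj] := ltP `|s q f j| 1; first by rewrite (far_node qN sj) !mul0r !mulr0 addr0.
by have [-> ->] := inactive i sj; rewrite !mul0r addr0.
Qed.

Let smoothing_support q : smoothing q != 0 -> `|q| <= 2 * r + 1.
Proof.
move=> q0; rewrite [X in X <= _]mx_normrE; apply: bigmax_le => [|[i j] _] /=.
  by rewrite addr_ge0// mulr_ge0// ltW.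
rewrite (ord1 i) leNgt; apply/negP => qj; move: q0; rewrite /smoothing big1 ?eqxx// => f _.
have qN : N%:R < `|n.+1%:R * q ord0 j|.
  rewrite normrM (gtr0_norm n1) /N natrM -[(2 * _).+1]addn1 natrD natrM -/r.
  by rewrite ltr_pM2l.
have [sj|sj] := ltP `|s q f j| 1; first by rewrite (far_node qN sj) mul0r mulr0.
by have [-> _] := inactive j sj; rewrite mul0r.
Qed.

Let lin_error f q : (forall j, `|s q f j| < 1) -> `|lin f q - phi q| <= K * (D * h) ^+ 2.
Proof.
move=> sj; have nn := near_node sj.
have -> : lin f q - phi q = - (phi q - phi (node f) - dotp (g (node f)) (q - node f)).
  by rewrite /lin; ring.
rewrite normrN; apply: (le_trans (quad _ _)); rewrite ler_wpM2l// ler_pXn2r// nnegrE ?enorm_ge0//.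
by rewrite mulr_ge0.
Qed.

(** The factor [h] offsets the n + 1 carried by [dchi]. The Taylor error has order h^2; [zeta]
    varies by at most D h / r, and only where |q| <= 3r, so dividing by [r] turns the quadratic
    growth of [phi] into linear growth. *)
Let a_bound f q : (forall j, `|s q f j| < 1) ->
  `|zeta (node f) * lin f q - zeta q * phi q| <= h * (K * D ^+ 2 + 3 * c0 * D) * (1 + enorm q).
Proof.
move=> sj; have nn := near_node sj; have le := lin_error sj.
have /andP[z0 z1] := @cutoff01 R d r (node f).
have e0 := enorm_ge0 q.
have t1 : `|zeta (node f) * (lin f q - phi q)| <= K * (D * h) ^+ 2.
  by rewrite normrM (ger0_norm z0); apply: le_trans le; rewrite ler_piMl.
have t2 : `|(zeta (node f) - zeta q) * phi q| <= 3 * c0 * (D * h) * (1 + enorm q).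
  have [E|E] := eqVneq (zeta (node f)) (zeta q).
    rewrite E subrr mul0r normr0 !mulr_ge0// addr_ge0//.
  have q3 : enorm q <= 3 * r.
    rewrite leNgt; apply/negP => q3; move/eqP: E; apply.
    have Dh : D * h <= r by apply: le_trans Dr; rewrite ler_piMr.
    have := enormD (q - node f) (node f); rewrite subrK => k.
    by rewrite /zeta !cutoff0//; lra.
  have zL : `|zeta (node f) - zeta q| <= D * h / r.
    apply: (le_trans (cutoff_lipschitz r0 _ _)); rewrite enormC.
    by rewrite ler_pM2r// invr_gt0.
  rewrite normrM; apply: (@le_trans _ _ ((D * h / r) * (c0 * (1 + enorm q ^+ 2)))).
    exact: ler_pM.
  have -> : D * h / r * (c0 * (1 + enorm q ^+ 2)) = (c0 * (D * h)) * ((1 + enorm q ^+ 2) / r).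
    by ring.
  have -> : 3 * c0 * (D * h) * (1 + enorm q) = (c0 * (D * h)) * (3 * (1 + enorm q)) by ring.
  rewrite ler_wpM2l ?mulr_ge0// ler_pdivrMr//.
  by move: q3 e0 r1; move: (enorm q) r => x y; nra.
have -> : zeta (node f) * lin f q - zeta q * phi q =
    zeta (node f) * (lin f q - phi q) + (zeta (node f) - zeta q) * phi q by ring.
apply: (le_trans (ler_normD _ _)); apply: (le_trans (lerD t1 t2)).
have k1 : K * (D * h) ^+ 2 <= h * (K * D ^+ 2) * (1 + enorm q).
  have -> : K * (D * h) ^+ 2 = (h * (K * D ^+ 2)) * h by ring.
  apply: ler_wpM2l; first by rewrite !mulr_ge0// sqr_ge0.
  by apply: le_trans h1 _; rewrite lerDl.
apply: (@le_trans _ _ (h * (K * D ^+ 2) * (1 + enorm q) + 3 * c0 * (D * h) * (1 + enorm q))).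
  by rewrite lerD2r.
by rewrite le_eqVlt; apply/orP; left; apply/eqP; ring.
Qed.

Let b_bound f q i : (forall j, `|s q f j| < 1) ->
  `|zeta (node f) * g (node f) ord0 i - g q ord0 i| <= (K * D + c0) * (1 + enorm q).
Proof.
move=> sj; have nn := near_node sj; have /andP[z0 z1] := @cutoff01 R d r (node f).
have e0 := enorm_ge0 q.
have -> : zeta (node f) * g (node f) ord0 i - g q ord0 i =
  zeta (node f) * (g (node f) ord0 i - g q ord0 i) + (zeta (node f) - 1) * g q ord0 i by ring.
have gg : `|g (node f) ord0 i - g q ord0 i| <= K * D.
  have := coord_le_enorm (g (node f) - g q) i; rewrite !mxE => /le_trans; apply.
  apply: (le_trans (gK _ _)); rewrite ler_wpM2l// enormC.
  by apply: (le_trans nn); rewrite ler_piMr.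
have gq : `|g q ord0 i| <= c0 * (1 + enorm q) := le_trans (coord_le_enorm _ i) (g_growth q).
apply: (le_trans (ler_normD _ _)); rewrite !normrM mulrDl lerD//.
  rewrite (ger0_norm z0); apply: (@le_trans _ _ (K * D)); first by apply: le_trans gg; rewrite ler_piMl.
  by rewrite ler_peMr ?mulr_ge0// lerDl.
apply: le_trans gq; rewrite ler_piMl// distrC ger0_norm ?subr_ge0//.
by rewrite gerBl.
Qed.

Let bound_coord q i : `|grad smoothing q ord0 i - g q ord0 i| <=
  (Q * (K * D ^+ 2 + 3 * c0 * D + (K * D + c0)) + c0) * (1 + enorm q).
Proof.
have e0 : 0 <= 1 + enorm q by rewrite addr_ge0 ?enorm_ge0.
have [/existsP[j jN]|/existsPn H] := boolP [exists j, N%:R < `|n.+1%:R * q ord0 j|].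
  rewrite (out_range_error _ jN) sub0r normrN mulrDl.
  apply: (le_trans (coord_le_enorm _ i)); apply: (le_trans (g_growth q)).
  by rewrite lerDr; apply: mulr_ge0 => //; apply: mulr_ge0 => //; exact: addr_ge0.
rewrite in_range_error; last by move=> j; rewrite leNgt.
pose al := h * (K * D ^+ 2 + 3 * c0 * D) * (1 + enorm q).
pose be := (K * D + c0) * (1 + enorm q).
have act f : (forall i, chi f q = 0 /\ dchi f i q = 0) \/ (forall j, `|s q f j| < 1).
  have [/existsP[j sj]|/existsPn k] := boolP [exists j, 1 <= `|s q f j|].
    by left => i'; exact: inactive sj.
  by right => j; rewrite ltNge.
apply: le_trans (combine (al := al) (be := be) _ _ (sum_abs_dchi i q) (sum_abs_chi q) _ _) _.
- by rewrite /al; do 2 apply: mulr_ge0 => //.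
- by rewrite /be; apply: mulr_ge0.
- by move=> f; case: (act f) => [k|k]; [left; have [] := k i|right; exact: a_bound].
- by move=> f; case: (act f) => [k|k]; [left; have [] := k i|right; exact: b_bound].
have -> : n.+1%:R * Q * al = Q * (K * D ^+ 2 + 3 * c0 * D) * (1 + enorm q).
  by rewrite /al /h; field; rewrite gt_eqF.
have := mulr_ge0 c0_ge0 e0; rewrite /be; lra.
Qed.

Let bound_coord_small q i : enorm q <= n%:R ->
  `|grad smoothing q ord0 i - g q ord0 i| <= Q * (K * D ^+ 2 + K * D) * h.
Proof.
move=> qn; have qr : enorm q <= r by apply: (le_trans qn); rewrite ler_nat leqW// leq_addr.
have zq : zeta q = 1 by exact: cutoff1.
rewrite in_range_error; last first.
  move=> j; rewrite normrM (gtr0_norm n1) /N natrM ler_pM2l//.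
  apply: (le_trans (coord_le_enorm _ j)); apply: (le_trans qr).
  by rewrite ler_nat leqW// leq_pmull.
have act f : (forall i, chi f q = 0 /\ dchi f i q = 0) \/ (forall j, `|s q f j| < 1).
  have [/existsP[j sj]|/existsPn k] := boolP [exists j, 1 <= `|s q f j|].
    by left => i'; exact: inactive sj.
  by right => j; rewrite ltNge.
have zf f : (forall j, `|s q f j| < 1) -> zeta (node f) = 1.
  move=> sj; apply: cutoff1 => //; have := enormD (node f - q) q; rewrite subrK => /le_trans.
  apply; rewrite enormC; apply: (@le_trans _ _ (D + n%:R)); last first.
    by rewrite /D /r -natrD ler_nat addnC.
  by rewrite lerD//; apply: (le_trans (near_node sj)); rewrite ler_piMr.
apply: le_trans (combine (al := K * (D * h) ^+ 2) (be := K * (D * h)) _ _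
  (sum_abs_dchi i q) (sum_abs_chi q) _ _) _.
- by rewrite mulr_ge0// sqr_ge0.
- by rewrite !mulr_ge0.
- move=> f; case: (act f) => [k|k]; [left; have [] := k i => //|right].
  by rewrite zf// zq !mul1r; exact: lin_error.
- move=> f; case: (act f) => [k|k]; [left; have [] := k i => //|right].
  rewrite zf// mul1r; have := coord_le_enorm (g (node f) - g q) i; rewrite !mxE => /le_trans.
  apply; apply: (le_trans (gK _ _)); rewrite ler_wpM2l// enormC; exact: near_node.
have -> : n.+1%:R * Q * (K * (D * h) ^+ 2) = Q * (K * D ^+ 2) * h.
  by rewrite /h; field; rewrite gt_eqF.
by rewrite le_eqVlt; apply/orP; left; apply/eqP; ring.
Qed.

Lemma smoothing_estimates : exists2 psi, test_function psi &
  let A := D * ((Q * (K * D ^+ 2 + 3 * c0 * D + (K * D + c0)) + c0) + Q * (K * D ^+ 2 + K * D)) in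
  (forall q, enorm (grad psi q - g q) <= A * (1 + enorm q)) /\
  (forall q, enorm q <= n%:R -> enorm (grad psi q - g q) <= A * n.+1%:R^-1).
Proof.
exists smoothing; first exact: smooth_test_function CN_smoothing smoothing_support.
have vec q (b : R) : (forall i, `|grad smoothing q ord0 i - g q ord0 i| <= b) ->
    enorm (grad smoothing q - g q) <= D * b.
  move=> k; apply: (le_trans (enorm_le_sum _)); apply: (@le_trans _ _ (\sum_(i < d) b)).
    by apply: ler_sum => i _; have := k i; rewrite !mxE.
  by rewrite sumr_const card_ord -[leLHS]mulr_natl.
have q1 : 0 <= Q * (K * D ^+ 2 + K * D) by exact: mulr_ge0.
have q2 : 0 <= Q * (K * D ^+ 2 + 3 * c0 * D + (K * D + c0)) + c0.
  by apply: addr_ge0 => //; apply: mulr_ge0 => //; exact: addr_ge0.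
move=> A; split=> q.
  apply: (le_trans (vec _ _ (bound_coord q))); rewrite /A -!mulrA ler_wpM2l//.
  by rewrite ler_wpM2r ?addr_ge0 ?enorm_ge0// lerDl.
move=> qn; apply: (le_trans (vec _ _ (fun i => bound_coord_small i qn))).
rewrite /A -[leRHS]mulrA; apply: ler_wpM2l => //; apply: ler_wpM2r; first exact: h0.
by rewrite lerDr.
Qed.
End grid.

(** [A] is the same for all [n]: the first estimate provides a majorant and the second pointwise
    convergence. *)
Lemma smooth_approximation : exists A : R, forall n : nat, exists2 psi, test_function psi &
  (forall q, enorm (grad psi q - g q) <= A * (1 + enorm q)) /\
  (forall q, enorm q <= n%:R -> enorm (grad psi q - g q) <= A * n.+1%:R^-1).
Proof.
have [M M0 hM] := @dstep_bounded R.
by eexists => n; exact: (smoothing_estimates M0 hM n).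
Qed.
End smoothing.

Section tangent_space.
Context {R : realType} {d : nat}.
Implicit Types (mu : P2 R d) (g : 'rV[R]_d -> 'rV[R]_d).

Lemma continuous_measurable_rV_R (f : 'rV[R]_d -> R) : continuous f -> measurable_fun setT f.
Proof.
move=> cf; apply: (measurability _ (RGenOInfty.measurableE R)) => _ [_ [a ->] <-].
rewrite setTI; apply: open_measurable_rV.
by apply: open_comp; last exact: interval_open.
Qed.

Lemma measurable_grad phi : test_function phi -> measurable_fun setT (@grad R d phi).
Proof.
move=> [tf _]; apply: measurable_fun_rV => i; under eq_fun do rewrite mxE.
exact: (continuous_measurable_rV_R (tf [:: i]).1).
Qed.

Lemma P2_sqi mu : sqi mu (fun q => q).
Proof. by apply: sqi_lty; [exact: measurable_id|exact: P2_finite]. Qed.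

Lemma P2_sqi_lipschitz mu g (K : R) :
  (forall q q', enorm (g q - g q') <= K * enorm (q - q')) -> sqi mu g.
Proof.
move=> gK; have fmu : (P2_prob mu setT < +oo)%E by rewrite probability_setT ltry.
exact: (sqi_lipschitz fmu gK (P2_sqi mu)).
Qed.

Definition approximable mu g := forall e : R, 0 < e -> exists psi,
  [/\ test_function psi, sqi mu (grad psi) & n2 mu (fun q => g q - grad psi q) < e].

(** Dominated convergence applies because an error of linear growth has an integrable square under a
    law with finite second moment. *)
Lemma C11_approximable mu (phi : 'rV[R]_d -> R) g (K : R) : 0 <= K ->
  (forall q q', `|phi q' - phi q - dotp (g q) (q' - q)| <= K * enorm (q' - q) ^+ 2) ->
  (forall q q', enorm (g q - g q') <= K * enorm (q - q')) -> approximable mu g.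
Proof.
move=> K0 quad gK; have sg := P2_sqi_lipschitz mu gK; move=> e e0.
have [A HA] := smooth_approximation K0 quad gK.
have /choice[psi Hpsi] n : exists psi, test_function psi /\
    (forall q, enorm (grad psi q - g q) <= A * (1 + enorm q)) /\
    (forall q, enorm q <= n%:R -> enorm (grad psi q - g q) <= A * n.+1%:R^-1).
  by have [psi tpsi] := HA n; exists psi.
pose f n q := grad (psi n) q - g q.
have mf n : measurable_fun setT (f n).
  by apply: measurable_rVB; [exact: measurable_grad (Hpsi n).1|exact: sg.1].
have A0 : 0 <= A.
  have := (Hpsi 0%N).2.1 0; rewrite enorm0 addr0 mulr1; apply: le_trans; exact: enorm_ge0.
have fB n q : enorm (f n q) ^+ 2 <= A ^+ 2 * (2 * (1 + enorm q ^+ 2)).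
  apply: (@le_trans _ _ ((A * (1 + enorm q)) ^+ 2)).
    rewrite ler_pXn2r// ?nnegrE ?enorm_ge0 ?mulr_ge0 ?addr_ge0 ?enorm_ge0//.
    exact: (Hpsi n).2.1.
  rewrite exprMn ler_wpM2l ?sqr_ge0//; have := sqr_ge0 (enorm q - 1); lra.
have ic : mu.-integrable setT (EFin \o cst (1 : R)) by exact: finite_measure_integrable_cst.
have ik := integrableZl measurableT (A ^+ 2)
  (integrableZl measurableT 2 (integrableD measurableT ic (P2_sqi mu).2)).
have f0 : {ae mu, forall q, enorm (f n q) @[n --> \oo] --> 0}.
  apply: aeW => q; apply/cvgrPdist_le => eta eta0; near=> n.
  rewrite sub0r normrN ger0_norm ?enorm_ge0//.
  have qn : enorm q <= n%:R.
    near: n; exists (Num.bound (enorm q)) => // m /= Nm.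
    by apply: (le_trans (ltW (archi_boundP (enorm_ge0 _)))); rewrite ler_nat.
  apply: (le_trans ((Hpsi n).2.2 _ qn)); rewrite ler_pdivrMr// mulrC -ler_pdivrMr//.
  near: n; exists (Num.bound (A / eta)) => // m /= Nm.
  have de : 0 <= A / eta by rewrite divr_ge0// ltW.
  by apply: (le_trans (ltW (archi_boundP de))); rewrite ler_nat (leq_trans Nm).
have [N HN] := @n2_dominated _ _ _ _ mu f
  (fun q => A ^+ 2 * (2 * (1 + enorm q ^+ 2))) mf ik fB f0 e e0.
have sf : sqi mu (f N) by exact: sqi_dominated (mf N) ik (fB N).
exists (psi N); split; first exact: (Hpsi N).1.
  have -> : grad (psi N) = (fun q => f N q + g q) by apply/funext => q; rewrite /f subrK.
  exact: sqiD.
by rewrite n2C; exact: HN.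
Unshelve. all: by end_near. Qed.

Lemma tangent_closure mu g : sqi mu g ->
  (forall e : R, 0 < e -> exists g',
    [/\ sqi mu g', approximable mu g' & n2 mu (fun q => g q - g' q) < e]) ->
  tangent mu g.
Proof.
move=> sg H; split; [exact: sg.1|exact: sqi_finite_norm|] => e e0.
have e2 : 0 < e / 2 by rewrite divr_gt0.
have [g' [sg' Hg' gg']] := H _ e2.
have [psi [tpsi spsi Hpsi]] := Hg' _ e2; exists psi => //.
rewrite /L2norm fine_Lnorm; last exact: sqiB.
by apply: (le_lt_trans (n2_dist sg spsi sg')); rewrite (splitr e) ltrD.
Qed.
End tangent_space.

(** * Tangency of the Wasserstein gradient *)

Section small_modifications.
Context {R : realType} {d : nat}.
Local Notation leb := (leb_Omega d.+1).
Implicit Types (x : H R d.+1) (q : 'rV[R]_d.+1).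

(* In 'rV_0 no set has small positive measure, whence the dimension [d.+1]. *)
Definition slab (n : nat) : set 'rV[R]_d.+1 := [set w | 1 - n.+2%:R^-1 < w ord0 ord0].

Lemma measurable_slab n : measurable (slab n).
Proof.
rewrite (_ : slab n = (fun w : 'rV[R]_d.+1 => w ord0 ord0) @^-1` `]1 - n.+2%:R^-1, +oo[).
  by rewrite -[X in measurable X]setTI; exact: measurable_coord.
by apply/seteqP; split=> w /=; rewrite in_itv/= andbT.
Qed.

Lemma leb_slab n : leb (slab n) = (n.+2%:R^-1)%:E.
Proof.
rewrite leb_Omega_tail; first by congr EFin; ring.
by rewrite subr_ge0 invf_le1// ler1n gerBl invr_ge0 ler0n.
Qed.

Let modify_fun n x q w := \1_(slab n) w *: (q - x w) + x w.

Lemma sqi_modify n x q : sqi leb (modify_fun n x q).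
Proof.
apply: sqiD; last exact: H_sqi; apply: sqi_indic; first exact: measurable_slab.
by apply: sqiB; [exact: sqi_cst (leb_Omega_fin R d.+1)|exact: H_sqi].
Qed.

Definition modify n x q : H R d.+1 := ofL2 (sqi_modify n x q).

Lemma modify_in n x q w : slab n w -> modify n x q w = q.
Proof. by move=> sw; rewrite /= /modify_fun indicE mem_set// scale1r subrK. Qed.

Lemma modify_out n x q w : ~ slab n w -> modify n x q w = x w.
Proof. by move=> sw; rewrite /= /modify_fun indicE memNset// scale0r add0r. Qed.

Lemma modify_dist n x q q' : n2 leb (fun w => modify n x q' w - modify n x q w) ^+ 2 =
  enorm (q' - q) ^+ 2 / n.+2%:R.
Proof.
have E : (fun w => modify n x q' w - modify n x q w) = (fun w => \1_(slab n) w *: (q' - q)).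
  apply/funext => w; rewrite indicE; case: (pselect (slab n w)) => sw.
    by rewrite !modify_in// mem_set// scale1r.
  by rewrite !modify_out// memNset// scale0r subrr.
rewrite E sqr_n2 ip_sqr_enorm.
transitivity (\int[leb]_w (enorm (q' - q) ^+ 2 * \1_(slab n) w)).
  apply: eq_Rintegral => w _; rewrite indicE; case: (w \in slab n).
    by rewrite scale1r mulr1.
  by rewrite scale0r mulr0 enorm0 expr0n.
by rewrite Rintegral_scaled_indic ?leb_slab//; exact: measurable_slab.
Qed.

Lemma modify_cvg x q (e : R) : 0 < e -> exists N, forall n, (N <= n)%N ->
  n2 leb (fun w => modify n x q w - x w) < e.
Proof.
have sx := H_sqi x.
have sq : sqi leb (fun w => q - x w).
  by apply: sqiB => //; exact: sqi_cst (leb_Omega_fin R d.+1).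
apply: (@n2_dominated _ _ _ _ leb _ (fun w => enorm (q - x w) ^+ 2)).
- by move=> n; exact: (sqiB (H_sqi (modify n x q)) sx).1.
- exact: sq.2.
- move=> n w; case: (pselect (slab n w)) => sw; first by rewrite modify_in.
  by rewrite modify_out// subrr enorm0 expr0n sqr_ge0.
(* A point outside the cube may belong to every slab, but such points are null; inside the cube the
   first coordinate is below 1, and the point eventually leaves the slabs. *)
exists (~` @Omega R d.+1); split.
- by apply: measurableC; exact: measurable_Omega.
- by rewrite -[LHS]/(mrestr (lebesgue_rV d.+1) (@measurable_Omega R d.+1) _) /mrestr setICl measure0.
apply: subsetC => w /(_ ord0)/andP[_ w1].
apply: cvg_near_cst; exists (Num.bound (1 - w ord0 ord0)^-1) => // n Nn.
suff sw : ~ slab n w by rewrite -[LHS]/(enorm (modify n x q w - x w)) modify_out// subrr enorm0.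
rewrite /slab /= => h; rewrite /= in Nn.
have w10 : 0 < 1 - w ord0 ord0 by rewrite subr_gt0.
have hb : 0 <= (1 - w ord0 ord0)^-1 by rewrite invr_ge0 ltW.
have n2w : n.+2%:R^-1 <= 1 - w ord0 ord0.
  rewrite -[leRHS]invrK lef_pV2 ?posrE ?invr_gt0//.
  by apply: (le_trans (ltW (archi_boundP hb))); rewrite ler_nat (leq_trans Nn)// leqW.
by move: h n2w; move: (w ord0 ord0) n.+2%:R^-1 => a b; lra.
Qed.
End small_modifications.

(** * Potentials obtained by modifying a map on a slab *)

Section modified_gradients.
Context {R : realType} {d : nat} (F : H R d.+1 -> R).
Local Notation leb := (leb_Omega d.+1).
Implicit Types (x y h p : H R d.+1) (q : 'rV[R]_d.+1).
Context (G : H R d.+1 -> H R d.+1) (FG : forall x, is_gradH F x (G x)).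
Context (C : R) (C0 : 0 <= C).
Context (GC : forall x y, n2 leb (fun w => G x w - G y w) <= C * n2 leb (fun w => x w - y w)).
Context (g : H R d.+1 -> 'rV[R]_d.+1 -> 'rV[R]_d.+1) (K : R) (K0 : 0 <= K).
Context (gK : forall x q q', enorm (g x q - g x q') <= K * enorm (q - q')).
Context (gG : forall x, n2 leb (fun w => G x w - g x (x w)) = 0).

Let sqi_g x : sqi leb (fun w => g x (x w)).
Proof. exact: (sqi_lipschitz (leb_Omega_fin R d.+1) (gK x) (H_sqi x)). Qed.

Let n2_g x y : n2 leb (fun w => g x (x w) - g y (y w)) <= C * n2 leb (fun w => x w - y w).
Proof.
apply: le_trans (GC x y); have sx := H_sqi (G x); have sy := H_sqi (G y).
apply: (le_trans (n2_dist (sqi_g x) (sqi_g y) sx)); rewrite n2C gG add0r.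
by apply: (le_trans (n2_dist sx (sqi_g y) sy)); rewrite gG addr0.
Qed.

(** On the slab the modified map equals [q], so its gradient is represented there by this value. In
    [phi], defined next, the factor n + 2 is the inverse of the measure of the slab and makes [gam]
    the gradient of [phi]. *)
Let gam n x q := g (modify n x q) q.
Let phi n x q := F (modify n x q) * n.+2%:R.

Let n0 n : 0 < n.+2%:R :> R.
Proof. by rewrite ltr0n. Qed.

Let gam_quad n x q q' :
  `|phi n x q' - phi n x q - dotp (gam n x q) (q' - q)| <= C * enorm (q' - q) ^+ 2.
Proof.
have := lipschitz_grad_taylor C0 FG GC (modify n x q) (modify n x q').
rewrite modify_dist.
set X := modify n x q; set X' := modify n x q'.
have sX := sqiB (H_sqi X') (H_sqi X).
have -> : ip leb (G X) (fun w => X' w - X w) = dotp (gam n x q) (q' - q) / n.+2%:R.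
  have sG := H_sqi (G X); have sg := sqi_g X.
  transitivity (ip leb (fun w => g X (X w)) (fun w => X' w - X w)).
    by apply/eqP; rewrite -subr_eq0 -ipBl// ip_null//; exact: sqiB.
  transitivity (\int[leb]_w (dotp (gam n x q) (q' - q) * \1_(slab n) w)).
    apply: eq_Rintegral => w _; rewrite indicE; case: (pselect (slab n w)) => sw.
      by rewrite /X /X' !modify_in// mem_set// mulr1.
    by rewrite /X /X' !modify_out// memNset// mulr0 subrr dotpC dotp0l.
  by rewrite Rintegral_scaled_indic ?leb_slab//; exact: measurable_slab.
move=> h; rewrite -(ler_pM2r (n0 n)) in h.
have -> : phi n x q' - phi n x q - dotp (gam n x q) (q' - q) =
    (F X' - F X - dotp (gam n x q) (q' - q) / n.+2%:R) * n.+2%:R.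
  by rewrite /phi mulrBl mulrBl divfK ?gt_eqF.
rewrite normrM (gtr0_norm (n0 n)); apply: (le_trans h).
by rewrite mulrA divfK// gt_eqF.
Qed.

(** Both gradient representatives are constant on the slab; restricting the Lipschitz estimate of H
    to it and dividing by its measure gives the constant [C] for every [n]. *)
Let gam_lip n x q q' : enorm (gam n x q - gam n x q') <= C * enorm (q - q').
Proof.
set X := modify n x q; set X' := modify n x q'.
have s := sqiB (sqi_g X) (sqi_g X').
have lo := n2_lower (measurable_slab n) s (enorm_ge0 (gam n x q - gam n x q')).
have {}lo := lo _; rewrite leb_slab in lo.
have {}lo : enorm (gam n x q - gam n x q') ^+ 2 / n.+2%:R
    <= n2 leb (fun w => g X (X w) - g X' (X' w)) ^+ 2.
  by apply: lo => w sw; rewrite /X /X' !modify_in.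
have up : n2 leb (fun w => g X (X w) - g X' (X' w)) ^+ 2 <= (C * enorm (q - q')) ^+ 2 / n.+2%:R.
  rewrite [in leRHS]exprMn -mulrA -(modify_dist n x q' q) -exprMn.
  by rewrite ler_pXn2r ?nnegrE ?mulr_ge0 ?n2_ge0//; exact: n2_g.
have := le_trans lo up; rewrite ler_pM2r ?invr_gt0// ler_pXn2r// ?nnegrE ?enorm_ge0//.
by rewrite mulr_ge0 ?enorm_ge0.
Qed.

(** A gap above eta at [x w0] would persist, above eta/2, on a set [E] around [w0] of positive
    measure, because both functions are K-Lipschitz. Outside the slab the modified map equals [x],
    so this would contradict the convergence of the gradients in L^2. *)
Let gam_cvg x w0 (eta : R) :
  (forall e : R, 0 < e -> (0 < leb [set w | enorm (x w - x w0) < e]%R)%E) -> 0 < eta ->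
  exists N, forall n, (N <= n)%N -> enorm (gam n x (x w0) - g x (x w0)) <= eta.
Proof.
move=> supp eta0; set q := x w0.
have K1 : 0 < 4 * K + 1 by rewrite ltr_wpDl// mulr_ge0.
(* The two Lipschitz errors on [E] add up to 2 K del < eta/2. *)
pose del := eta / (4 * K + 1); have del0 : 0 < del by exact: divr_gt0.
have delE : del * (4 * K + 1) = eta by rewrite divfK// gt_eqF.
clearbody del.
pose E := [set w | enorm (x w - q) < del].
have mE : measurable E by apply: measurable_enorm_lt; exact: (H_sqi x).1.
pose m := fine (leb E).
have m0 : 0 < m by rewrite -lte_fin fineK ?fin_num_measure//; exact: supp.
(* [kap] is what a persistent gap contributes on at least half of [E]; [th] below is chosen so that
   C^2 th^2 < kap, and the index so that the slab has measure at most m/2. *)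
pose kap := (eta / 2) ^+ 2 * (m / 2).
have kap0 : 0 < kap by rewrite mulr_gt0 ?exprn_gt0 ?divr_gt0.
have C1 : 0 < C ^+ 2 + 1 by rewrite ltr_wpDl// sqr_ge0.
pose th := Num.min 1 (kap / (C ^+ 2 + 1)).
have th0 : 0 < th by rewrite lt_min ltr01 divr_gt0.
have [N HN] := modify_cvg x q th0.
exists (maxn N (Num.bound (2 / m))) => n; rewrite geq_max => /andP[Nn mn].
rewrite leNgt; apply/negP => big.
set X := modify n x q; have sf := sqiB (sqi_g X) (sqi_g x).
have mEn : measurable (E `\` slab n) by apply: measurableD => //; exact: measurable_slab.
have leE : m / 2 <= fine (leb (E `\` slab n)).
  have hs : n.+2%:R^-1 <= m / 2.
    rewrite -[leRHS]invrK lef_pV2 ?posrE ?invr_gt0 ?divr_gt0// invf_div.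
    have h2 : 0 <= 2 / m by rewrite divr_ge0// ltW.
    by apply: (le_trans (ltW (archi_boundP h2))); rewrite ler_nat (leq_trans mn)// leqW.
  have : (leb E <= leb (E `\` slab n) + leb (slab n))%E.
    have mU : measurable (E `\` slab n `|` slab n).
      by apply: measurableU => //; exact: measurable_slab.
    apply: le_trans (measureU2 _ mEn (measurable_slab n)).
    apply: le_measure; rewrite ?inE// => w Ew.
    by case: (pselect (slab n w)) => sw; [right|left].
  have mfin : leb E \is a fin_num by rewrite fin_num_measure.
  have mnfin : leb (E `\` slab n) \is a fin_num by rewrite fin_num_measure.
  rewrite leb_slab -(fineK mfin) -(fineK mnfin) -EFinD lee_fin.
  by move: hs; rewrite /m; move: (fine (leb E)) (fine _) n.+2%:R^-1 => a b c; lra.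
have e2 : 0 <= eta / 2 by rewrite divr_ge0// ltW.
have lo : (eta / 2) ^+ 2 * fine (leb (E `\` slab n)) <= n2 leb (fun w => g X (X w) - g x (x w)) ^+ 2.
  apply: n2_lower => // w [Ew nsw]; have -> : X w = x w by exact: modify_out.
  have d1 := enorm_dist (gam n x q) (g x q) (g X (x w)).
  have d2 := enorm_dist (g X (x w)) (g x q) (g x (x w)).
  have k1 := gK X q (x w); have k2 := gK x (x w) q; rewrite -/(gam n x q) in k1.
  have k3 : K * enorm (x w - q) <= K * del by rewrite ler_wpM2l// ltW.
  rewrite (enormC q) in k1.
  move: big d1 d2 k1 k2 k3 delE.
  move: (enorm (gam n x q - g x q)) (enorm (gam n x q - g X (x w))) (enorm (g X (x w) - g x q))
    (enorm (g X (x w) - g x (x w))) (enorm (g x (x w) - g x q)) (enorm (x w - q)) del0.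
  by move=> a1 a2 a3 a4 a5 a6; lra.
have up : n2 leb (fun w => g X (X w) - g x (x w)) ^+ 2 <= C ^+ 2 * th ^+ 2.
  rewrite -exprMn ler_pXn2r ?nnegrE ?mulr_ge0 ?n2_ge0 ?(ltW th0)//.
  by apply: (le_trans (n2_g X x)); rewrite ler_wpM2l// ltW//; exact: HN.
have kl : kap <= C ^+ 2 * th ^+ 2.
  by apply: le_trans up; apply: le_trans lo; rewrite /kap ler_wpM2l// sqr_ge0.
have th1 : th <= 1 by rewrite ge_min lexx.
have thk : th * (C ^+ 2 + 1) <= kap by rewrite -ler_pdivlMr// ge_min lexx orbT.
have thth : C ^+ 2 * th ^+ 2 <= C ^+ 2 * th.
  by rewrite ler_wpM2l ?sqr_ge0// expr2 ler_piMl// ltW.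
by clearbody th kap; lra.
Qed.

Lemma tangent_lipschitz_grad (mu : P2 R d.+1) x :
  (forall A, measurable A -> mu A = leb (x @^-1` A)) -> tangent mu (g x).
Proof.
move=> E; apply: tangent_closure; first exact: P2_sqi_lipschitz (gK x).
move=> e e0.
pose good w := forall e : R, 0 < e -> (0 < leb [set w' | enorm (x w' - x w) < e]%R)%E.
have ae : {ae leb, forall w, good w} := ae_mem_support leb (H_sqi x).1.
have [w0 gw0] : exists w, good w.
  apply: contrapT => H; have : leb.-negligible [set: 'rV[R]_d.+1].
    by apply: negligibleS ae => w _ /= gw; apply: H; exists w.
  move/negligibleP => /(_ measurableT) z; suff : (1 = 0 :> \bar R)%E by move=> /eqP; rewrite onee_eq0.
  by rewrite -z; apply/esym; exact: probability_setT.
(* From [N0] on, [gam] stays within 1 of [g x] at the fixed point [x w0]; the Lipschitz bounds C and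
   K turn this into a square-integrable majorant, independent of [n]. *)
have [N0 HN0] := gam_cvg gw0 ltr01.
pose f n w := gam (N0 + n)%N x (x w) - g x (x w).
have sgam n : sqi leb (fun w => gam n x (x w)).
  exact: (sqi_lipschitz (leb_Omega_fin R d.+1) (gam_lip n x) (H_sqi x)).
have mf n : measurable_fun setT (f n) by exact: (sqiB (sgam _) (sqi_g x)).1.
have sx : sqi leb (fun w => x w - x w0) 
  by apply: sqiB; [exact: H_sqi|exact: sqi_cst (leb_Omega_fin R d.+1)].
have ic : leb.-integrable setT (EFin \o cst (1 : R)) by exact: finite_measure_integrable_cst.
have ik := integrableZl measurableT 2 (integrableD measurableT ic
  (integrableZl measurableT ((C + K) ^+ 2) sx.2)).
have fB n w : enorm (f n w) ^+ 2 <= 2 * (1 + (C + K) ^+ 2 * enorm (x w - x w0) ^+ 2).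
  have b : enorm (f n w) <= 1 + (C + K) * enorm (x w - x w0).
    have h := HN0 (N0 + n)%N (leq_addr _ _).
    have d1 := enorm_dist (gam (N0 + n)%N x (x w)) (g x (x w)) (gam (N0 + n)%N x (x w0)).
    have d2 := enorm_dist (gam (N0 + n)%N x (x w0)) (g x (x w)) (g x (x w0)).
    have k1 := gam_lip (N0 + n)%N x (x w) (x w0); have k2 := gK x (x w0) (x w).
    rewrite (enormC (x w0)) in k2; rewrite /f.
    move: d1 d2 k1 k2 h; rewrite mulrDl; lra.
  have c0 : 0 <= (C + K) * enorm (x w - x w0) by rewrite mulr_ge0 ?addr_ge0 ?enorm_ge0.
  apply: (@le_trans _ _ ((1 + (C + K) * enorm (x w - x w0)) ^+ 2)).
    by rewrite ler_pXn2r ?nnegrE ?enorm_ge0 ?addr_ge0.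
  rewrite -exprMn; move: (_ * _) => a; have := sqr_ge0 (a - 1); lra.
have f0 : {ae leb, forall w, enorm (f n w) @[n --> \oo] --> 0}.
  apply: filterS ae => w gw; apply/cvgrPdist_le => eta eta0.
  have [N HN] := gam_cvg gw eta0; exists N => // n /= Nn.
  by rewrite sub0r normrN ger0_norm ?enorm_ge0//; apply: HN; rewrite (leq_trans Nn)// leq_addl.
have [N /(_ N (leqnn _)) HN] := n2_dominated mf ik fB f0 e0.
have mg : measurable_fun setT (g x) := continuous_measurable_rV (lipschitz_continuous (gK x)).
have mgam : measurable_fun setT (gam (N0 + N)%N x) :=
  continuous_measurable_rV (lipschitz_continuous (gam_lip (N0 + N)%N x)).
exists (gam (N0 + N)%N x); split.
- exact: P2_sqi_lipschitz (gam_lip _ x).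
- exact: C11_approximable C0 (gam_quad _ x) (gam_lip _ x).
have sf := sqiB (sgam (N0 + N)%N) (sqi_g x).
have mF := measurable_rVB mgam mg.
rewrite n2C (_ : n2 _ _ = n2 leb (f N))//; congr Num.sqrt.
exact: (ip_image (H_sqi x).1 E sf sf mF mF).
Qed.
End modified_gradients.

Lemma tangent_dim0 (R : realType) (mu : P2 R 0) (g : 'rV[R]_0 -> 'rV[R]_0) : tangent mu g.
Proof.
have z (u : 'rV[R]_0) : enorm u = 0 by rewrite /enorm /dotp big_ord0 sqrtr0.
have gK (q q' : 'rV[R]_0) : enorm (g q - g q') <= 0 * enorm (q - q') by rewrite !z mulr0.
have sg := P2_sqi_lipschitz mu gK.
have quad (q q' : 'rV[R]_0) : `|0 - 0 - dotp (g q) (q' - q)| <= 0 * enorm (q' - q) ^+ 2.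
  by rewrite /dotp big_ord0 !subr0 normr0 mul0r.
apply: (tangent_closure sg) => e e0; exists g; split => //; last first.
  by rewrite n2_eq0// => w; rewrite subrr.
have z0 : 0 <= 0 :> R by [].
exact: (@C11_approximable _ _ mu (fun=> 0) g 0 z0 quad gK).
Qed.

Lemma tangent_gradient (R : realType) (d : nat) (F : H R d -> R) (G : H R d -> H R d) (C K : R)
    (g : H R d -> 'rV[R]_d -> 'rV[R]_d) (mu : P2 R d) (x : H R d) :
  (forall x, is_gradH F x (G x)) -> 0 <= C ->
  (forall x y, n2 (leb_Omega d) (fun w => G x w - G y w) <=
    C * n2 (leb_Omega d) (fun w => x w - y w)) ->
  0 <= K -> (forall x q q', enorm (g x q - g x q') <= K * enorm (q - q')) ->
  (forall x, n2 (leb_Omega d) (fun w => G x w - g x (x w)) = 0) ->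
  (forall A, measurable A -> mu A = leb_Omega d (x @^-1` A)) -> tangent mu (g x).
Proof.
case: d => [|d] in F G g mu x *; first by move=> *; exact: tangent_dim0.
move=> FG C0 GC K0 gK gG E.
exact: (tangent_lipschitz_grad FG C0 GC K0 gK gG E).
Qed.

Lemma C11_H_C11_P2 (R : realType) (d : nat) (U : P2 R d -> R) : P2_function U ->
  C11_H (lift_P2 U) -> C11_P2 U.
Proof.
(* The constant in [C11_H] has no prescribed sign, whereas the target asks for a nonnegative one. *)
move=> hU [G [FG [C' GC']]]; pose C := `|C'|; have C0 : 0 <= C by exact: normr_ge0.
have sB (x y : H R d) : sqi (leb_Omega d) (fun w => x w - y w).
  by apply: sqiB; exact: H_sqi.
have GC (x y : H R d) : n2 (leb_Omega d) (fun w => G x w - G y w) <=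
    C * n2 (leb_Omega d) (fun w => x w - y w).
  have := GC' x y; rewrite !normHE; [|exact: sB..] => /le_trans; apply.
  by rewrite ler_wpM2r ?n2_ge0// ler_norm.
have C1 : 0 < C + 1 by rewrite ltr_wpDl.
have [g Hg] := choice (grad_structure hU FG C0 GC).
have [X HX] := choice (@law_exists R d).
have K0 : 0 <= d%:R * C by rewrite mulr_ge0.
have gK (x : H R d) q q' : enorm (g x q - g x q') <= d%:R * C * enorm (q - q').
  by have [+ _ _] := Hg x; exact.
have gG (x : H R d) : n2 (leb_Omega d) (fun w => G x w - g x (x w)) = 0.
  by have [_ + _] := Hg x.
have quad mu nu gamma : optimal mu nu gamma ->
    `|U nu - U mu - first_order (g (X mu)) gamma| <= C * W2 mu nu ^+ 2.
  (* The plan is carried by some pair (x, y), and [x] need not be the map [X mu] that defines the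
     gradient; [grad_same_law] shows that [g (X mu)] also represents [G x]. *)
  move=> og; have [x [y [gE muE nuE]]] := coupling_law og.1.
  have XxE A : measurable A -> leb_Omega d (X mu @^-1` A) = leb_Omega d (x @^-1` A).
    by move=> mA; rewrite -HX// muE.
  have Gx := grad_same_law hU FG XxE (gK (X mu)) (gK x) (gG (X mu)) (gG x).
  have -> : U mu = lift_P2 U x by apply: hU => A mA; exact: muE.
  have -> : U nu = lift_P2 U y by apply: hU => A mA; exact: nuE.
  have mg : measurable_fun setT (g (X mu)) :=
    continuous_measurable_rV (lipschitz_continuous (gK (X mu))).
  have sg : sqi (leb_Omega d) (g (X mu) \o x).
    exact: (sqi_lipschitz (leb_Omega_fin R d) (gK (X mu)) (H_sqi x)).
  have sG := H_sqi (G x).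
  rewrite (first_order_law mg sg gE) (W2_optimal og) (cost_law gE).
  rewrite sqr_sqrtr ?exprn_ge0 ?n2_ge0//=.
  have -> : ip (leb_Omega d) (g (X mu) \o x) (fun w => y w - x w) =
      ip (leb_Omega d) (G x) (fun w => y w - x w).
    by apply/esym/eqP; rewrite -subr_eq0 -ipBl// ip_null//; exact: sqiB.
  exact: lipschitz_grad_taylor.
split.
  exists G; split=> // x e e0; exists (e / (C + 1)); first exact: divr_gt0.
  move=> y; rewrite !normHE; [|exact: sB..]; rewrite ltr_pdivlMr// => h.
  apply: (le_lt_trans (GC y x)); apply: le_lt_trans h.
  by rewrite mulrC ler_wpM2l ?n2_ge0// lerDl.
exists (fun mu => g (X mu)); split.
  move=> mu; split; first exact: (tangent_gradient FG C0 GC K0 gK gG (HX mu)).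
  (* Below this distance the quadratic remainder C W2^2 is at most e W2; the 1 covers the case C =
     0. *)
  move=> e e0; exists (e / (C + 1)); first exact: divr_gt0.
  move=> nu gamma og; rewrite ltr_pdivlMr// => h; apply: (le_trans (quad _ _ _ og)).
  have W0 : 0 <= W2 mu nu by exact: sqrtr_ge0.
  rewrite expr2 mulrA ler_wpM2r//; apply: le_trans (ltW h).
  by rewrite mulrC ler_wpM2l// lerDl.
exists C; split=> // mu q q' sq sq'.
have spt_X u : spt mu u -> spt (sharp (X mu)) u.
  move=> su V oV; have := su V oV.
  by rewrite HX//; apply: open_measurable_rV; case: oV.
by have [_ _ +] := Hg (X mu); apply; exact: spt_X.
Qed.

Theorem lemma3p11 (R : realType) (d : nat) (U : P2 R d -> R)
  (hU : P2_function U) : C11_P2 U <-> C11_H (lift_P2 U).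
Proof. by split; [exact: C11_P2_C11_H|exact: C11_H_C11_P2]. Qed.
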